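(* There is no reduced square-tiled surface of genus two whose Veech group is equal to $SL_2(\mathbb Z)$.
   Context: A translation surface is a closed connected surface obtained from Euclidean polygons in the plane by gluing sides in parallel opposite pairs by translations, considered up to cut-and-paste equivalence. A square-tiled surface (STS) is a translation surface obtained by gluing finitely many unit squares along parallel opposite sides by translations; equivalently a translation surface covering the square torus $\mathbb T=\mathbb R^2/\mathbb Z^2$ branched over only one point. An STS is reduced if the only genus-one STS that it covers (branched over a single point) is the one-square torus $\mathbb T$. Equivalently, for an STS with cone points, the lattice generated by the holonomy vectors (displacement vectors of saddle connections, i.e. straight segments joining cone points with no cone points in the interior) is $\mathbb Z^2$. $SL_2(\mathbb R)$ acts on translation surfaces by acting linearly on the defining polygons in $\mathbb R^2$ while keeping the same side identifications. The Veech group of a translation surface is its stabilizer in $SL_2(\mathbb R)$ under this action. *)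

(* Defs.v *)
From HB Require Import structures.
From mathcomp Require Import all_boot all_order all_algebra all_fingroup.
From mathcomp Require Import classical_sets reals.
From Stdlib Require Import Relation_Operators.

Set Implicit Arguments.
Unset Strict Implicit.
Unset Printing Implicit Defensive.
Import Order.TTheory GRing.Theory Num.Theory.
Local Open Scope ring_scope.

(* A finite cyclic sequence of side vectors, given by a permutation [next] of
   a finite set of sides, is a polygon of the plane up to translation: the
   polygon of [d] has its corners at the partial sums of the side vectors. *)
Section Polygon.
Variables (R : realType) (D : finType) (next : {perm D}) (vec : D -> 'cV[R]_2).

Definition nsides (d : D) : nat := #|porbit next d|.

Definition side_vec (d : D) (i : nat) : 'cV[R]_2 := vec (iter i next d).

Definition corner (d : D) (k : nat) : 'cV[R]_2 := \sum_(i < k) side_vec d i.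

Definition closed_polygon (d : D) : Prop := corner d (nsides d) = 0.

Definition simple_polygon (d : D) : Prop :=
  forall (i j : nat) (s t : R),
    (i < nsides d)%N -> (j < nsides d)%N -> 0 <= s < 1 -> 0 <= t < 1 ->
    corner d i + s *: side_vec d i = corner d j + t *: side_vec d j ->
    i = j /\ s = t.

(* Shoelace formula. *)
Definition twice_signed_area (d : D) : R :=
  \sum_(i < nsides d) \det (row_mx (corner d i) (side_vec d i) : 'M[R]_2).

(* A simple polygon, with its boundary traversed counterclockwise. *)
Definition euclidean_polygon (d : D) : Prop :=
  [/\ closed_polygon d, simple_polygon d & 0 < twice_signed_area d].

End Polygon.

(* Polygons glued along their sides. The elements of [side] are the sides of
   all the polygons, [next] is the next side counterclockwise on the same
   polygon, so that the polygons are the cycles of [next], and [glue] is the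
   side to which a side is glued. Since all the polygons are traversed
   counterclockwise, two sides are glued by a translation, with the polygons
   on opposite sides, exactly when their vectors are opposite. *)
Record translation_surface (R : realType) : Type := TranslationSurface {
  side : finType;
  next : {perm side};
  glue : {perm side};
  vec : side -> 'cV[R]_2;
  polygonP : forall d, euclidean_polygon next vec d;
  glueK : forall d, glue (glue d) = d;
  vec_glue : forall d, vec (glue d) = - vec d;
  connectedP : exists d0, forall d,
    connect (fun x y => (y == next x) || (y == glue x)) d0 d
}.
Arguments TranslationSurface {R} _ _ _ _ _ _ _ _.
Arguments side {R} _.
Arguments next {R} _.
Arguments glue {R} _.
Arguments vec {R} _ _.

Section Topology.
Variable R : realType.
Implicit Types X Y : translation_surface R.

(* [next (glue d)] is the side that follows [d] in the rotation around the
   initial endpoint of [d]: the vertices of the surface are the cycles of this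
   permutation, and [glue X * next X] applies [glue X] first. *)
Definition vertex_perm X : {perm side X} := (glue X * next X)%g.

Definition vertex X (d : side X) : {set side X} := porbit (vertex_perm X) d.

Definition euler_char X : int :=
  #|porbits (vertex_perm X)|%:Z - #|porbits (glue X)|%:Z
  + #|porbits (next X)|%:Z.

Definition has_genus X (g : nat) : Prop := euler_char X = 2 - 2 * g%:Z.

End Topology.

Section CutAndPaste.
Variable R : realType.
Implicit Types X Y : translation_surface R.

Definition side_morphism X Y (f : side X -> side Y) : Prop :=
  forall d, [/\ f (next X d) = next Y (f d),
                f (glue X d) = glue Y (f d) & vec Y (f d) = vec X d].

Definition relabelling X Y : Prop :=
  exists2 f : side X -> side Y, bijective f & side_morphism f.

(* A new vertex on the edge formed by [a] and [glue a]: [a] becomes [old a]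
   followed by [b], and [glue a] becomes [old (glue a)] followed by [b']. *)
Definition edge_cut X Y : Prop :=
  exists (h : side X + bool -> side Y) (a : side X) (t : R),
  let old d := h (inl d) in
  let b := h (inr true) in
  let b' := h (inr false) in
  [/\ bijective h, 0 < t < 1,
      (forall d, next Y (old d) =
         if d == a then b else if d == glue X a then b'
         else old (next X d)) /\
      next Y b = old (next X a) /\
      next Y b' = old (next X (glue X a)),
      (forall d, d != a -> d != glue X a ->
         glue Y (old d) = old (glue X d)) /\
      glue Y (old a) = b' /\
      glue Y b = old (glue X a) &
      (forall d, d != a -> d != glue X a -> vec Y (old d) = vec X d) /\
      vec Y (old a) = t *: vec X a /\
      vec Y b = (1 - t) *: vec X a].

(* A polygon is cut along the segment joining the initial endpoints of two of
   its sides [a] and [b]. The pieces are [a], ..., up to the side before [b],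
   closed by [e], and [b], ..., up to the side before [a], closed by [e'];
   [e] and [e'] are glued. The vector of [e] is forced by the closedness of
   the pieces, and the segment lies inside the polygon because the polygon and
   both pieces are simple and counterclockwise. *)
Definition polygon_cut X Y : Prop :=
  exists (h : side X + bool -> side Y) (a b : side X),
  let old d := h (inl d) in
  let e := h (inr true) in
  let e' := h (inr false) in
  [/\ bijective h, a != b /\ b \in porbit (next X) a,
      (forall d, next Y (old d) =
         if next X d == b then e else if next X d == a then e'
         else old (next X d)) /\
      next Y e = old a /\
      next Y e' = old b,
      (forall d, glue Y (old d) = old (glue X d)) /\ glue Y e = e' &
      forall d, vec Y (old d) = vec X d].

Definition cut X Y : Prop :=
  [\/ relabelling X Y, edge_cut X Y | polygon_cut X Y].

(* Pasting is the inverse of cutting. Polygons being taken up to translation,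
   moving the pieces needs no separate step. *)
Definition cut_paste_equiv : translation_surface R -> translation_surface R -> Prop :=
  clos_refl_sym_trans (translation_surface R) cut.

End CutAndPaste.

Section SquareTiled.
Variable R : realType.
Implicit Types X Y Q : translation_surface R.

Definition e1 : 'cV[R]_2 := delta_mx 0 0.
Definition e2 : 'cV[R]_2 := delta_mx 1 0.

Definition quarter_turn (v : 'cV[R]_2) : 'cV[R]_2 :=
  v 0 0 *: e2 - v 1 0 *: e1.

Definition made_of_unit_squares Q : Prop :=
  forall d : side Q,
    [/\ nsides (next Q) d = 4%N, vec Q d \in [:: e1; e2; - e1; - e2] &
        vec Q (next Q d) = quarter_turn (vec Q d)].

Definition square_tiled X : Prop :=
  exists2 Q, made_of_unit_squares Q & cut_paste_equiv X Q.

Definition one_square_torus X : Prop :=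
  exists Q, [/\ made_of_unit_squares Q, #|porbits (next Q)| = 1%N &
                cut_paste_equiv X Q].

(* A translation covering, branched over at most one point, sends polygons to
   polygons once the presentations are cut suitably; it can then be branched
   only over vertices. It is unbranched at the vertex of [d] when as many
   sides leave that vertex as leave its image. *)
Definition covers_branched_over_one_point X Y : Prop :=
  exists (X' Y' : translation_surface R) (f : side X' -> side Y'),
  [/\ cut_paste_equiv X X', cut_paste_equiv Y Y', side_morphism f &
      exists w : side Y', forall d : side X',
        f d \notin vertex w -> #|vertex d| = #|vertex (f d)|].

Definition reduced X : Prop :=
  forall Y, square_tiled Y -> has_genus Y 1 ->
    covers_branched_over_one_point X Y -> one_square_torus Y.

End SquareTiled.

Section LinearAction.
Variables (R : realType) (A : 'M[R]_2) (hA : \det A = 1).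
Variable X : translation_surface R.

Let Avec (d : side X) : 'cV[R]_2 := A *m vec X d.

Let act_corner d k : corner (next X) Avec d k = A *m corner (next X) (vec X) d k.
Proof. by rewrite /corner mulmx_sumr. Qed.

Lemma act_polygonP d : euclidean_polygon (next X) Avec d.
Proof.
have [clo sim pos] := polygonP (t := X) d; split.
- by rewrite /closed_polygon act_corner clo mulmx0.
- move=> i j s t hi hj hs ht; rewrite !act_corner /side_vec /Avec.
  rewrite !scalemxAr -!mulmxDr => eqA.
  have uA : A \in unitmx by rewrite unitmxE hA unitr1.
  by apply: sim => //; have /(congr1 (mulmx (invmx A))) := eqA; rewrite !mulKmx.
- rewrite /twice_signed_area; under eq_bigr => i _.
    rewrite act_corner /side_vec /Avec -mul_mx_row det_mulmx hA mul1r; over.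
  exact: pos.
Qed.

Lemma act_vec_glue d : Avec (glue X d) = - Avec d.
Proof. by rewrite /Avec vec_glue mulmxN. Qed.

Definition act : translation_surface R :=
  TranslationSurface (side X) (next X) (glue X) Avec act_polygonP
    (glueK (t := X)) act_vec_glue (connectedP X).

End LinearAction.

Local Open Scope classical_set_scope.

Definition Veech_group (R : realType) (X : translation_surface R) : set 'M[R]_2 :=
  [set A | exists hA : \det A = 1, cut_paste_equiv (act hA X) X].

Definition SL2Z (R : realType) : set 'M[R]_2 :=
  [set A | \det A = 1 /\ forall i j, A i j \is a Num.int].
Arguments SL2Z : clear implicits.

(* Main.v *)
From mathcomp Require Import all_boot all_order all_algebra all_fingroup.
From mathcomp Require Import boolp reals.
From mathcomp Require classical_sets set_interval cardinality constructive_ereal ereal measure lebesgue_measure.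
From mathcomp Require Import ring lra zify.
From Stdlib Require Import Relation_Operators.
Require Import Defs.

(* Let [Q] be made of unit squares, and let the permutations [h] and [v] send a
   square to its right and upper neighbours. Suppose that shearing [Q] by
   [A = (1 1; 0 1)] gives a surface that is cut-and-paste equivalent to [Q].
   Straight trajectories that avoid the vertices survive cutting and pasting.
   Start from a point whose coordinates are generic over a countable ring
   containing all the side vectors. On the sheared surface, following the
   images of the unit vectors for a unit time realizes [h] and [v]; on [Q]
   itself, following [e1] and [e1 + e2] realizes [h] and [hv] or [vh],
   according to which side of the square is met first. Matching the two gives
   a permutation of the squares that fixes [h] and sends [v] to [hv] under
   conjugation. The shear [(1 0; 1 1)] gives one that fixes [v] and sends [h]
   to [vh]. Hence the monodromy group has a large group of symmetries, all of
   which fix the commutator [c] of [h] and [v]. By the Euler characteristic, in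
   genus two [c] is a 3-cycle or a product of two transpositions, and neither
   is compatible with these symmetries.

   That a trajectory cannot leave or enter a piece except through its sides is
   proved with winding numbers: the winding number of a simple counterclockwise
   polygon is 0 or 1 off the boundary, because just left of the boundary it has
   a constant value, just right of it one less, and the area is positive. *)

Set Implicit Arguments.
Unset Strict Implicit.
Unset Printing Implicit Defensive.
Import Order.TTheory GRing.Theory Num.Theory.

(** * Permutations *)

(** The two symmetries lift generators of SL2(Z). Certain words in them lift elements of order four
    and three, and the fourth, respectively third, power of such a lift acts on [h] and [v] as
    conjugation by [c]. Composing that power with the inverse of [c] gives a permutation commuting
    with [h] and [v], a translation automorphism [t] of the surface. It is not trivial: the power
    fixes points that [c] moves. If [c] is a product of two transpositions, dividing by [t] makes
    [h] and [v] commute, so the quotient is a torus with two marked points. The translation between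
    them is preserved up to sign by the symmetries; the lift of order four makes it a translation of
    order two, and an element of order three fixes no such translation. On the geometric side a cut
    is purely combinatorial data: nothing in it places the new polygons inside the old one, or keeps
    two pieces from overlapping. Such facts are extracted from winding numbers at generic points.
    The resulting invariant is only a relation that carries trajectories from one surface to the
    other; no homeomorphism is built. *)

Lemma partition_porbits (T : finType) (s : {perm T}) : partition (porbits s) [set: T].
Proof.
apply/and3P; split.
- apply/eqP/setP=> x; rewrite inE; apply/bigcupP; exists (porbit s x); last exact: porbit_id.
  exact: imset_f.
- apply/trivIsetP=> A B /imsetP[x _ ->] /imsetP [y _ ->] ne.
  rewrite -setI_eq0; apply/eqP/setP=> z; rewrite !inE; apply/negP=> /andP[zx zy].
  by case/eqP: ne; rewrite -!eq_porbit_mem in zx zy; rewrite -(eqP zx) (eqP zy).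
- by apply/negP=> /imsetP [x _ /setP/(_ x)]; rewrite porbit_id inE.
Qed.

Lemma perm_closedV (T : finType) (P : T -> Prop) (p : {perm T}) :
  (forall x, P x -> P (p x)) -> forall x, P x -> P (p^-1%g x).
Proof.
move=> hp x px; rewrite invg_expg permX.
by elim: #[p]%g.-1 => //= i; apply: hp.
Qed.

Section Permutations.
Import GroupScope.

(** * Permutations with two cycles fewer than points *)

Section CycleTypes.
Variable (E : finType).
Implicit Types (c : {perm E}) (x y z : E).

Lemma porbit_iter c x y : y \in porbit c x -> exists2 i, (i < #|porbit c x|)%N & y = (c ^+ i) x.
Proof. by rewrite porbit_traject => /trajectP [i hi ->]; exists i; rewrite // permX. Qed.

Lemma porbit_exp c x : (c ^+ #|porbit c x|) x = x.
Proof. by rewrite permX; apply: iter_porbit. Qed.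

(** A cycle of length l contributes l - 1 to the difference between the number of points and the
    number of cycles. A total of 2 leaves one cycle of length three or two of length two. *)
Lemma two_excess c : (#|porbits c| + 2)%N = #|E| ->
  (exists x, [/\ c x != x, c (c x) != x, c (c (c x)) = x &
     forall z, c z != z -> z \in [:: x; c x; c (c x)]]) \/
  (exists x y, [/\ c x != x, c (c x) = x, c y != y, c (c y) = y &
     y \notin [:: x; c x] /\ forall z, c z != z -> z \in [:: x; c x; y; c y]]).
Proof.
move=> h.
have card1 O : O \in porbits c -> (0 < #|O|)%N.
  by move=> /imsetP [x _ ->]; rewrite card_gt0; apply/set0Pn; exists x; apply: porbit_id.
have sumE : (\sum_(O in porbits c) (#|O| - 1))%N = 2.
  have : (\sum_(O in porbits c) #|O|)%N = #|E|.
    by rewrite -cardsT (card_partition (partition_porbits c)).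
  rewrite (eq_bigr (fun O : {set E} => (#|O| - 1) + 1))%N; last by move=> O /card1; lia.
  rewrite big_split /= sum1_card => es.
  by apply/eqP; rewrite -(eqn_add2r #|porbits c|) es -h addnC.
have mem x : porbit c x \in porbits c by apply: imset_f.
have fixpt x : #|porbit c x| = 1%N -> c x = x.
  by move=> h1; have := porbit_exp c x; rewrite h1 expg1.
have [/existsP [x hx]|/existsPn all1] := boolP [exists x, (1 < #|porbit c x|)%N]; last first.
  move: sumE; rewrite big1 // => O /imsetP [x _ ->].
  have := all1 x; have := card1 _ (mem x); rewrite -leqNgt.
  by move: #|_| => k; case: k => [|[|]].
have rest y : y \notin porbit c x -> (#|porbit c x| - 1 + (#|porbit c y| - 1) <= 2)%N.
  move=> hy; rewrite -sumE (bigD1 (porbit c x)) //= leq_add2l.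
  rewrite (bigD1 (porbit c y)) ?leq_addr //= mem /=.
  by apply: contra hy => /eqP <-; apply: porbit_id.
have le3 : (#|porbit c x| - 1 <= 2)%N.
  by rewrite -sumE (bigD1 (porbit c x)) //= leq_addr.
have nx : c x != x.
  apply/eqP=> e; have : porbit c x = [set x].
    apply/setP=> z; rewrite inE; apply/idP/eqP=> [/porbit_iter [i _ ->]|->]; last exact: porbit_id.
    by elim: i => [|i IH]; rewrite ?perm1 // expgS permM e.
  by move=> e1; move: hx; rewrite e1 cards1.
have [e3|e2] : #|porbit c x| = 3 \/ #|porbit c x| = 2 by lia.
- left; exists x; have c3 := porbit_exp c x; rewrite e3 !expgS expg0 mulg1 !permM in c3.
  split=> //.
    apply/eqP=> c2; move: nx; rewrite -[X in _ != X]c3 c2 => /eqP; apply.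
    by [].
  move=> z nz; have : z \in porbit c x.
    apply: contraNT nz => nz; apply/eqP/fixpt.
    by have := rest z nz; rewrite e3; have := card1 _ (mem z); lia.
  move=> /porbit_iter [i]; rewrite e3; case: i => [|[|[|//]]] _ ->;
    by rewrite !inE ?expgS ?expg0 ?mulg1 ?permM ?perm1 eqxx ?orbT.
- right; have c2 := porbit_exp c x; rewrite e2 !expgS expg0 mulg1 !permM in c2.
  have [/existsP [y /andP[hy ny]]|/existsPn all1] :=
     boolP [exists y, (1 < #|porbit c y|)%N && (y \notin porbit c x)]; last first.
    move: sumE; rewrite (bigD1 (porbit c x)) //= e2 big1 // => O /andP[/imsetP [y _ ->] ne].
    have := all1 y; rewrite negb_and negbK => /orP[|yx].
      by have := card1 _ (mem y); lia.
    by move: ne; rewrite -eq_porbit_mem in yx; rewrite (eqP yx) eqxx.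
  have ey : #|porbit c y| = 2 by have := rest y ny; lia.
  have d2 := porbit_exp c y; rewrite ey !expgS expg0 mulg1 !permM in d2.
  exists x, y; split=> //.
    apply/eqP=> e; have : porbit c y = [set y].
      apply/setP=> z; rewrite inE; apply/idP/eqP=> [/porbit_iter [i _ ->]|->]; last exact: porbit_id.
      by elim: i => [|i IH]; rewrite ?perm1 // expgS permM e.
    by move=> e1; move: hy; rewrite e1 cards1.
  split.
    rewrite !inE; apply: contra ny => /orP[/eqP ->|/eqP ->]; first exact: porbit_id.
    by rewrite -{1}[c]expg1 mem_porbit.
  move=> z nz.
  have : (z \in porbit c x) || (z \in porbit c y).
    apply: contraNT nz; rewrite negb_or => /andP[z1 z2]; apply/eqP/fixpt.
    have ne1 : porbit c y != porbit c x.
      by apply: contra ny => /eqP <-; apply: porbit_id.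
    have ne2 : porbit c z != porbit c x.
      by apply: contra z1 => /eqP <-; apply: porbit_id.
    have ne3 : porbit c z != porbit c y.
      by apply: contra z2 => /eqP <-; apply: porbit_id.
    move: sumE; rewrite (bigD1 (porbit c x)) //= (bigD1 (porbit c y)) /= ?mem //.
    rewrite (bigD1 (porbit c z)) /= ?mem ?ne2 ?ne3 // e2 ey.
    by have := card1 _ (mem z); lia.
  move=> /orP[] /porbit_iter [i]; rewrite ?e2 ?ey; case: i => [|[|//]] _ ->;
    by rewrite !inE ?expg1 ?expg0 ?perm1 eqxx ?orbT.
Qed.

End CycleTypes.

(** * Lifts of elements of SL2(Z) acting on words in [h] and [v] *)

Section Words.
Variables (gT : finGroupType) (h v psi chi : gT).
Hypotheses (hpsi : h ^ psi = h) (vpsi : v ^ psi = h * v).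
Hypotheses (hchi : h ^ chi = v * h) (vchi : v ^ chi = v).

(** On the abelianization [sigma] sends h to -v and v to h, a matrix of order four, while [rho]
    sends h to -v and v to h - v, a matrix of order three. *)
Definition sigma : gT := psi * chi^-1 * psi.
Definition rho : gT := psi * chi^-1 * (psi * chi^-1).
Let c := [~ h, v].

Let wordE := (@mulgA gT, @invMg gT, @invgK gT, @mulgK gT, @mulgKV gT, @mulVg gT, @mulgV gT,
  @mul1g gT, @mulg1 gT).

Let vchi' : v ^ chi^-1 = v.
Proof. by apply: (can_inj (conjgK chi)); rewrite conjgKV vchi. Qed.

Let hchi' : h ^ chi^-1 = v^-1 * h.
Proof. by apply: (can_inj (conjgK chi)); rewrite conjgKV conjMg conjVg vchi hchi mulKg. Qed.

Lemma h_sigma : h ^ sigma = v^-1.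
Proof. by rewrite !conjgM hpsi hchi' conjMg conjVg vpsi hpsi !wordE. Qed.

Lemma v_sigma : v ^ sigma = v^-1 * h * v.
Proof.
by rewrite !conjgM vpsi (conjMg h v) vchi' hchi' !conjMg conjVg vpsi hpsi !wordE.
Qed.

Let h_rho0 : h ^ (psi * chi^-1) = v^-1 * h.
Proof. by rewrite conjgM hpsi hchi'. Qed.

Let v_rho0 : v ^ (psi * chi^-1) = v^-1 * h * v.
Proof. by rewrite conjgM vpsi conjMg hchi' vchi'. Qed.

Lemma h_rho : h ^ rho = v^-1.
Proof. by rewrite conjgM h_rho0 conjMg conjVg h_rho0 v_rho0 !wordE. Qed.

Lemma v_rho : v ^ rho = v^-1 * v^-1 * h * v.
Proof. by rewrite conjgM v_rho0 !conjMg conjVg h_rho0 v_rho0 !wordE. Qed.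

Let c_psi : c ^ psi = c.
Proof. by rewrite /c conjRg hpsi vpsi /commg /conjg !wordE. Qed.

Let c_chi : c ^ chi = c.
Proof. by rewrite /c conjRg hchi vchi /commg /conjg !wordE. Qed.

Let c_chi' : c ^ chi^-1 = c.
Proof. by apply: (can_inj (conjgK chi)); rewrite conjgKV c_chi. Qed.

Lemma c_sigma : c ^ sigma = c.
Proof. by rewrite !conjgM c_psi c_chi' c_psi. Qed.

Lemma c_rho : c ^ rho = c.
Proof. by rewrite !conjgM c_psi c_chi' c_psi c_chi'. Qed.

Let conj_c x : x ^ c = v^-1 * h^-1 * v * h * x * h^-1 * v^-1 * h * v.
Proof. by rewrite /c /commg /conjg !wordE. Qed.

(** Among automorphisms of the free group on [h] and [v] the relation of order four holds only up to
    an inner automorphism, and that one is conjugation by the commutator. The same happens in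
    [rho3]. *)
Lemma sigma4 : h ^ (sigma ^+ 4) = h ^ c /\ v ^ (sigma ^+ 4) = v ^ c.
Proof.
have -> : sigma ^+ 4 = sigma * sigma * (sigma * sigma) by rewrite !expgS expg0 !wordE.
have h2 : h ^ (sigma * sigma) = v^-1 * h^-1 * v.
  by rewrite conjgM h_sigma conjVg v_sigma !wordE.
have v2 : v ^ (sigma * sigma) = v^-1 * h^-1 * v^-1 * h * v.
  by rewrite conjgM v_sigma 2!conjMg conjVg h_sigma v_sigma !wordE.
move: (sigma * sigma) h2 v2 => s2 h2 v2.
by rewrite !conj_c !(conjgM _ s2) h2 v2 !conjMg !conjVg h2 v2 !wordE.
Qed.

Lemma rho3 : h ^ (rho ^+ 3) = h ^ c /\ v ^ (rho ^+ 3) = v ^ c.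
Proof.
have -> : rho ^+ 3 = rho * rho * rho by rewrite !expgS expg0 !wordE.
have h2 : h ^ (rho * rho) = v^-1 * h^-1 * v * v.
  by rewrite conjgM h_rho conjVg v_rho !wordE.
have v2 : v ^ (rho * rho) = v^-1 * h^-1 * v * h^-1 * v^-1 * h * v.
  by rewrite conjgM v_rho !conjMg conjVg h_rho v_rho !wordE.
rewrite !conj_c !(conjgM _ (rho * rho)) h2 v2.
by rewrite !conjMg !conjVg h_rho v_rho !wordE.
Qed.

End Words.

(** * The centralizer of the monodromy group *)

Section Obstruction.
Variables (E : finType) (h v psi chi : {perm E}).
Hypothesis trans : forall P : E -> Prop, (exists x, P x) ->
  (forall x, P x -> P (h x) /\ P (v x)) -> forall x, P x.
Hypotheses (hpsi : h ^ psi = h) (vpsi : v ^ psi = h * v).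
Hypotheses (hchi : h ^ chi = v * h) (vchi : v ^ chi = v).

Local Notation c := [~ h, v].
Local Notation s := (sigma psi chi).
Local Notation r := (rho psi chi).
Implicit Types (x y z : E) (t g k : {perm E}).

Lemma conj_commute g k : g ^ k = g -> commute g k.
Proof. by move=> e; rewrite /commute -{2}e /conjg !mulgA mulgV mul1g. Qed.

(** The fixed points of a permutation that commutes with [h] and [v] form an invariant set, so by
    transitivity one fixed point is enough. *)
Lemma semiregular t z : commute h t -> commute v t -> t z = z -> t = 1.
Proof.
move=> ht vt tz; apply/permP=> x; rewrite perm1.
apply: (trans (P := fun x => t x = x)); first by exists z.
move=> {}x tx; split.
  by rewrite -permM ht permM tx.
by rewrite -permM vt permM tx.
Qed.

Lemma commute_permE g k x : commute g k -> k (g x) = g (k x).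
Proof. by move=> e; rewrite -!permM e. Qed.

Let cs : commute c s. Proof. exact: conj_commute (c_sigma hpsi vpsi hchi vchi). Qed.
Let cr : commute c r. Proof. exact: conj_commute (c_rho hpsi vpsi hchi vchi). Qed.

(** The source of translation automorphisms: a power of a symmetry that acts like [c] differs from
    [c] by an element of the centralizer. *)
Lemma tau_commute g n : h ^ (g ^+ n) = h ^ c -> v ^ (g ^+ n) = v ^ c ->
  commute h (g ^+ n * c^-1) /\ commute v (g ^+ n * c^-1).
Proof.
by move=> e1 e2; split; apply: conj_commute; rewrite conjgM ?e1 ?e2 conjgK.
Qed.

Lemma commute_c t : commute h t -> commute v t -> commute c t.
Proof.
move=> ht vt; have hc : h ^ t = h by rewrite /conjg ht mulKg.
have vc : v ^ t = v by rewrite /conjg vt mulKg.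
by apply: conj_commute; rewrite conjRg hc vc.
Qed.

End Obstruction.

(** * Transfer to Z/3 along cycles of length three *)

Section Transfer.
Variables (E : finType) (t : {perm E}).
Hypothesis t3 : forall x, t (t (t x)) = x.
Hypothesis tfree : forall x, t x != x.
Implicit Types (x y : E) (g k : {perm E}).

(** The choice is made from the cycle as a set, so it is the same for all its points; the default
    [x] is never taken. *)
Let rep x : E := odflt x [pick y in porbit t x].

Let rep_in x : rep x \in porbit t x.
Proof. by rewrite /rep; case: pickP => [y|/(_ x)]; rewrite /= ?porbit_id. Qed.

Let rep_t x : rep (t x) = rep x.
Proof.
have e : porbit t (t x) = porbit t x by have := porbit_perm t 1 x; rewrite expg1.
rewrite /rep e; case: pickP => // /(_ x); by rewrite porbit_id.
Qed.

Let level_spec x : [|| x == rep x, x == t (rep x) | x == t (t (rep x))].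
Proof.
have : x \in porbit t (rep x) by rewrite porbit_sym rep_in.
move: (rep x) => y /porbit_iter [i _ ->]; elim: i => [|i IH]; first by rewrite expg0 perm1 eqxx.
rewrite expgSr permM.
by case/or3P: IH => /eqP ->; rewrite ?t3 eqxx ?orbT.
Qed.

Let t_inj2 x : t (t x) != x.
Proof. by apply/eqP=> e; have := t3 x; rewrite e => e'; move: (tfree x); rewrite e' eqxx. Qed.

Let level x : 'Z_3 := if x == rep x then 0%R else if x == t (rep x) then 1%R else 2%:R%R.

Let level_t x : level (t x) = (level x + 1)%R.
Proof.
move: (level_spec x); rewrite /level rep_t; move: (rep x) => y.
by case/or3P => /eqP ->; rewrite ?t3 ?eqxx ?(negbTE (t_inj2 _)) ?(negbTE (tfree _)) ?add0r //;
  apply: val_inj.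
Qed.

Let rep_iter i x : rep ((t ^+ i) x) = rep x.
Proof. by elim: i => [|i IH]; rewrite ?expg0 ?perm1 // expgSr permM rep_t. Qed.

Let rep_rep x : rep (rep x) = rep x.
Proof. by have /porbit_iter [i _ e] := rep_in x; rewrite {1}e rep_iter. Qed.

Let level_rep x : level (rep x) = 0%R.
Proof. by rewrite /level rep_rep eqxx. Qed.

(** The centralizer of [t] is a wreath product of Z/3 by the symmetric group on the cycles of [t].
    This is the sum of the Z/3 coordinates, a homomorphism to an abelian group. *)
Definition transfer g : 'Z_3 := (\sum_(x | rep x == x) level (g x))%R.

Let level_iter i x : level ((t ^+ i) x) = (level x + i%:R)%R.
Proof.
elim: i => [|i IH]; first by rewrite expg0 perm1 addr0.
by rewrite expgSr permM level_t IH -addrA natr1.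
Qed.

Let level_shift k x : commute k t -> level (k x) = (level (k (rep x)) + level x)%R.
Proof.
move=> kt; have /porbit_iter [i _ e] : x \in porbit t (rep x) by rewrite porbit_sym rep_in.
have ki : k ((t ^+ i) (rep x)) = (t ^+ i) (k (rep x)).
  by rewrite -!permM; rewrite (commuteX i kt).
have lx : level x = i%:R%R by rewrite {1}e level_iter level_rep add0r.
by rewrite lx {1}e ki level_iter.
Qed.

Let rep_commute g x : commute g t -> rep (g (rep x)) = rep (g x).
Proof.
move=> gt; have /porbit_iter [i _ ->] := rep_in x; have ti : commute g (t ^+ i) by apply: commuteX.
by rewrite -permM -ti permM rep_iter.
Qed.

Lemma transferM g k : commute g t -> commute k t ->
  transfer (g * k) = (transfer g + transfer k)%R.
Proof.
move=> gt kt; rewrite /transfer addrC.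
rewrite (eq_bigr (fun x => level (k (rep (g x))) + level (g x))%R); last first.
  by move=> x _; rewrite permM level_shift.
rewrite big_split /=; congr (_ + _)%R; symmetry.
have g't : commute g^-1 t := commute_sym (commuteV (commute_sym gt)).
rewrite (reindex_onto (fun x => rep (g x)) (fun y => rep (g^-1 y))) /=; last first.
  by move=> y /eqP ey; rewrite rep_commute // permKV.
apply: eq_bigl => x; rewrite rep_rep eqxx /=.
by rewrite rep_commute // permK.
Qed.

Lemma transfer_commutator h v : commute h t -> commute v t -> transfer [~ h, v] = 0%R.
Proof.
move=> ht vt; have vh : commute (v * h) t := commute_sym (commuteM (commute_sym vt) (commute_sym ht)).
have ct : commute [~ h, v] t.
  have th := commute_sym ht; have tv := commute_sym vt.
  apply: commute_sym; rewrite /commg /conjg.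
  exact: commuteM (commuteV th) (commuteM (commuteV tv) (commuteM th tv)).
have e : v * h * [~ h, v] = h * v by rewrite /commg /conjg !mulgA mulgK mulgV mul1g.
have := transferM vh ct; rewrite e (transferM ht vt) (transferM vt ht) => /eqP.
by rewrite [X in X == _]addrC -[X in X == _]addr0 (inj_eq (addrI _)) => /eqP.
Qed.

(** Only the cycle of [x0] contributes, and it contributes 2, which is not zero modulo 3. *)
Lemma transfer_cycle (c : {perm E}) x0 : (forall x, x \in porbit t x0 -> c x = t (t x)) ->
  (forall x, x \notin porbit t x0 -> c x = x) -> transfer c <> 0%R.
Proof.
move=> hin hout; rewrite /transfer (bigD1 (rep x0)) /=; last by rewrite rep_rep.
rewrite hin ?rep_in // !level_t level_rep big1 ?addr0; first by [].
move=> x /andP[/eqP ex nx]; rewrite hout; first by rewrite -ex level_rep.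
apply: contra nx => /porbit_iter [i _ e]; by rewrite -ex e rep_iter.
Qed.

End Transfer.

Lemma perm_exp3 (E : finType) (g : {perm E}) x : (g ^+ 3) x = g (g (g x)).
Proof. by rewrite permX. Qed.

Section ThreeCycle.
Variables (E : finType) (h v psi chi : {perm E}).
Hypothesis trans : forall P : E -> Prop, (exists x, P x) ->
  (forall x, P x -> P (h x) /\ P (v x)) -> forall x, P x.
Hypotheses (hpsi : h ^ psi = h) (vpsi : v ^ psi = h * v).
Hypotheses (hchi : h ^ chi = v * h) (vchi : v ^ chi = v).
Local Notation c := [~ h, v].
Local Notation r := (rho psi chi).

(* The lift [r] of an element of order three commutes with the 3-cycle [c],
   so [r ^+ 3] is trivial on its support, whereas it acts on [h] and [v] as
   [c] does: [r ^+ 3 * c^-1] is a translation automorphism [t] of order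
   three. Transfer to the orbits of [t] then contradicts that [c] is a
   commutator. *)
Lemma commutator_not_3cycle x : c x != x -> c (c x) != x -> c (c (c x)) = x ->
  (forall z, c z != z -> z \in [:: x; c x; c (c x)]) -> False.
Proof.
move=> c1 c2 c3 supp.
have cr : commute c r by apply: conj_commute; apply: c_rho.
have [e1 e2] := rho3 hpsi vpsi hchi vchi.
have [ht vt] := tau_commute e1 e2; set t := r ^+ 3 * c^-1 in ht vt.
have ct := commute_c ht vt.
have crE z : r (c z) = c (r z) by rewrite -!permM cr.
(* Since [r] commutes with [c], it maps [x] into the support of [c] and acts there as a power of the
   3-cycle. *)
have r3 : (r ^+ 3) x = x.
  rewrite perm_exp3.
  have /supp : c (r x) != r x by rewrite -crE (inj_eq perm_inj).
  rewrite !inE => /or3P[] /eqP e; first by rewrite !e.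
    by rewrite !(e, crE) !c3.
  by rewrite !(e, crE) !c3.
have cV : c^-1 x = c (c x) by apply: (@perm_inj _ c); rewrite permKV c3.
have tx : t x = c (c x) by rewrite permM r3 cV.
have ctE z : t (c z) = c (t z) by rewrite -!permM ct.
have t3x : (t ^+ 3) x = x.
  by rewrite perm_exp3 !(tx, ctE) !c3.
have t3 z : t (t (t z)) = z.
  have : t ^+ 3 = 1 by apply: (semiregular trans (z := x)) => //; apply: commuteX.
  by move=> /permP /(_ z); rewrite perm_exp3 perm1.
have tfree z : t z != z.
  apply/eqP=> /(semiregular trans ht vt) t1; move: tx; rewrite t1 perm1 => e.
  by rewrite -e eqxx in c2.
apply: (@transfer_cycle E t t3 tfree c x); last first.
- exact: (transfer_commutator t3 tfree ht vt).
- move=> z; apply: contraNeq => /supp; rewrite !inE => /or3P[]/eqP ->.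
  + exact: porbit_id.
  + have -> : c x = (t ^+ 2) x by rewrite permX /= !(tx, ctE) c3.
    exact: mem_porbit.
  + by rewrite -tx -{1}[t]expg1 mem_porbit.
- move=> z /porbit_iter [i _ ->]; elim: i => [|i IH].
    by rewrite expg0 (perm1 x) !(tx, ctE) c3.
  by rewrite expgSr (permM (t ^+ i) t) -ctE IH.
Qed.

End ThreeCycle.

(** * The case of two transpositions *)

Section Pairs.
Variables (E : finType) (c g : {perm E}) (x y : E).
Hypotheses (cx : c x != x) (ccx : c (c x) = x) (cy : c y != y) (ccy : c (c y) = y).
Hypothesis ny : y \notin [:: x; c x].
Hypothesis supp : forall z, c z != z -> z \in [:: x; c x; y; c y].
Hypothesis cg : forall z, g (c z) = c (g z).

Lemma pairs_permuted :
  (g x \in [:: x; c x] /\ g y \in [:: y; c y]) \/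
  (g x \in [:: y; c y] /\ g y \in [:: x; c x]).
Proof.
have gx : g x \in [:: x; c x; y; c y].
  by apply: supp; rewrite -cg (inj_eq perm_inj).
have gy : g y \in [:: x; c x; y; c y].
  by apply: supp; rewrite -cg (inj_eq perm_inj).
have nyx : g y != g x.
  by rewrite (inj_eq perm_inj); apply: contra ny => /eqP ->; rewrite !inE eqxx.
have nycx : g y != c (g x).
  by rewrite -cg (inj_eq perm_inj); apply: contra ny => /eqP ->; rewrite !inE eqxx orbT.
move: gx gy; rewrite !inE => /or4P[]/eqP ex /or4P[]/eqP ey;
  first [ by move: nyx; rewrite ex ey eqxx
        | by move: nycx; rewrite ex ey ?ccx ?ccy eqxx
        | by left; rewrite ex ey !eqxx ?orbT
        | by right; rewrite ex ey !eqxx ?orbT ].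
Qed.

(** On the four points, [g] lies in the centralizer of a double transposition, a dihedral group of
    order eight, which has exponent four. *)
Lemma pairs_exp4 : (g ^+ 4) x = x.
Proof.
have g2 z : (g ^+ 2) z = g (g z) by rewrite permX.
have h : g (g x) \in [:: x; c x].
  have [[gx gy]|[gx gy]] := pairs_permuted.
    by move: gx; rewrite !inE => /orP[]/eqP e; rewrite !(e, cg) ?ccx ?eqxx ?orbT.
  move: gx gy; rewrite !inE => /orP[]/eqP -> /orP[]/eqP e; by rewrite !(e, cg) ?ccx ?eqxx ?orbT.
rewrite permX /=; move: h; rewrite !inE => /orP[]/eqP e; rewrite !e //.
by rewrite 2!cg e ccx.
Qed.

End Pairs.

Section TwoPairs.
Variables (E : finType) (h v psi chi : {perm E}).
Hypothesis trans : forall P : E -> Prop, (exists x, P x) ->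
  (forall x, P x -> P (h x) /\ P (v x)) -> forall x, P x.
Hypotheses (hpsi : h ^ psi = h) (vpsi : v ^ psi = h * v).
Hypotheses (hchi : h ^ chi = v * h) (vchi : v ^ chi = v).
Local Notation c := [~ h, v].
Local Notation s := (sigma psi chi).
Local Notation r := (rho psi chi).

Section Quotient.
Variable t : {perm E}.
Hypotheses (ht : commute h t) (vt : commute v t) (st : commute s t) (rt : commute r t).
Hypothesis t2 : forall z, t (t z) = z.
Hypothesis ct : forall z, c z = z \/ c z = t z.

Let eqv (z w : E) := (w == z) || (w == t z).

Let eqv_sym z w : eqv z w = eqv w z.
Proof.
by rewrite /eqv eq_sym; congr orb; apply/eqP/eqP => ->; rewrite t2.
Qed.

Let eqv_trans z w u : eqv z w -> eqv w u -> eqv z u.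
Proof.
by rewrite /eqv => /orP[]/eqP -> /orP[]/eqP ->; rewrite ?t2 eqxx ?orbT.
Qed.

Let eqv_refl z : eqv z z. Proof. by rewrite /eqv eqxx. Qed.

Let eqv_perm (g : {perm E}) z w : commute g t -> eqv z w -> eqv (g z) (g w).
Proof.
by move=> gt /orP[]/eqP ->; rewrite /eqv ?eqxx // -!permM gt eqxx orbT.
Qed.

(** The kernel of the action of the centralizer of [t] on the cycles of [t]. Working in the quotient
    group replaces the construction of the set of cycles and of the permutations induced on it. *)
Let N0 := [set g in 'C[t] | [forall z, eqv z (g z)]].

Let N0P g : reflect (commute g t /\ forall z, eqv z (g z)) (g \in N0).
Proof.
rewrite inE; apply: (iffP andP) => [[/cent1P gt /forallP gz]|[gt gz]]; split=> //.
- exact/cent1P.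
- exact/forallP.
Qed.

Let N0_group : group_set N0.
Proof.
apply/group_setP; split.
  by apply/N0P; split=> [|z]; [apply/commute_sym/commute1|rewrite perm1].
move=> a b /N0P [ta ha] /N0P [tb hb]; apply/N0P; split.
  exact: commute_sym (commuteM (commute_sym ta) (commute_sym tb)).
by move=> z; rewrite permM; apply: eqv_trans (ha z) (hb _).
Qed.

Let N := Group N0_group.

Let normN g : commute g t -> g \in 'N(N).
Proof.
move=> gt; rewrite inE; apply/subsetP=> k /imsetP [a /N0P [ta ha] ->].
have at_ : commute (a ^ g) t.
  have tg : t ^ g = t by rewrite /conjg -gt mulKg.
  have taE : a ^ t = a by rewrite /conjg ta mulKg.
  by rewrite -{1}tg; apply: conj_commute; rewrite -conjJg taE.
apply/N0P; split=> // z; rewrite /conjg !permM.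
by rewrite -{1}(permKV g z); apply: eqv_perm.
Qed.

Local Notation q := (coset N).

Let tM g k : commute g t -> commute k t -> commute (g * k) t.
Proof. by move=> gt kt; exact: commute_sym (commuteM (commute_sym gt) (commute_sym kt)). Qed.
Let tV g : commute g t -> commute g^-1 t.
Proof. by move=> gt; exact: commute_sym (commuteV (commute_sym gt)). Qed.
Let tX g n : commute g t -> commute (g ^+ n) t.
Proof. by move=> gt; exact: commute_sym (commuteX n (commute_sym gt)). Qed.

Let qM g k : commute g t -> commute k t -> q (g * k) = q g * q k.
Proof. by move=> gt kt; rewrite morphM ?normN. Qed.
Let qV g : commute g t -> q g^-1 = (q g)^-1.
Proof. by move=> gt; rewrite morphV ?normN. Qed.
Let qX g n : commute g t -> q (g ^+ n) = q g ^+ n.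
Proof. by move=> gt; rewrite morphX ?normN. Qed.
Let qJ g k : commute g t -> commute k t -> q (g ^ k) = q g ^ q k.
Proof. by move=> gt kt; rewrite morphJ ?normN. Qed.

Let q_eqv g k z : commute g t -> commute k t -> q g = q k -> eqv (k z) (g z).
Proof.
move=> gt kt e; have gk := tM (tV kt) gt.
have /coset_idr : q (k^-1 * g) = 1 by rewrite qM ?qV ?e ?mulVg //; apply: tV.
by move=> /(_ (normN gk)) /N0P [_ /(_ (k z))]; rewrite permM permK.
Qed.

Let hv_comm : commute (q h) (q v).
Proof.
have ctt : commute c t := commute_c ht vt.
have cN : c \in N by apply/N0P; split=> // z; rewrite /eqv; case: (ct z) => ->; rewrite eqxx ?orbT.
have e : v * h * c = h * v by rewrite /commg /conjg !mulgA mulgK mulgV mul1g.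
rewrite /commute -!qM // -e qM ?(coset_id cN) ?mulg1 //; exact: tM.
Qed.

(** The analogue of [semiregular] for the action on the cycles of [t]. *)
Let q_regular g x : commute g t -> commute (q g) (q h) -> commute (q g) (q v) ->
  eqv x (g x) -> q g = 1.
Proof.
move=> gt gh gv gx; apply: coset_id; apply/N0P; split=> //.
apply: (trans (P := fun z => eqv z (g z))); first by exists x.
have step k z : commute k t -> commute (q g) (q k) -> eqv z (g z) -> eqv (k z) (g (k z)).
  move=> kt gk gz; apply: eqv_trans (eqv_perm kt gz) _.
  by rewrite -!permM; apply: q_eqv; rewrite ?qM //; apply: tM.
by move=> z gz; split; apply: step.
Qed.

Variables (x y : E).
Hypothesis nxy : ~~ eqv x y.
Hypothesis sxy : (eqv x (s x) && eqv y (s y)) || (eqv y (s x) && eqv x (s y)).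
Hypothesis rxy : (eqv x (r x) && eqv y (r y)) || (eqv y (r x) && eqv x (r y)).

Let H := q h. Let W := q v.
Let H_s : H ^ q s = W^-1.
Proof. by rewrite -qJ // (h_sigma hpsi vpsi hchi vchi) qV. Qed.

Let W_s : W ^ q s = H.
Proof.
have vV := tV vt; have vVh := tM vV ht.
by rewrite -qJ // (v_sigma hpsi vpsi hchi vchi) !qM // qV // -mulgA hv_comm mulKg.
Qed.

Let H_r : H ^ q r = W^-1.
Proof. by rewrite -qJ // (h_rho hpsi vpsi hchi vchi) qV. Qed.

Let W_r : W ^ q r = W^-1 * H.
Proof.
have vV := tV vt; have vVv := tM vV vV; have vVh := tM vVv ht.
by rewrite -qJ // (v_rho hpsi vpsi hchi vchi) !qM // qV // -!mulgA hv_comm mulKg.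
Qed.

(** Modulo [N] the monodromy is abelian and transitive, hence regular: the cycles of [t] are the
    squares of a torus. The translation [d] leads from the cycle of [x] to that of [y]; the
    symmetries force it to be trivial, although the two cycles differ. *)
Lemma two_pairs_false : False.
Proof.
have [i [j dy]] : exists i j, eqv y ((h ^+ i * v ^+ j) x).
  apply: (trans (P := fun y => exists i j, eqv y ((h ^+ i * v ^+ j) x))).
    by exists x, 0%N, 0%N; rewrite !expg0 mulg1 perm1.
  move=> z [i [j e]].
  have hi := tX i ht; have vj := tX j vt; have hivj := tM hi vj.
  split; last first.
    by exists i, j.+1; rewrite expgSr mulgA permM; apply: eqv_perm.
  exists i.+1, j; apply: eqv_trans (eqv_perm ht e) _; rewrite -permM; apply: q_eqv.
  - by apply: tM vj; apply: tX.
  - exact: tM.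
  - rewrite !qM ?qX //; last exact: tX.
    by rewrite expgSr -!mulgA (commuteX j hv_comm).
set d := h ^+ i * v ^+ j in dy.
have dt : commute d t by apply: tM; apply: tX.
have HWi n : commute H (W ^+ n) by apply: commuteX.
have HH n : commute H (H ^+ n) by apply: commuteX.
have WW n : commute W (W ^+ n) by apply: commuteX.
have WHi n : commute W (H ^+ n) by apply: commuteX.
have qd : q d = H ^+ i * W ^+ j by rewrite /d qM ?qX //; apply: tX.
pose cHW (a : coset_of N) := commute a H /\ commute a W.
have cM a b : cHW a -> cHW b -> cHW (a * b).
  by move=> [a1 a2] [b1 b2]; split; apply: commute_sym; apply: commuteM; apply: commute_sym.
have cV a : cHW a -> cHW a^-1.
  by move=> [a1 a2]; split; apply: commute_sym; apply: commuteV; apply: commute_sym.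
have cX a n : cHW a -> cHW (a ^+ n).
  by move=> [a1 a2]; split; apply: commute_sym; apply: commuteX; apply: commute_sym.
have cH : cHW H by split.
have cW : cHW W by split.
have cD : cHW (q d) by rewrite qd; apply: cM; apply: cX.
(* If [g] fixes both cycles, the conjugate of [d] leads again from the first to the second, hence
   equals [d] modulo [N]. If [g] exchanges them it equals the inverse of [d]. Either way conjugating
   twice gives [d] back. *)
have involutive g : commute g t -> cHW (q d ^ q g) ->
    (eqv x (g x) && eqv y (g y)) || (eqv y (g x) && eqv x (g y)) ->
    (q d ^ q g) ^ q g = q d.
  move=> gt cg /orP[]/andP [g1 g2].
  - have dg : commute (d ^ g) t by rewrite /conjg; apply: tM (tV gt) (tM dt gt).
    have : q (d ^ g * d^-1) = 1.
      apply: (@q_regular _ x); first by apply: tM dg (tV dt).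
      + by rewrite qM ?qV ?qJ //; [case: (cM _ _ cg (cV _ cD))|apply: tV].
      + by rewrite qM ?qV ?qJ //; [case: (cM _ _ cg (cV _ cD))|apply: tV].
      rewrite permM -{1}(permK d x); apply: eqv_perm; first exact: tV.
      apply: eqv_trans (_ : eqv (d x) y) _; first by rewrite eqv_sym.
      apply: eqv_trans g2 _; apply: eqv_trans (eqv_perm gt dy) _.
      rewrite -[g (d x)](_ : (d ^ g) (g x) = _); last by rewrite /conjg !permM permK.
      by apply: eqv_perm => //; rewrite eqv_sym.
    rewrite qM ?qV ?qJ //; last exact: tV.
    move/eqP; rewrite -eq_mulgV1 => /eqP e. by rewrite !e.
  - have dg : commute (d ^ g) t by rewrite /conjg; apply: tM (tV gt) (tM dt gt).
    have : q (d * d ^ g) = 1.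
      apply: (@q_regular _ x); first by apply: tM.
      + by rewrite qM ?qJ //; case: (cM _ _ cD cg).
      + by rewrite qM ?qJ //; case: (cM _ _ cD cg).
      rewrite permM.
      apply: eqv_trans g2 _; apply: eqv_trans (eqv_perm gt dy) _.
      rewrite -[g (d x)](_ : (d ^ g) (g x) = _); last by rewrite /conjg !permM permK.
      apply: eqv_perm => //; apply: (eqv_trans (w := y)); last exact: dy.
      by rewrite eqv_sym.
    rewrite qM ?qJ // => e.
    have e' : q d ^ q g = (q d)^-1 by apply/eqP; rewrite eq_sym eq_invg_mul e.
    by rewrite e' conjVg e' invgK.
have D_s : q d ^ q s = W^-1 ^+ i * H ^+ j by rewrite qd conjMg !conjXg H_s W_s.
(* The square of [s] acts as -1 on the torus; with [involutive] this makes [d] of order two. *)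
have D_ss : (q d ^ q s) ^ q s = (q d)^-1.
  rewrite D_s conjMg !conjXg conjVg H_s W_s qd invMg -!expgVn.
  by apply: (commuteX2 i j); apply: commuteV; apply: commute_sym; apply: commuteV.
have D2 : q d * q d = 1.
  have := involutive s st; rewrite D_ss D_s => h1.
  have {}h1 := h1 (cM _ _ (cX _ i (cV _ cW)) (cX _ j cH)) sxy.
  by rewrite -{1}h1 mulVg.
have D_r : q d ^ q r = W^-1 ^+ i * (W^-1 * H) ^+ j by rewrite qd conjMg !conjXg H_r W_r.
have D_rr : (q d ^ q r) ^ q r = q d.
  apply: involutive => //; rewrite D_r.
  exact: cM _ _ (cX _ i (cV _ cW)) (cX _ j (cM _ _ (cV _ cW) cH)).
have D_rr' : (q d ^ q r) ^ q r = (H^-1 * W) ^+ i * H^-1 ^+ j.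
  rewrite D_r conjMg !conjXg conjMg conjVg H_r W_r invMg invgK.
  by rewrite -mulgA mulgV mulg1.
(* The matrix of [r] has order three and no eigenvalue 1, so it satisfies 1 + r + r^2 = 0. *)
have tot : q d * (q d ^ q r) * ((q d ^ q r) ^ q r) = 1.
  have WVH : commute W^-1 H by apply: commute_sym; apply: commuteV; apply: commute_sym.
  have HVW : commute H^-1 W by apply: commute_sym; apply: commuteV; apply: commute_sym.
  rewrite D_rr' D_r qd (expgMn _ WVH) (expgMn _ HVW) !expgVn.
  have bb : commute (W ^+ j) (W ^+ i) by apply: commuteX2.
  have ab n k : commute (H ^+ n) (W ^+ k) by apply: commuteX2.
  have aa : commute (H ^+ j) (H ^+ i) by apply: commuteX2.
  move: (ab i i) (ab j i) aa bb; move: (H ^+ i) (H ^+ j) (W ^+ i) (W ^+ j) => a a' b' b c1 c2 aa bb.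
  have e1 : b * b'^-1 = b'^-1 * b := commuteV bb.
  have e2 : a' * a^-1 = a^-1 * a' := commuteV aa.
  have e3 : b'^-1 * a^-1 = a^-1 * b'^-1.
    by apply: commuteV; apply: commute_sym; apply: commuteV.
  have e4 : a' * b' = b' * a' := c2.
  rewrite !mulgA -(mulgA a b) e1 !mulgA mulgK -(mulgA _ a') e2 !mulgA -(mulgA a _ a^-1) e3.
  by rewrite !mulgA mulgV mul1g -(mulgA _ a') e4 !mulgA mulVg mul1g mulgV.
have : q d ^ q r = 1.
  have cr : cHW (q d ^ q r).
    by rewrite D_r; apply: cM _ _ (cX _ i (cV _ cW)) (cX _ j (cM _ _ (cV _ cW) cH)).
  have cdr : commute (q d) (q d ^ q r).
    rewrite {1}qd; apply: commute_sym; case: cr => r1 r2.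
    by apply: commuteM; apply: commuteX.
  by move: tot; rewrite D_rr cdr -mulgA D2 mulg1.
move/eqP; rewrite conjg_eq1 => /eqP d1.
have /N0P [_ /(_ x) hx] : d \in N by apply: coset_idr d1; apply: normN.
by move/negP: nxy; apply; apply: eqv_trans hx _; rewrite eqv_sym.
Qed.

End Quotient.

(** By [pairs_exp4] the fourth power of [s] fixes the support of [c] pointwise, so [t] acts there as
    [c] does. Its square has a fixed point and is therefore trivial, and [c] preserves all cycles of
    [t], as [two_pairs_false] requires. *)
Lemma commutator_not_two_pairs x y : c x != x -> c (c x) = x -> c y != y ->
  c (c y) = y -> y \notin [:: x; c x] ->
  (forall z, c z != z -> z \in [:: x; c x; y; c y]) -> False.
Proof.
move=> cx ccx cy ccy ny supp.
have cs : commute c s by apply: conj_commute; apply: c_sigma.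
have cr : commute c r by apply: conj_commute; apply: c_rho.
have csE z : s (c z) = c (s z) := commute_permE z cs.
have crE z : r (c z) = c (r z) := commute_permE z cr.
have nx : x \notin [:: y; c y].
  rewrite !inE; apply: contra ny => /orP[]/eqP ->; rewrite !inE ?ccy ?eqxx ?orbT //.
have supp' z : c z != z -> z \in [:: y; c y; x; c x].
  by move/supp; rewrite !inE => /or4P[]/eqP ->; rewrite !eqxx ?orbT.
have [e1 e2] := sigma4 hpsi vpsi hchi vchi.
have [ht vt] := tau_commute e1 e2; set t := s ^+ 4 * c^-1 in ht vt.
have sx := pairs_exp4 cx ccx cy ccy ny supp csE.
have sy := pairs_exp4 cy ccy cx ccx nx supp' csE.
have cV z : c (c z) = z -> c^-1 z = c z.
  by move=> e; apply: (@perm_inj _ c); rewrite permKV e.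
have tx : t x = c x by rewrite permM sx cV.
have ty : t y = c y by rewrite permM sy cV.
have ct := commute_c ht vt.
have ctE z : t (c z) = c (t z) := commute_permE z ct.
have tc z : c z != z -> t z = c z.
  by move/supp; rewrite !inE => /or4P[]/eqP ->; rewrite ?ctE ?tx ?ty.
have t2 z : t (t z) = z.
  have tt : t ^+ 2 = 1.
    apply: (semiregular trans (z := x)); [exact: commuteX|exact: commuteX|].
    by rewrite permX /= tx ctE tx.
  by have := congr1 (fun g : {perm E} => g z) tt; rewrite permX /= perm1.
have st : commute s t.
  apply: commuteM; first exact: commuteX.
  by apply: commuteV; apply: commute_sym.
have conjt k : commute k t -> k ^ t = k by move=> kt; rewrite /conjg kt mulKg.
(* The conjugate of [t] by [r] commutes with [h ^ r] and [v ^ r], hence with [h] and [v], which are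
   words in them. It agrees with [t] at [r x], so the two are equal by [semiregular]. *)
have rt : commute r t.
  have vtr : v ^ (t ^ r) = v.
    apply: invg_inj; rewrite -conjVg -(h_rho hpsi vpsi hchi vchi).
    by rewrite -conjJg (conjt h).
  have htr : h ^ (t ^ r) = h.
    have : (v ^ r) ^ (t ^ r) = v ^ r by rewrite -conjJg (conjt v).
    rewrite (v_rho hpsi vpsi hchi vchi); move: (t ^ r) vtr => T vT.
    by rewrite 3!conjMg !conjVg vT => /mulIg /mulgI.
  have t'h : commute h (t ^ r * t^-1).
    by apply: commuteM; [apply: conj_commute|apply: commuteV].
  have t'v : commute v (t ^ r * t^-1).
    by apply: commuteM; [apply: conj_commute|apply: commuteV].
  have fixpt : (t ^ r * t^-1) (r x) = r x.
    apply: (@perm_inj _ t); rewrite (permM (t ^ r) t^-1) permKV permJ tx.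
    by rewrite crE tc // -crE (inj_eq perm_inj).
  have := semiregular trans t'h t'v fixpt.
  move/eqP; rewrite -eq_mulgV1 => /eqP tr; apply: commute_sym.
  exact: conj_commute.
have ctz z : c z = z \/ c z = t z.
  by case: (eqVneq (c z) z) => [->|nz]; [left|right; rewrite tc].
have pe (g : {perm E}) : (forall z, g (c z) = c (g z)) ->
  ((g x == x) || (g x == t x)) && ((g y == y) || (g y == t y)) ||
  ((g x == y) || (g x == t y)) && ((g y == x) || (g y == t x)).
  move=> gE; rewrite tx ty.
  by have [[]|[]] := pairs_permuted cx ccx cy ccy ny supp gE; rewrite !inE => -> ->; rewrite ?orbT.
apply: (two_pairs_false ht vt st rt t2 ctz (x := x) (y := y)).
- by rewrite tx; move: ny; rewrite !inE.
- exact: pe.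
- exact: pe.
Qed.

(* The commutator of the two generators of the monodromy group has
   [#|E| - 2] cycles exactly when the square-tiled surface has genus two. *)
Theorem no_symmetric_genus2_monodromy : (#|porbits c| + 2)%N <> #|E|.
Proof.
case/two_excess => [[x [c1 c2 c3 supp]]|[x [y [c1 c2 c3 c4 [ny supp]]]]].
  exact: (commutator_not_3cycle trans hpsi vpsi hchi vchi c1 c2 c3 supp).
exact: (commutator_not_two_pairs c1 c2 c3 c4 ny supp).
Qed.

End TwoPairs.

End Permutations.

Lemma porbit_no_return (T : finType) (s : {perm T}) (x : T) k :
  (0 < k < #|porbit s x|)%N -> iter k s x <> x.
Proof.
move=> /andP[k0 kn] e; have n0 := leq_ltn_trans (leq0n k) kn.
have := nth_uniq x (i := k) (j := 0) _ _ (uniq_traject_porbit s x).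
rewrite size_traject => /(_ kn n0).
by rewrite !nth_traject //= e eqxx => /esym; rewrite eqn0Ngt k0.
Qed.

Lemma porbit_card_eq (T : finType) (s : {perm T}) (x : T) m : (0 < m)%N ->
  iter m s x = x -> (forall k, (0 < k < m)%N -> iter k s x <> x) ->
  #|porbit s x| = m.
Proof.
move=> m0 em hm; set n := #|porbit s x|.
have n0 : (0 < n)%N by rewrite /n card_gt0; apply/set0Pn; exists x; apply: porbit_id.
apply/eqP; rewrite eqn_leq; apply/andP; split; rewrite leqNgt; apply/negP=> lt.
- by apply: (@porbit_no_return _ s x m) em; rewrite m0.
- apply: (hm n); first by rewrite n0.
  exact: iter_porbit.
Qed.

Lemma iter_porbit_inj (T : finType) (s : {perm T}) (x : T) i j :
  (i < #|porbit s x|)%N -> (j < #|porbit s x|)%N -> iter i s x = iter j s x -> i = j.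
Proof.
move=> hi hj e.
have := nth_uniq x (i := i) (j := j) _ _ (uniq_traject_porbit s x).
rewrite size_traject => /(_ hi hj).
by rewrite !nth_traject // e eqxx => /esym/eqP.
Qed.

(** * Comparing numbers of cycles *)

Section CountingOrbits.

Lemma mem_porbit_iter (T : finType) (s : {perm T}) x y :
  reflect (exists i, y = iter i s x) (y \in porbit s x).
Proof.
apply: (iffP idP) => [/porbitP [i ->]|[i ->]]; first by exists i; rewrite permX.
by rewrite -permX mem_porbit.
Qed.

(** The map [f] need not intertwine the permutations nor be onto. This covers the case where [s] is
    the return map of [s'], or its inverse, to a subset that meets every cycle. *)
Lemma card_porbits_transfer (T T' : finType) (s : {perm T}) (s' : {perm T'}) (f : T -> T') :
  (forall y, exists x, y \in porbit s' (f x)) ->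
  (forall x y, (f y \in porbit s' (f x)) = (y \in porbit s x)) ->
  #|porbits s'| = #|porbits s|.
Proof.
move=> cover iso.
pose F (O : {set T}) : {set T'} := \bigcup_(x in O) porbit s' (f x).
have FE x : F (porbit s x) = porbit s' (f x).
  apply/setP=> z; apply/bigcupP/idP => [[y yx zy]|zx]; last by exists x; rewrite ?porbit_id.
  by rewrite -iso -eq_porbit_mem in yx; rewrite -(eqP yx).
have -> : porbits s' = F @: porbits s.
  apply/setP=> O; apply/imsetP/imsetP => [[y _ ->]|[_ /imsetP [x _ ->] ->]].
    have [x hx] := cover y; exists (porbit s x); first exact: imset_f.
    by rewrite FE; rewrite -eq_porbit_mem in hx; rewrite (eqP hx).
  by exists (f x) => //; rewrite FE.
apply: card_in_imset => _ _ /imsetP [x _ ->] /imsetP [y _ ->]; rewrite !FE => e.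
by apply/eqP; rewrite eq_porbit_mem -iso -eq_porbit_mem e.
Qed.

Lemma card_porbits_conj (T T' : finType) (s : {perm T}) (s' : {perm T'}) (f : T -> T') :
  bijective f -> (forall x, s' (f x) = f (s x)) -> #|porbits s'| = #|porbits s|.
Proof.
move=> bf fs; have it i x : iter i s' (f x) = f (iter i s x) by elim: i => //= i ->.
apply: (card_porbits_transfer (f := f)).
  by case: bf => g _ gf y; exists (g y); rewrite gf porbit_id.
move=> x y; apply/mem_porbit_iter/mem_porbit_iter => -[i e]; exists i; last by rewrite it e.
by apply: (bij_inj bf); rewrite e it.
Qed.

Lemma card_porbits_free_involution (T : finType) (s : {perm T}) :
  (forall x, s (s x) = x) -> (forall x, s x != x) -> (#|porbits s| * 2)%N = #|T|.
Proof.
move=> s2 sfree.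
have card2 O : O \in porbits s -> #|O| = 2%N.
  move=> /imsetP [x _ ->].
  apply: porbit_card_eq => [//||[|[|k]] //= _]; first exact: s2.
  by apply/eqP.
by rewrite -cardsT (card_uniform_partition card2 (partition_porbits s)).
Qed.

Variables (T : finType) (s : {perm T}).

(** Two fixed points are added, ready to receive the two new sides that an edge cut or a polygon cut
    creates. *)
Definition ext_fun (u : T + bool) : T + bool := if u is inl d then inl (s d) else u.

Lemma ext_inj : injective ext_fun.
Proof. by move=> [d|b] [d'|b'] //= [] // /perm_inj ->. Qed.

Definition ext : {perm T + bool} := perm ext_inj.

Lemma card_porbits_ext : #|porbits ext| = (#|porbits s| + 2)%N.
Proof.
have it i d : iter i ext (inl d) = inl (iter i s d) by elim: i => //= i ->; rewrite permE.
have itb i b : iter i ext (inr b) = inr b by elim: i => //= i ->; rewrite permE.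
have ob b : porbit ext (inr b) = [set inr b].
  apply/setP=> z; rewrite inE; apply/mem_porbit_iter/eqP => [[i ->]|->]; first exact: itb.
  by exists 0%N.
pose F (O : {set T}) : {set T + bool} := inl @: O.
have od d : porbit ext (inl d) = F (porbit s d).
  apply/setP=> z; apply/mem_porbit_iter/imsetP => [[i ->]|[y /mem_porbit_iter [i ->] ->]].
    by exists (iter i s d); [apply/mem_porbit_iter; exists i|rewrite it].
  by exists i; rewrite it.
have injF : injective F by move=> A B; apply: imset_inj => x y [].
have -> : porbits ext = [set inr true] |: ([set inr false] |: (F @: porbits s)).
  apply/setP=> O; apply/imsetP/idP => [[[d|[]] _ ->]|].
  - by rewrite od !inE imset_f ?orbT // imset_f.
  - by rewrite ob !inE eqxx.
  - by rewrite ob !inE eqxx orbT.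
  - rewrite !inE => /orP[/eqP ->|/orP[/eqP ->|/imsetP [_ /imsetP [d _ ->] ->]]].
    + by exists (inr true).
    + by exists (inr false).
    + by exists (inl d).
have nF b : [set inr b] \notin F @: porbits s.
  apply/negP=> /imsetP [O _ /setP/(_ (inr b))]; rewrite inE eqxx.
  by move=> /esym/imsetP [].
rewrite !cardsU1 card_imset // (negbTE (nF false)) !inE (negbTE (nF true)) orbF.
have -> : ([set inr true] == [set inr false :> T + bool]) = false.
  by apply/eqP=> /setP/(_ (inr true)); rewrite !inE eqxx.
by rewrite !add1n addn2.
Qed.

End CountingOrbits.

(** The product sends [x] to [y] and [y] to [s x]: the fixed point [y] is inserted into the cycle of
    [x], right after [x]. *)
Lemma card_porbits_tperm_fixed (T : finType) (s : {perm T}) x y : s y = y -> x != y ->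
  (#|porbits (tperm x y * s)| + 1)%N = #|porbits s|.
Proof.
move=> fy ne; have := porbits_mul_tperm s x y; rewrite ne.
have -> : x \notin porbit s y.
  apply: contra ne => /mem_porbit_iter [i ->]; apply/eqP.
  by elim: i => //= i ->.
rewrite /=; lia.
Qed.

Local Open Scope ring_scope.

(** * Winding numbers of simple polygons *)

Section Crossing.
Variable R : realFieldType.
Implicit Types a b p q z : 'cV[R]_2.

Local Notation x_ v := (v 0 0).
Local Notation y_ v := (v 1 0).

Definition det2 a b : R := x_ a * y_ b - y_ a * x_ b.

Definition orient a b p : R := det2 (b - a) (p - a).

(* The signed number of times that [a, b] meets the horizontal ray going from
   [p] to the left. *)
Definition lam a b p : int :=
  if ~~ (y_ p < y_ a) && (y_ p < y_ b) && (orient a b p < 0) then 1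
  else if (y_ p < y_ a) && ~~ (y_ p < y_ b) && (0 < orient a b p) then -1
  else 0.

(* The same for [p, q] and the ray going from [a] to the right; [inter_num] is
   then an intersection number, which does not depend on the rays. *)
Definition kap p q a : int :=
  if (y_ p < y_ a) && ~~ (y_ q < y_ a) && (0 < orient p q a) then 1
  else if ~~ (y_ p < y_ a) && (y_ q < y_ a) && (orient p q a < 0) then -1
  else 0.

Definition on_seg a b p : Prop :=
  exists2 s : R, 0 <= s <= 1 & p = a + s *: (b - a).

Definition disjoint_segs a b p q : Prop :=
  forall z : 'cV[R]_2, on_seg a b z -> on_seg p q z -> False.

(** Each segment is closed up by horizontal rays, leftwards for [p, q] and rightwards for [a, b].
    The half-open comparisons of heights in [lam] and [kap] are those of a segment [p, q] raised
    infinitesimally, so the two kinds of rays never meet and equal heights need no separate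
    convention. *)
Definition inter_num a b p q : int :=
  lam a b q - lam a b p + kap p q b - kap p q a.

Lemma orientE a b p :
  orient a b p = (x_ b - x_ a) * (y_ p - y_ a) - (y_ b - y_ a) * (x_ p - x_ a).
Proof. by rewrite /orient /det2 !mxE. Qed.

Lemma orient_swap a b p : orient b a p = - orient a b p.
Proof. by rewrite !orientE; ring. Qed.

Lemma lam_swap a b p : lam b a p = - lam a b p.
Proof.
rewrite /lam (orient_swap a b) oppr_lt0 oppr_gt0.
by case: (y_ p < y_ a); case: (y_ p < y_ b) => //=; case: ifP.
Qed.

Lemma kap_swap p q a : kap q p a = - kap p q a.
Proof.
rewrite /kap (orient_swap p q) oppr_lt0 oppr_gt0.
by case: (y_ p < y_ a); case: (y_ q < y_ a) => //=; case: ifP.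
Qed.

Lemma on_seg_swap a b z : on_seg b a z -> on_seg a b z.
Proof.
move=> [s hs ->]; exists (1 - s); first by lra.
by apply/matrixP=> i j; rewrite !mxE; ring.
Qed.

Lemma cV2_eq a b : x_ a = x_ b -> y_ a = y_ b -> a = b.
Proof.
move=> ex ey; apply/matrixP=> i j; rewrite (ord1 j).
case: i => -[|[|//]] hi.
- by rewrite (_ : Ordinal hi = 0) //; apply: val_inj.
- by rewrite (_ : Ordinal hi = 1) //; apply: val_inj.
Qed.

Definition xcross a b (t : R) : R :=
  x_ a + (t - y_ a) / (y_ b - y_ a) * (x_ b - x_ a).

Lemma orient_xcross a b p : y_ a != y_ b ->
  orient a b p = (y_ b - y_ a) * (xcross a b (y_ p) - x_ p).
Proof.
move=> ne; rewrite orientE /xcross; field.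
by rewrite subr_eq0 eq_sym.
Qed.

Lemma on_seg_height a b t : y_ a < y_ b -> y_ a <= t <= y_ b ->
  forall z : 'cV[R]_2, x_ z = xcross a b t -> y_ z = t -> on_seg a b z.
Proof.
move=> lab /andP[h1 h2] z ex ey.
have pos : 0 < y_ b - y_ a by lra.
exists ((t - y_ a) / (y_ b - y_ a)).
  by rewrite divr_ge0 ?ler_pdivrMr //=; lra.
apply: cV2_eq; rewrite !mxE; first by rewrite ex /xcross.
by rewrite ey; field; lra.
Qed.

(** An intermediate value argument: the horizontal gap between the two segments is affine in the
    height and changes sign between [t1] and [t2]; [th] locates its zero. *)
Lemma meet_heights a b p q t1 t2 : y_ a < y_ b -> y_ p < y_ q ->
  y_ a <= t1 <= y_ b -> y_ a <= t2 <= y_ b ->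
  y_ p <= t1 <= y_ q -> y_ p <= t2 <= y_ q ->
  xcross a b t1 <= xcross p q t1 -> xcross p q t2 <= xcross a b t2 ->
  ~ disjoint_segs a b p q.
Proof.
move=> lab lpq a1 a2 p1 p2 h1 h2 dis.
pose f t := xcross a b t - xcross p q t.
have f1 : f t1 <= 0 by rewrite /f; lra.
have f2 : 0 <= f t2 by rewrite /f; lra.
have [t [ta tp ft]] : exists t, [/\ y_ a <= t <= y_ b, y_ p <= t <= y_ q & f t = 0].
  case: (eqVneq (f t1) 0) => [e|ne]; first by exists t1.
  have f1' : f t1 < 0 by rewrite lt_neqAle ne.
  have df : 0 < f t2 - f t1 by lra.
  pose th := - f t1 / (f t2 - f t1).
  have th1 : 0 <= th <= 1 by rewrite /th divr_ge0 ?ler_pdivrMr //=; lra.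
  exists (t1 + th * (t2 - t1)).
  have bnd l u : l <= t1 <= u -> l <= t2 <= u -> l <= t1 + th * (t2 - t1) <= u.
    by move=> ? ?; apply/andP; split; nra.
  split; [exact: bnd|exact: bnd|].
  have -> : f (t1 + th * (t2 - t1)) = f t1 + th * (f t2 - f t1).
    rewrite /f /xcross; field; lra.
  rewrite /th; field; lra.
pose z : 'cV[R]_2 := \col_i (if i == 0 then xcross a b t else t).
apply: (dis z).
  by apply: (on_seg_height lab ta); rewrite !mxE.
apply: (on_seg_height lpq tp); rewrite !mxE //=.
by move: ft; rewrite /f; lra.
Qed.

Lemma disjoint_segs_sym a b p q : disjoint_segs a b p q -> disjoint_segs p q a b.
Proof. by move=> dis z h1 h2; apply: (dis z). Qed.

Lemma disjoint_segs_swapl a b p q : disjoint_segs a b p q -> disjoint_segs b a p q.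
Proof. by move=> dis z /on_seg_swap h1 h2; apply: (dis z). Qed.

Lemma disjoint_segs_swapr a b p q : disjoint_segs a b p q -> disjoint_segs a b q p.
Proof. by move=> dis z h1 /on_seg_swap h2; apply: (dis z). Qed.

Lemma inter_swapl a b p q : inter_num b a p q = - inter_num a b p q.
Proof. rewrite /inter_num !(lam_swap a b). ring. Qed.

Lemma inter_swapr a b p q : inter_num a b q p = - inter_num a b p q.
Proof. rewrite /inter_num !(kap_swap p q). ring. Qed.

Lemma on_segl a b : on_seg a b a.
Proof. by exists 0; rewrite ?scale0r ?addr0 //; lra. Qed.

Lemma on_segr a b : on_seg a b b.
Proof. by apply: on_seg_swap; apply: on_segl. Qed.

Lemma on_seg_horizontal a b z : y_ a = y_ b -> y_ z = y_ a ->
  (x_ a <= x_ z <= x_ b) || (x_ b <= x_ z <= x_ a) -> on_seg a b z.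
Proof.
move=> eab ez.
wlog lab : a b eab ez / x_ a <= x_ b.
  move=> hw; case: (lerP (x_ a) (x_ b)) => [|/ltW] le h; first exact: hw.
  by apply: on_seg_swap; apply: hw => //; rewrite ?ez // orbC.
move=> h; have {}h : x_ a <= x_ z <= x_ b by lra.
case: (eqVneq (x_ a) (x_ b)) => [e|ne].
  have -> : z = a by apply: cV2_eq; lra.
  exact: on_segl.
have pos : 0 < x_ b - x_ a by rewrite subr_gt0 lt_neqAle ne.
exists ((x_ z - x_ a) / (x_ b - x_ a)).
  by rewrite divr_ge0 ?ler_pdivrMr //=; lra.
apply: cV2_eq; rewrite !mxE; first by field; lra.
by rewrite ez eab; ring.
Qed.

Lemma horizontal_same_side a b p q : y_ a = y_ b -> y_ p < y_ q ->
  y_ p <= y_ a <= y_ q -> disjoint_segs a b p q ->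
  (orient p q a < 0) = (orient p q b < 0) /\
  (0 < orient p q a) = (0 < orient p q b).
Proof.
move=> eab lpq ha dis.
have pos : 0 < y_ q - y_ p by lra.
have ne : y_ p != y_ q by rewrite neq_lt lpq.
rewrite !(orient_xcross _ ne) -eab !pmulr_rlt0 ?pmulr_rgt0 //.
set X := xcross p q (y_ a).
have nb : ~ ((x_ a <= X <= x_ b) || (x_ b <= X <= x_ a)).
  move=> h; pose z : 'cV[R]_2 := \col_i (if i == 0 then X else y_ a).
  apply: (dis z); first by apply: on_seg_horizontal; rewrite // !mxE.
  by apply: (on_seg_height lpq ha); rewrite !mxE.
split.
- by case: (ltrP (X - x_ a)) => h1; case: (ltrP (X - x_ b)) => h2 //; exfalso; apply: nb; lra.
- by case: (ltrP 0 (X - x_ a)) => h1; case: (ltrP 0 (X - x_ b)) => h2 //; exfalso; apply: nb; lra.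
Qed.

Lemma orient_lt0 a b p : y_ a < y_ b ->
  (orient a b p < 0) = (xcross a b (y_ p) < x_ p).
Proof.
move=> l; rewrite orient_xcross ?neq_lt ?l // pmulr_rlt0 ?subr_gt0 //.
by rewrite subr_lt0.
Qed.

Lemma orient_gt0 a b p : y_ a < y_ b ->
  (0 < orient a b p) = (x_ p < xcross a b (y_ p)).
Proof.
move=> l; rewrite orient_xcross ?neq_lt ?l // pmulr_rgt0 ?subr_gt0 //.
Qed.

Lemma xcross_start a b : xcross a b (y_ a) = x_ a.
Proof. by rewrite /xcross subrr !mul0r addr0. Qed.

Lemma xcross_end a b : y_ a != y_ b -> xcross a b (y_ b) = x_ b.
Proof. by move=> ne; rewrite /xcross; field; rewrite subr_eq0 eq_sym. Qed.

Lemma xcross_same_side a b p q t1 t2 : y_ a < y_ b -> y_ p < y_ q ->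
  disjoint_segs a b p q ->
  y_ a <= t1 <= y_ b -> y_ a <= t2 <= y_ b ->
  y_ p <= t1 <= y_ q -> y_ p <= t2 <= y_ q ->
  (xcross a b t1 < xcross p q t1) = (xcross a b t2 < xcross p q t2).
Proof.
move=> *; case: ltrP => h1; case: ltrP => h2 //.
  by case: (@meet_heights a b p q t1 t2) => //; apply/ltW.
by case: (@meet_heights a b p q t2 t1) => //; apply/ltW.
Qed.

(** Once both segments are directed upwards, each surviving term tells on which side of one segment
    an endpoint of the other lies. At heights common to disjoint segments this side is constant, so
    the terms cancel in pairs. *)
Lemma inter_disjoint a b p q : disjoint_segs a b p q -> inter_num a b p q = 0.
Proof.
wlog lab : a b / y_ a <= y_ b.
  move=> hw dis; case: (lerP (y_ a) (y_ b)) => [h|/ltW h]; first exact: hw.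
  by apply/oppr_inj; rewrite -inter_swapl oppr0; apply: hw h (disjoint_segs_swapl dis).
wlog lpq : p q / y_ p <= y_ q.
  move=> hw dis; case: (lerP (y_ p) (y_ q)) => [h|/ltW h]; first exact: hw.
  by apply/oppr_inj; rewrite -inter_swapr oppr0; apply: hw h (disjoint_segs_swapr dis).
move=> dis; rewrite /inter_num /lam /kap.
case: (eqVneq (y_ a) (y_ b)) => [eab|nab].
  rewrite -eab.
  case: (ltrP (y_ p) (y_ a)) => pa; case: (ltrP (y_ q) (y_ a)) => qa //=; try (exfalso; lra).
  have lt : y_ p < y_ q by exact: lt_le_trans pa qa.
  have [] := horizontal_same_side eab lt _ dis; first by rewrite (ltW pa).
  by move=> _ ->; ring.
case: (eqVneq (y_ p) (y_ q)) => [epq|npq].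
  rewrite -epq.
  case: (ltrP (y_ p) (y_ a)) => pa; case: (ltrP (y_ p) (y_ b)) => pb //=; try (exfalso; lra).
  have lt : y_ a < y_ b by exact: le_lt_trans pa pb.
  have [] := horizontal_same_side epq lt _ (disjoint_segs_sym dis).
    by rewrite pa (ltW pb).
  by move=> -> _; ring.
have {nab}lab : y_ a < y_ b by rewrite lt_neqAle nab.
have {npq}lpq : y_ p < y_ q by rewrite lt_neqAle npq.
have nab : y_ a != y_ b by rewrite neq_lt lab.
have npq : y_ p != y_ q by rewrite neq_lt lpq.
rewrite !orient_lt0 ?orient_gt0 //.
have eq := xcross_end npq; have ep := xcross_start p q.
have eb := xcross_end nab; have ea := xcross_start a b.
have mh t1 t2 : _ -> _ -> _ -> _ -> _ := @xcross_same_side a b p q t1 t2 lab lpq dis.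
case: (ltrP (y_ p) (y_ a)) => pa; case: (ltrP (y_ p) (y_ b)) => pb;
 case: (ltrP (y_ q) (y_ a)) => qa; case: (ltrP (y_ q) (y_ b)) => qb //=;
 try (exfalso; lra); rewrite ?subrr ?subr0 ?sub0r ?add0r ?addr0 //.
- by rewrite -{1}eq -{1}ea (mh (y_ q) (y_ a)) ?subrr //; lra.
- by rewrite -{1}eb -{1}ea (mh (y_ b) (y_ a)) ?subrr //; lra.
- by rewrite -{1}eq -{1}ep (mh (y_ q) (y_ p)) ?subrr //; lra.
- by rewrite -{1}ep -{1}eb (mh (y_ p) (y_ b)) ?addNr //; lra.
Qed.

Lemma inter_crossing a b p q :
  0 < orient a b p -> orient a b q < 0 ->
  orient p q a < 0 -> 0 < orient p q b -> inter_num a b p q = 1.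
Proof.
rewrite /inter_num /lam /kap => hp hq ha hb.
rewrite hp hq ha hb.
have -> : (orient a b p < 0) = false by apply/negbTE; rewrite -leNgt ltW.
have -> : (0 < orient a b q) = false by apply/negbTE; rewrite -leNgt ltW.
have -> : (0 < orient p q a) = false by apply/negbTE; rewrite -leNgt ltW.
have -> : (orient p q b < 0) = false by apply/negbTE; rewrite -leNgt ltW.
have sm : orient a b p - orient a b q = orient p q b - orient p q a.
  by rewrite !orientE; ring.
(* Divided by the common value in [sm], both sides are the height of the crossing point, written as
   a convex combination of the heights of [a] and [b], and of those of [p] and [q]. So neither
   segment can lie above the other. *)
have id : orient p q b * y_ a - orient p q a * y_ b
          = orient a b p * y_ q - orient a b q * y_ p.
  by rewrite !orientE; ring.
have nz : ~ [/\ y_ a = y_ p, y_ b = y_ p & y_ q = y_ p].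
  by case=> e1 e2 e3; move: hp; rewrite orientE e1 e2 subrr mulr0 mul0r subrr ltxx.
case: (ltrP (y_ p) (y_ a)) => pa; case: (ltrP (y_ p) (y_ b)) => pb;
 case: (ltrP (y_ q) (y_ a)) => qa; case: (ltrP (y_ q) (y_ b)) => qb //=;
 exfalso; move: nz hp hq ha hb sm id pa pb qa qb;
 move: (orient a b p) (orient a b q) (orient p q a) (orient p q b) (y_ a) (y_ b) (y_ p) (y_ q);
 clear => Dp Dq Da Db ya yb yp yq nz hp hq ha hb sm id pa pb qa qb; try lra.
- case: (lerP yp yq) => h.
  + have h1 : 0 < Db * (ya - yq) by rewrite mulr_gt0 // subr_gt0.
    have h2 : 0 < (- Da) * (yb - yq) by rewrite mulr_gt0 // ?subr_gt0 ?oppr_gt0.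
    have h3 : 0 <= (- Dq) * (yq - yp) by rewrite mulr_ge0 ?subr_ge0 ?oppr_ge0 // ltW.
    nra.
  + have h1 : 0 < Db * (ya - yp) by rewrite mulr_gt0 // subr_gt0.
    have h2 : 0 < (- Da) * (yb - yp) by rewrite mulr_gt0 // ?subr_gt0 ?oppr_gt0.
    have h3 : 0 <= Dp * (yp - yq) by rewrite mulr_ge0 ?subr_ge0 // ltW.
    nra.
(* Here the comparisons are weak, and the two expressions of the crossing height force all four
   heights to coincide, against [nz]. *)
- wlog h : Dp Dq Da Db ya yb yp yq nz hp hq ha hb sm id pa pb qa qb / yp <= yq.
    move=> hw; case: (lerP yp yq) => [|/ltW] h; first exact: (hw Dp Dq Da Db ya yb yp yq).
    apply: (hw (- Dq) (- Dp) Da Db ya yb yq yp); rewrite ?oppr_gt0 ?oppr_lt0 //; try lra.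
    by move=> [e1 e2 e3]; apply: nz; split; lra.
  have h1 : 0 <= Db * (yp - ya) by rewrite mulr_ge0 ?subr_ge0 // ltW.
  have h2 : 0 <= (- Da) * (yp - yb) by rewrite mulr_ge0 ?subr_ge0 ?oppr_ge0 // ltW.
  have h3 : 0 <= Dp * (yq - yp) by rewrite mulr_ge0 ?subr_ge0 // ltW.
  have s1 : Db * (yp - ya) + (- Da) * (yp - yb) + Dp * (yq - yp) = 0.
    have : Db * (yp - ya) + (- Da) * (yp - yb) + Dp * (yq - yp)
       = yp * (Db - Da - (Dp - Dq)) - (Db * ya - Da * yb - (Dp * yq - Dq * yp)) by ring.
    by rewrite -sm subrr mulr0 -id subrr subr0.
  have z1 : Db * (yp - ya) = 0 by lra.
  have z2 : (- Da) * (yp - yb) = 0 by lra.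
  have z3 : Dp * (yq - yp) = 0 by lra.
  apply: nz; split.
  + by move/eqP: z1; rewrite mulf_eq0 gt_eqF //= subr_eq0 => /eqP.
  + by move/eqP: z2; rewrite mulf_eq0 oppr_eq0 lt_eqF //= subr_eq0 => /eqP.
  + by move/eqP: z3; rewrite mulf_eq0 gt_eqF //= subr_eq0 => /eqP.
Qed.

End Crossing.

(** * Local contribution of a corner *)

Section Corner.
Variable R : realFieldType.
Implicit Types a b p q v z : 'cV[R]_2.
Local Notation x_ v := (v 0 0).
Local Notation y_ v := (v 1 0).

(* [crn a v b] tells whether, just above the height of [v], the points west
   of the corner [a, v, b] lie on the right of the path. *)
Definition crn a v b : int :=
  if y_ v < y_ a then if y_ v < y_ b then (0 < orient a v b)%R%:Z else 1
  else if y_ v < y_ b then 0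
  else ((0 < orient a v b) || ((orient a v b == 0) && (x_ b < x_ v)))%R%:Z.

(** It tells whether the points just west of the side from [p] to [q] lie on its right. For a
    horizontal side, raising the point infinitesimally replaces west by north, whence the comparison
    of abscissas. *)
Definition west p q : int :=
  ((y_ q < y_ p) || ((y_ q == y_ p) && (x_ q < x_ p)))%R%:Z.

(* The corner is not a cusp. *)
Definition proper_corner a v b : Prop :=
  orient a v b <> 0 \/
  exists2 s, 0 < s & b - v = s *: (v - a).

Lemma proper_corner0 a v b : proper_corner a v b -> orient a v b = 0 ->
  [/\ y_ v < y_ a -> y_ b < y_ v, y_ a < y_ v -> y_ v < y_ b,
      y_ a = y_ v -> y_ b = y_ v, x_ v < x_ a -> x_ b < x_ v &
      x_ a < x_ v -> x_ v < x_ b].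
Proof.
case=> // -[s s0 e] _; move/matrixP: e => e.
move: (e 0 0) (e 1 0); rewrite !mxE => e1 e2.
split=> h; last 2 first; try (rewrite -subr_gt0 ?e1 ?e2 mulr_gt0 //; lra).
all: try (rewrite -subr_lt0 ?e1 ?e2 pmulr_rlt0 //; lra).
by apply/eqP; rewrite -subr_eq0 e2 h subrr mulr0.
Qed.

(** The left-hand side is what remains of [inter_num a p p q]. It need not vanish for consecutive
    sides, which share [p]; its value is a difference of two local terms. [corner_out] is the same
    at the other end of the side. *)
Lemma corner_in a p q : p != q -> proper_corner a p q ->
  lam a p q - kap p q a = west p q - crn a p q.
Proof.
move=> npq /proper_corner0 hz.
have {}npq : ~ (x_ p = x_ q /\ y_ p = y_ q).
  by case=> *; case/eqP: npq; apply: cV2_eq.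
have e2 : orient p q a = orient a p q by rewrite !orientE; ring.
rewrite /lam /kap /west /crn e2.
move: hz (orientE a p q) {e2} npq; move: (orient a p q) => D.
move: (a 0 0) (a 1 0) (p 0 0) (p 1 0) (q 0 0) (q 1 0) => xa ya xp yp xq yq hz eD npq.
case: (ltrgtP yp yq) => pq.
3: { have {hz}eD : D = (ya - yp) * (xq - xp) by rewrite eD pq; ring.
  subst yq; have {}npq : xp <> xq by move=> e; apply: npq.
  case: (ltrgtP yp ya) => pa; case: (ltrgtP xp xq) => xpq //=.
  - have h : 0 < D by rewrite eD mulr_gt0 // subr_gt0.
    by case: ltrgtP h.
  - have h : D < 0 by rewrite eD pmulr_rlt0 ?subr_gt0 ?subr_lt0.
    by case: ltrgtP h.
  - have h : D < 0 by rewrite eD nmulr_rlt0 ?subr_gt0 ?subr_lt0.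
    by case: ltrgtP h.
  - have h : 0 < D by rewrite eD nmulr_rgt0 ?subr_gt0 ?subr_lt0.
    by case: ltrgtP h.
  - have z : D = 0 by rewrite eD pa subrr mul0r.
    by rewrite z ltxx eqxx.
  - have z : D = 0 by rewrite eD pa subrr mul0r.
    by rewrite z ltxx eqxx. }
all: case: (ltrgtP D 0) => [Dn|Dp|D0].
3,6: have [h1 h2 h3 _ _] := hz D0.
all: case: (ltrgtP yp ya) => pa; case: (ltrgtP yq ya) => qa; rewrite //=.
all: exfalso; lra.
Qed.

Lemma corner_out p q b : p != q -> proper_corner p q b ->
  kap p q b - lam q b p = crn p q b - west p q.
Proof.
move=> npq /proper_corner0 hz.
have {}npq : ~ (x_ p = x_ q /\ y_ p = y_ q).
  by case=> *; case/eqP: npq; apply: cV2_eq.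
have e2 : orient q b p = orient p q b by rewrite !orientE; ring.
rewrite /lam /kap /west /crn e2.
move: hz (orientE p q b) {e2} npq; move: (orient p q b) => D.
move: (b 0 0) (b 1 0) (p 0 0) (p 1 0) (q 0 0) (q 1 0) => xb yb xp yp xq yq hz eD npq.
case: (ltrgtP yp yq) => pq.
3: { subst yq; have {}npq : xp <> xq by move=> e; apply: npq.
  have {}eD : D = (yb - yp) * (xq - xp) by rewrite eD; ring.
  case: (ltrgtP yp yb) => pb; case: (ltrgtP xp xq) => xpq //=.
  - have h : 0 < D by rewrite eD mulr_gt0 // subr_gt0.
    by case: (ltrgtP D 0) h.
  - have h : D < 0 by rewrite eD pmulr_rlt0 ?subr_gt0 ?subr_lt0.
    by case: (ltrgtP D 0) h.
  - have h : D < 0 by rewrite eD nmulr_rlt0 ?subr_gt0 ?subr_lt0.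
    by case: (ltrgtP D 0) h.
  - have h : 0 < D by rewrite eD nmulr_rgt0 ?subr_gt0 ?subr_lt0.
    by case: (ltrgtP D 0) h.
  - have z : D = 0 by rewrite eD pb subrr mul0r.
    by have [_ _ _ _ /(_ xpq) h5] := hz z; rewrite z ltxx eqxx /= ltNge ltW.
  - have z : D = 0 by rewrite eD pb subrr mul0r.
    by have [_ _ _ /(_ xpq) h4 _] := hz z; rewrite z ltxx eqxx /= h4. }
all: case: (ltrgtP D 0) => [Dn|Dp|D0].
3,6: have [h1 h2 h3 _ _] := hz D0.
all: case: (ltrgtP yp yb) => pb; case: (ltrgtP yq yb) => qb; rewrite //=.
all: exfalso; clear hz eD npq.
all: lra.
Qed.

Lemma crn_scale a v b s : 0 < s -> crn a v (v + s *: (b - v)) = crn a v b.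
Proof.
move=> s0; rewrite /crn.
have -> : orient a v (v + s *: (b - v)) = s * orient a v b.
  by rewrite !orientE !mxE; ring.
rewrite pmulr_rgt0 // mulf_eq0 gt_eqF //= !mxE.
by rewrite ltrDl pmulr_rgt0 // subr_gt0 gtrDl pmulr_rlt0 // subr_lt0.
Qed.

End Corner.

Section Translation.
Variable R : realFieldType.
Implicit Types a b p q w z : 'cV[R]_2.

Lemma orientT w a b p : orient (a + w) (b + w) (p + w) = orient a b p.
Proof. by rewrite !orientE !mxE; ring. Qed.

Lemma lamT w a b p : lam (a + w) (b + w) (p + w) = lam a b p.
Proof. by rewrite /lam orientT !mxE !ltrD2r. Qed.

Lemma crnT w a v b : crn (a + w) (v + w) (b + w) = crn a v b.
Proof. by rewrite /crn orientT !mxE !ltrD2r. Qed.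

Lemma on_segT w a b z : on_seg (a + w) (b + w) (z + w) <-> on_seg a b z.
Proof.
have e : b + w - (a + w) = b - a by rewrite opprD addrACA subrr addr0.
split=> -[s hs h]; exists s => //.
  by apply: (addIr w); rewrite h e addrAC.
by rewrite h e addrAC.
Qed.

Lemma proper_cornerT w a v b : proper_corner a v b ->
  proper_corner (a + w) (v + w) (b + w).
Proof.
have e x y : x + w - (y + w) = x - y by rewrite opprD addrACA subrr addr0.
by rewrite /proper_corner orientT !e.
Qed.

End Translation.

(** * The winding number on the left of the boundary *)

Section Polygon.
Variables (R : realType) (D : finType) (next : {perm D}) (vec : D -> 'cV[R]_2).
Local Notation n := (nsides next).
Local Notation V := (corner next vec).
Local Notation side := (side_vec next vec).
Implicit Types (d : D) (p q z w : 'cV[R]_2).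

Definition wind d p : int := - \sum_(i < n d) lam (V d i) (V d i.+1) p.

Definition onb d p : Prop := exists2 i, (i < n d)%N & on_seg (V d i) (V d i.+1) p.

Lemma corner0 d : V d 0 = 0.
Proof. by rewrite /corner big_ord0. Qed.

Lemma cornerS d k : V d k.+1 = V d k + side d k.
Proof. by rewrite /corner big_ord_recr. Qed.

Lemma side_vec0 d : side d 0 = vec d.
Proof. by []. Qed.

Lemma corner1 d : V d 1 = vec d.
Proof. by rewrite cornerS corner0 add0r. Qed.

Lemma side_vecS d k : side (next d) k = side d k.+1.
Proof. by rewrite /side_vec -iterSr. Qed.

Lemma corner_next d k : V (next d) k = V d k.+1 - vec d.
Proof.
elim: k => [|k IH]; first by rewrite corner0 corner1 subrr.
by rewrite cornerS IH [in RHS]cornerS side_vecS addrAC.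
Qed.

Lemma nsides_next d : n (next d) = n d.
Proof. by rewrite /nsides -[next d]/(iter 1 next d) -permX porbit_perm. Qed.

Lemma iter_nsides d : iter (n d) next d = d.
Proof. exact: iter_porbit. Qed.

Lemma nsides_gt0 d : (0 < n d)%N.
Proof. by rewrite /nsides card_gt0; apply/set0Pn; exists d; apply: porbit_id. Qed.

Lemma edge_next d i : V d i.+1 - V d i = side d i.
Proof. by rewrite cornerS addrC addKr. Qed.

Hypothesis polyP : forall d, euclidean_polygon next vec d.

Lemma corner_nsides d : V d (n d) = 0.
Proof. by case: (polyP d). Qed.

Lemma corner_param d i j s t : (i < n d)%N -> (j < n d)%N ->
  0 <= s < 1 -> 0 <= t < 1 ->
  V d i + s *: side d i = V d j + t *: side d j -> i = j /\ s = t.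
Proof. by case: (polyP d) => _ h _; apply: h. Qed.

Let zero01 : 0 <= (0 : R) < 1. Proof. by rewrite lexx ltr01. Qed.
Let half01 : 0 <= (1 / 2 : R) < 1. Proof. by lra. Qed.

Lemma nsides_ge3 d : (2 < n d)%N.
Proof.
have := nsides_gt0 d; case en : (n d) => [|[|[|k]]] // _.
- have := corner_nsides d; rewrite en corner1 => v0.
  have [] := @corner_param d 0 0 0 (1 / 2); rewrite ?en //.
    by rewrite side_vec0 v0 !scaler0.
  by move=> _ /eqP; rewrite eq_sym mul1r invr_eq0 pnatr_eq0.
- have := corner_nsides d; rewrite en cornerS => v0.
  have [] := @corner_param d 0 1 (1 / 2) (1 / 2); rewrite ?en //.
  have -> : side d 1 = - V d 1 by apply/eqP; rewrite -addr_eq0 addrC v0.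
  rewrite corner0 side_vec0 corner1 add0r.
  by apply/matrixP=> i j; rewrite !mxE; field.
Qed.

Lemma vec_neq0 d : vec d != 0.
Proof.
apply/eqP=> v0; have n0 := nsides_gt0 d.
have [] := @corner_param d 0 0 0 (1 / 2); rewrite // ?side_vec0 ?v0 ?scaler0 //.
by move=> _ /eqP; rewrite eq_sym mul1r invr_eq0 pnatr_eq0.
Qed.

Lemma edge_point d i z : on_seg (V d i) (V d i.+1) z ->
  (exists2 s, 0 <= s < 1 & z = V d i + s *: side d i) \/ z = V d i.+1.
Proof.
case=> s hs; rewrite edge_next => ->.
case: (eqVneq s 1) => [->|ne]; first by right; rewrite scale1r cornerS.
by left; exists s => //; case/andP: hs => -> /=; rewrite lt_neqAle ne.
Qed.

Lemma initial_edge_disjoint d j s : 0 <= s < 1 -> (0 < j)%N -> (j.+1 < n d)%N ->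
  disjoint_segs (V d j) (V d j.+1) 0 (s *: vec d).
Proof.
move=> hs j0 jn z /edge_point hj [t ht]; rewrite subr0 add0r scalerA => ez.
have hts : 0 <= t * s < 1 by apply/andP; split; nra.
have n0 := nsides_gt0 d.
have e0 : z = V d 0 + (t * s) *: side d 0 by rewrite corner0 add0r side_vec0.
case: hj => [[r hr e]|e].
- have [] := @corner_param d 0 j (t * s) r; rewrite -?e0 // ?(ltnW jn) //.
  by move=> jj; rewrite -jj in j0.
- have [] := @corner_param d 0 j.+1 (t * s) 0; rewrite -?e0 // ?scale0r ?addr0 ?lexx ?ltr01 //.
Qed.

Lemma edges_disjoint d j : (1 < j)%N -> (j.+1 < n d)%N ->
  disjoint_segs (V d j) (V d j.+1) 0 (vec d).
Proof.
move=> j1 jn z hj [t ht]; rewrite subr0 add0r => ez.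
have j0 : (0 < j)%N by rewrite ltnW.
have [e|ne] := eqVneq t 1; last first.
  have t1 : 0 <= t < 1 by case/andP: ht => -> /=; rewrite lt_neqAle ne.
  apply: (initial_edge_disjoint t1 j0 jn hj).
  by rewrite ez; apply: on_segr.
have e1 : z = V d 1 + 0 *: side d 1 by rewrite scale0r addr0 corner1 ez e scale1r.
have hn1 : (1 < n d)%N by apply: leq_trans (nsides_ge3 d).
case/edge_point: hj => [[r hr er]|er].
- have [] := @corner_param d 1 j 0 r; rewrite -?e1 ?lexx ?ltr01 // ?(ltnW jn) //.
  by move=> jj; rewrite -jj in j1.
- have [] := @corner_param d 1 j.+1 0 0; rewrite -?e1 // ?scale0r ?addr0 ?lexx ?ltr01 //.
  by move=> [jj]; rewrite -jj in j1.
Qed.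

(** At a cusp the two sides would overlap near the corner, against simplicity. *)
Lemma proper_corner_base d : proper_corner (V d (n d).-1) 0 (vec d).
Proof.
have n3 := nsides_ge3 d; set m := (n d).-1; have em : n d = m.+1 by rewrite prednK // nsides_gt0.
have := corner_nsides d; rewrite em cornerS; set u := side d m => hu.
have {}hu : V d m = - u by apply/eqP; rewrite -addr_eq0 hu.
rewrite /proper_corner subr0 sub0r hu opprK.
case: (eqVneq (orient (- u) 0 (vec d)) 0) => [ez|/eqP]; last by left.
right.
have ud : u 0 0 * vec d 1 0 = u 1 0 * vec d 0 0.
  by move: ez; rewrite orientE !mxE; lra.
have u0 : u != 0 by apply: vec_neq0.
have [s es] : exists s, vec d = s *: u.
  have [ux|ux] := eqVneq (u 0 0) 0.
    have uy : u 1 0 != 0 by apply: contraNneq u0 => uy; apply/eqP/cV2_eq; rewrite mxE.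
    exists (vec d 1 0 / u 1 0); apply: cV2_eq; rewrite !mxE ?divfK // ux mulr0.
    by move: ud; rewrite ux mul0r => /esym/eqP; rewrite mulf_eq0 (negbTE uy) /= => /eqP.
  exists (vec d 0 0 / u 0 0); apply: cV2_eq; rewrite !mxE ?divfK //.
  by apply: (mulfI ux); rewrite ud; field.
have s0 : s != 0 by apply: contraTneq (vec_neq0 d) => s0; rewrite es s0 scale0r eqxx.
exists s => //; rewrite lt_neqAle eq_sym s0 leNgt; apply/negP=> sn.
(* The parameter [1 + b * s] on the last side and [b] on the first describe the same point; this [b]
   puts both in the unit interval. *)
pose b := (1 - s)^-1; have b0 : 0 < 1 - s by lra.
have hb : 0 < b by rewrite invr_gt0.
have hb1 : b < 1 by rewrite invf_lt1 //; lra.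
have hbs : b * (1 - s) = 1 by rewrite mulVf // gt_eqF.
have [] := @corner_param d m 0 (1 + b * s) b; rewrite ?em //; first by nra.
- by rewrite ltW.
- rewrite hu corner0 side_vec0 es add0r -/u scalerA scalerDl scale1r addrA addNr add0r.
  by [].
- by move=> m0; move: n3; rewrite em m0.
Qed.

(** The winding number of a point immediately on the left of the boundary near the base corner: the
    terms of the two sides that meet there are replaced by the local term [crn]. *)
Definition left_wind d : int :=
  crn (V d (n d).-1) 0 (vec d) -
  \sum_(1 <= j < (n d).-1) lam (V d j) (V d j.+1) 0.

(** When the corner moves along a side, the sides not adjacent to it have intersection number 0 with
    it. The two adjacent ones contribute the defects of [corner_in] and [corner_out], in which
    [west] cancels. *)
Lemma left_wind_next d : left_wind (next d) = left_wind d.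
Proof.
rewrite /left_wind nsides_next.
have := nsides_ge3 d; case en : (n d) => [|[|[|k]]] // _ /=.
set v := vec d.
have V2 : V d 2 = vec (next d) + v by rewrite cornerS corner1 addrC.
have -> : crn (V (next d) k.+2) 0 (vec (next d)) = crn 0 v (V d 2).
  by rewrite -(crnT v) corner_next subrK add0r -en corner_nsides V2.
have -> : \sum_(1 <= j < k.+2) lam (V (next d) j) (V (next d) j.+1) 0 =
   \sum_(2 <= j < k.+3) lam (V d j) (V d j.+1) v.
  rewrite [RHS]big_add1; apply: eq_bigr => j _.
  by rewrite -(lamT v) !corner_next !subrK add0r.
rewrite big_nat_recr //= [in RHS]big_ltn //.
have -> : V d k.+3 = 0 by rewrite -en corner_nsides.
have mid : \sum_(2 <= j < k.+2) lam (V d j) (V d j.+1) v =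
   \sum_(2 <= j < k.+2) lam (V d j) (V d j.+1) 0 + kap 0 v (V d 2) - kap 0 v (V d k.+2).
  have : \sum_(2 <= j < k.+2) (kap 0 v (V d j.+1) - kap 0 v (V d j)) =
      kap 0 v (V d k.+2) - kap 0 v (V d 2) by rewrite telescope_sumr.
  have -> : \sum_(2 <= j < k.+2) (kap 0 v (V d j.+1) - kap 0 v (V d j)) =
     \sum_(2 <= j < k.+2) (lam (V d j) (V d j.+1) 0 - lam (V d j) (V d j.+1) v).
    apply: eq_big_nat => j /andP[j2 jk].
    have : disjoint_segs (V d j) (V d j.+1) 0 v by apply: edges_disjoint; rewrite ?en.
    move/inter_disjoint; rewrite /inter_num.
    by move: (lam _ _ _) (lam _ _ _) (kap _ _ _) (kap _ _ _) => *; lia.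
  rewrite sumrB => h. by clear V2; lra.
rewrite mid.
have nv : 0 != v by rewrite eq_sym; apply: vec_neq0.
have h1 : proper_corner (V d k.+2) 0 v by have := proper_corner_base d; rewrite en.
have h2 : proper_corner 0 v (V d 2).
  have := proper_corner_base (next d); rewrite nsides_next en => /(@proper_cornerT _ v).
  by rewrite corner_next -en corner_nsides subrK add0r V2.
have := corner_in nv h1; have := corner_out nv h2.
rewrite corner1 -/v.
clear V2 mid; move=> e1 e2; lra.
Qed.

End Polygon.

Section Lam.
Variable R : realFieldType.
Implicit Types a b p q v z : 'cV[R]_2.
Local Notation x_ v := (v 0 0).
Local Notation y_ v := (v 1 0).

Definition sgn_cross a b (t : R) : int :=
  (t < y_ b)%R%:Z - (t < y_ a)%R%:Z.

Lemma lamE a b p : y_ p != y_ a -> y_ p != y_ b ->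
  lam a b p = if xcross a b (y_ p) < x_ p then sgn_cross a b (y_ p) else 0.
Proof.
move=> na nb; rewrite /lam /sgn_cross.
case: (ltgtP (y_ p) (y_ a)) na => //= ha _; case: (ltgtP (y_ p) (y_ b)) nb => //= hb _.
- by case: ifP.
- by rewrite -[0 < _]oppr_lt0 -orient_swap orient_lt0 ?(lt_trans hb) //
     [xcross b a _](_ : _ = xcross a b (y_ p)) // /xcross; field; lra.
- by rewrite orient_lt0 ?(lt_trans ha).
- by case: ifP.
Qed.

Lemma proper_corner_scale s a v b : 0 < s ->
  proper_corner a v b -> proper_corner a v (v + s *: (b - v)).
Proof.
move=> s0 [h|[t t0 e]].
  left=> h0; apply: h; move/eqP: h0.
  have -> : orient a v (v + s *: (b - v)) = s * orient a v b.
    by rewrite !orientE !mxE; ring.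
  by rewrite mulf_eq0 gt_eqF //= => /eqP.
right; exists (s * t); first by rewrite mulr_gt0.
by rewrite [v + _]addrC addrK e scalerA.
Qed.

Lemma kap_beyond p q s : 0 < s < 1 -> kap p (p + s *: (q - p)) q = 0.
Proof.
move=> hs; rewrite /kap !mxE.
case: (ltrP (y_ p) (y_ q)) => h; case: (ltrP (y_ p + _) (y_ q)) => h' //=; exfalso; nra.
Qed.

Lemma west_scale p q s : 0 < s -> west p (p + s *: (q - p)) = west p q.
Proof.
move=> s0; rewrite /west !mxE.
by rewrite !gtrDl pmulr_rlt0 // subr_lt0 -subr_eq0 addrAC subrr add0r mulf_eq0
  gt_eqF //= subr_eq0 pmulr_rlt0 // subr_lt0.
Qed.

Lemma on_seg_sgn_cross a b z : sgn_cross a b (y_ z) != 0 ->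
  x_ z = xcross a b (y_ z) -> on_seg a b z.
Proof.
rewrite /sgn_cross; case: (ltrP (y_ z) (y_ a)) => ha; case: (ltrP (y_ z) (y_ b)) => hb // _ e.
- apply: on_seg_swap; apply: (@on_seg_height _ b a (y_ z)); rewrite ?hb ?(ltW ha) ?(le_lt_trans hb) //.
  by rewrite e /xcross; field; lra.
- by apply: (@on_seg_height _ a b (y_ z)); rewrite ?ha ?(ltW hb) ?(le_lt_trans ha).
Qed.

End Lam.

(** * Values of the winding number *)

Section Jordan.
Variables (R : realType) (D : finType) (next : {perm D}) (vec : D -> 'cV[R]_2).
Local Notation n := (nsides next).
Local Notation V := (corner next vec).
Local Notation side := (side_vec next vec).
Local Notation wind := (wind next vec).
Local Notation onb := (onb next vec).
Local Notation left_wind := (left_wind next vec).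
Local Notation x_ v := (v 0 0).
Local Notation y_ v := (v 1 0).
Implicit Types (d : D) (p q z w : 'cV[R]_2).

Hypothesis polyP : forall d, euclidean_polygon next vec d.

Lemma corner_add d i j : V d (i + j) = V d i + V (iter i next d) j.
Proof.
elim: i d j => [|i IH] d j; first by rewrite corner0 add0r.
rewrite addSn iterSr.
have e k : V d k.+1 = V (next d) k + vec d by rewrite corner_next subrK.
by rewrite !e IH addrAC.
Qed.

Lemma corner_mod d k : V d k = V d (k %% n d)%N.
Proof.
rewrite {1}(divn_eq k (n d)) corner_add.
have it m : iter (m * n d)%N next d = d.
  by elim: m => // m IH; rewrite mulSn iterD IH iter_nsides.
have -> : V d (k %/ n d * n d)%N = 0.
  elim: (k %/ n d)%N => [|m IH]; first by rewrite corner0.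
  by rewrite mulSn addnC corner_add IH it (corner_nsides polyP) add0r.
by rewrite it add0r.
Qed.

Lemma corner_wrap d : V d (n d).+1 = V d 1.
Proof. by rewrite -[(n d).+1]addn1 corner_add (corner_nsides polyP) iter_nsides add0r. Qed.

Lemma wind_next d p : wind (next d) (p - vec d) = wind d p.
Proof.
rewrite /wind nsides_next; congr (- _).
have := nsides_gt0 next d; case en : (n d) => [|m] // _.
rewrite [RHS]big_ord_recl big_ord_recr /= addrC; congr (_ + _); last first.
  by apply: eq_bigr => i _; rewrite !corner_next lamT.
have e2 : V d m.+2 = V d 1.
  by have := corner_wrap d; rewrite en.
by rewrite -(lamT (vec d)) !corner_next !subrK e2 -en (corner_nsides polyP) corner0.
Qed.

Lemma onb_next d p : onb (next d) (p - vec d) <-> onb d p.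
Proof.
have k1 := nsides_gt0 next d; split=> -[i].
- rewrite nsides_next => hi; rewrite !corner_next on_segT => h.
  have [e|ne] := eqVneq i.+1 (n d); last by exists i.+1; rewrite // ltn_neqAle ne.
  by exists 0%N => //; move: h; rewrite e corner_wrap (corner_nsides polyP) corner0.
- case: i => [|i] hi h.
    exists (n d).-1; first by rewrite nsides_next prednK.
    rewrite !corner_next on_segT prednK // corner_wrap (corner_nsides polyP).
    by rewrite -(corner0 next vec d).
  by exists i; rewrite ?nsides_next ?(ltnW hi) // !corner_next on_segT.
Qed.

Lemma wind_iter i d p : wind (iter i next d) (p - V d i) = wind d p.
Proof.
elim: i => [|i IH]; first by rewrite corner0 subr0.
by rewrite cornerS opprD addrA iterS wind_next.
Qed.

Lemma onb_iter i d p : onb (iter i next d) (p - V d i) <-> onb d p.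
Proof.
elim: i => [|i IH]; first by rewrite corner0 subr0.
by rewrite cornerS opprD addrA iterS onb_next.
Qed.

Lemma left_wind_iter i d : left_wind (iter i next d) = left_wind d.
Proof. by elim: i => // i IH; rewrite iterS left_wind_next. Qed.

Lemma nsides_iter i d : n (iter i next d) = n d.
Proof. by elim: i => // i IH; rewrite iterS nsides_next. Qed.

(** At a highest corner no side rises above the base point, so only the truth value [crn]
    remains. *)
Lemma left_wind01 d : left_wind d = 0 \/ left_wind d = 1.
Proof.
have n0 := nsides_gt0 next d.
pose i0 : 'I_(n d) := Ordinal n0.
case: (@Order.TotalTheory.arg_maxP _ _ 'I_(n d) i0 predT (fun i => y_ (V d i)) isT) => i _ hmax.
rewrite -(left_wind_iter i).
have hy j : y_ (V (iter i next d) j) <= 0.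
  have -> : V (iter i next d) j = V d (i + j)%N - V d i by rewrite corner_add addrC addKr.
  rewrite !mxE subr_le0 corner_mod.
  by apply: (hmax (Ordinal (ltn_pmod (i + j) n0))).
have hy0 j : (0 : 'cV[R]_2) 1 0 < y_ (V (iter i next d) j) = false.
  by rewrite mxE ltNge hy.
rewrite /left_wind big1 => [|j _]; last by rewrite /lam !hy0.
rewrite subr0 /crn hy0 -(corner1 next vec) hy0.
by case: (_ || _); [right|left].
Qed.

Definition generic_height d p := forall i, y_ p != y_ (V d i).

Lemma generic_height_iter i d p : generic_height d p ->
  generic_height (iter i next d) (p - V d i).
Proof.
move=> g j; have := g (i + j)%N; rewrite corner_add !mxE.
by apply: contraNneq => e; rewrite -e addrC subrK.
Qed.

(* The edge [d] is the first one met from [p] towards the west. *)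
Lemma wind_first_edge d p : generic_height d p -> ~ onb d p ->
  lam 0 (vec d) p != 0 ->
  (forall j, (j < n d)%N -> lam (V d j) (V d j.+1) p != 0 ->
     xcross (V d j) (V d j.+1) (y_ p) <= xcross 0 (vec d) (y_ p)) ->
  wind d p = left_wind d - west 0 (vec d) - lam 0 (vec d) p.
Proof.
set v := vec d => gen nonb l0 hmax.
have g0 : y_ p != y_ (0 : 'cV[R]_2) by have := gen 0%N; rewrite corner0.
have gv : y_ p != y_ v by have := gen 1%N; rewrite corner1.
have n3 := nsides_ge3 polyP d.
pose s := y_ p / y_ v.
have vy0 : y_ v != 0.
  apply: contraNneq l0 => vy; rewrite lamE // /sgn_cross vy mxE subrr.
  by case: ifP.
have hs : 0 < s < 1.
  move: l0; rewrite /lam; move: g0 gv; rewrite mxE /s.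
  case: (ltrgtP (y_ p) 0) => //= h1 _; case: (ltrgtP (y_ p) (y_ v)) => //= h2 _ _.
  - by rewrite -mulrNN -invrN divr_gt0 ?ltr_pdivrMr /=; lra.
  - by rewrite divr_gt0 ?ltr_pdivrMr /=; lra.
(* The first point of the polygon on the ray from [p] to the west. The sides other than [d] are
   counted alike from [z] and from [p], and [z] is reached from the base corner along [d] without
   meeting the nonadjacent sides. *)
pose z := s *: v.
have zy : y_ z = y_ p by rewrite mxE divfK.
have zx : x_ z = xcross 0 v (y_ p).
  by rewrite /xcross !mxE !subr0 add0r.
have zp : x_ z < x_ p.
  by move: l0; rewrite lamE // zx; case: ifP.
have zlam j : (0 < j < n d)%N -> lam (V d j) (V d j.+1) z = lam (V d j) (V d j.+1) p.
  move=> /andP[j0 jn]; rewrite !lamE ?zy //.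
  have [sg0|sg] := eqVneq (sgn_cross (V d j) (V d j.+1) (y_ p)) 0.
    by rewrite sg0; do 2 case: ifP.
  have := hmax j jn; rewrite lamE // -zx; set X := xcross _ _ _ => hX.
  have Xz : X != x_ z.
    apply/eqP=> eX; have hz : on_seg (V d j) (V d j.+1) z.
      by apply: on_seg_sgn_cross; rewrite zy.
    have [jn'|jn'] := ltnP j.+1 (n d).
      apply: (@initial_edge_disjoint _ _ _ _ polyP d j s _ j0 jn' z hz).
        by case/andP: hs => /ltW -> ->.
      exact: on_segr.
    have ej : j.+1 = n d by apply/eqP; rewrite eqn_leq jn jn'.
    case/(@edge_point _ _ _ _ d j): hz => [[t ht ez]|ez].
      have [] := @corner_param _ _ _ _ polyP d 0%N j s t; rewrite ?nsides_gt0 //.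
      - by case/andP: hs => /ltW -> ->.
      - by rewrite corner0 add0r side_vec0 -ez.
      - by move=> e0; rewrite -e0 in j0.
    by move/eqP: g0; apply; rewrite -zy ez ej (corner_nsides polyP).
  case: (ltrP X (x_ p)) hX => hXp.
    by move=> /(_ sg); rewrite le_eqVlt (negbTE Xz) /= => ->.
  by move=> _; case: ltrP => // hXz; exfalso; lra.
rewrite /wind /left_wind.
have := zlam; have := (corner_nsides polyP d); have := n3.
have := (proper_corner_base polyP d).
have := @initial_edge_disjoint _ _ _ _ polyP d.
case: (n d) => [|[|m]] // dis pc m0 wrap {}zlam /=.
rewrite big_ord_recl /= corner0 corner1 -/v.
have -> : \sum_(i < m.+1) lam (V d (bump 0 i)) (V d (bump 0 i).+1) p =
  \sum_(1 <= j < m.+2) lam (V d j) (V d j.+1) z.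
  rewrite big_add1 big_mkord; apply: eq_bigr => i _.
  by symmetry; apply: (zlam i.+1); exact: (ltn_ord i).
rewrite big_nat_recr //= wrap.
have s01 : 0 <= s < 1 by case/andP: hs => /ltW -> ->.
have mid : \sum_(1 <= j < m.+1) (lam (V d j) (V d j.+1) 0 - lam (V d j) (V d j.+1) z)
   = kap 0 z (V d m.+1) - kap 0 z v.
  have <- : \sum_(1 <= j < m.+1) (kap 0 z (V d j.+1) - kap 0 z (V d j)) =
      kap 0 z (V d m.+1) - kap 0 z v by rewrite telescope_sumr // corner1.
  apply: eq_big_nat => j /andP[j2 jk].
  have : disjoint_segs (V d j) (V d j.+1) 0 z by apply: dis.
  move/inter_disjoint; rewrite /inter_num.
  by move: (lam _ _ _) (lam _ _ _) (kap _ _ _) (kap _ _ _) => *; lia.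
have ez : z = 0 + s *: (v - 0) by rewrite add0r subr0.
have s0 : 0 < s by case/andP: hs.
have kv : kap 0 z v = 0 by rewrite ez kap_beyond.
have nz : 0 != z by rewrite eq_sym scaler_eq0 gt_eqF //=; apply: (vec_neq0 polyP).
have pcz : proper_corner (V d m.+1) 0 z.
  by rewrite ez; apply: (proper_corner_scale s0 pc).
have := corner_in nz pcz; rewrite [X in crn _ _ X]ez [X in west _ X]ez.
rewrite crn_scale // west_scale //.
move: mid; rewrite sumrB kv; clear; rewrite -/v.
move: (lam 0 v p) (lam _ 0 z) (kap _ _ _) (west _ _) (crn _ _ _) (\sum_(_ <= _ < _) _) (\sum_(_ <= _ < _) _).
by move=> *; lia.
Qed.

(* Left of the boundary the winding number is [left_wind d], on its right it
   is one less. *)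
Lemma wind_values d p : generic_height d p -> ~ onb d p ->
  [\/ wind d p = 0, wind d p = left_wind d | wind d p = left_wind d - 1].
Proof.
move=> gen nonb; have n0 := nsides_gt0 next d.
have [/existsP[i0 hi0]|/existsPn h0] :=
  boolP [exists i : 'I_(n d), lam (V d i) (V d i.+1) p != 0]; last first.
  apply: Or31; rewrite /wind big1 ?oppr0 // => i _.
  by apply/eqP; have := h0 i; rewrite negbK.
case: (@Order.TotalTheory.arg_maxP _ _ 'I_(n d) i0 (fun i => lam (V d i) (V d i.+1) p != 0)
  (fun i => xcross (V d i) (V d i.+1) (y_ p)) hi0) => i li hmax.
have e := left_wind_iter i d.
pose d' := iter i next d; pose p' := p - V d i.
have tr j : V d' j = V d (i + j)%N - V d i by rewrite corner_add addrC addKr.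
have tr1 j : V d (i + j)%N = V d' j + V d i by rewrite tr subrK.
have xT w a b t : xcross (a + w) (b + w) (t + w 1 0) = xcross a b t + w 0 0.
  have e' (x y u : R) : x + u - (y + u) = x - y by ring.
  by rewrite /xcross !mxE !e'; ring.
have l0 : lam 0 (vec d') p' = lam (V d i) (V d i.+1) p.
  rewrite -(lamT (V d i)) subrK add0r; congr (lam _ _ _).
  by rewrite cornerS addrC.
have := @wind_first_edge d' p' (generic_height_iter i gen).
rewrite onb_iter // wind_iter // e => h; have {}h := h nonb; rewrite h; first last.
- move=> j; rewrite nsides_iter => jn lj.
  pose k := ((i + j) %% n d)%N; have kn : (k < n d)%N by rewrite ltn_mod.
  have ek : V d k = V d' j + V d i by rewrite -tr1 [RHS]corner_mod.
  have ek1 : V d k.+1 = V d' j.+1 + V d i.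
    by rewrite -tr1 addnS corner_mod [RHS]corner_mod; congr (V d _); rewrite -addn1 modnDml addn1.
  have := hmax (Ordinal kn); rewrite /= ek ek1 -{1}(subrK (V d i) p) lamT => /(_ lj).
  have -> : y_ p = y_ p' + y_ (V d i) by rewrite !mxE subrK.
  rewrite xT.
  have -> : xcross (V d i) (V d i.+1) (y_ p' + y_ (V d i)) =
            xcross 0 (vec d') (y_ p') + x_ (V d i).
    by rewrite -xT add0r cornerS [vec d' + _]addrC.
  by rewrite lerD2r.
- by rewrite l0.
have gv : y_ p' != y_ (vec d').
  by have := generic_height_iter i gen 1%N; rewrite corner1.
have g0 : y_ p' != y_ (0 : 'cV[R]_2).
  by have := generic_height_iter i gen 0%N; rewrite corner0.
move: (left_wind d) => L; move: l0 li; rewrite -/p' -/d' => <-.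
rewrite lamE // /sgn_cross /west; case: ifP => // _.
move: g0 gv; rewrite ![(0 : 'cV[R]_2) _ _]mxE.
case: (ltrgtP (y_ p') 0) => //= h1 _; case: (ltrgtP (y_ p') (y_ (vec d'))) => //= h2 _; rewrite ?subrr ?eqxx // => _.
- by rewrite (lt_trans h2 h1) /=; apply: Or32; lia.
- have h12 := lt_trans h1 h2.
  by rewrite ltNge (ltW h12) gt_eqF //=; apply: Or33; lia.
Qed.

End Jordan.

(** * Summation over slabs between consecutive values *)

Section Slabs.
Variable R : realFieldType.
Implicit Types (f : R -> R) (t a : R) (ts : seq R).

Definition mid (s : R * R) : R := (s.1 + s.2) / 2.

Definition slabs t ts : seq (R * R) := zip (t :: ts) ts.

Lemma slabs_above t ts a : path <%R t ts -> a <= t ->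
  forall s, s \in slabs t ts -> a < mid s.
Proof.
elim: ts t => [|u ts IH] t //= /andP[tu up] at_ s; rewrite inE => /orP[/eqP ->|].
  by rewrite /mid /=; lra.
by apply: IH => //; lra.
Qed.

Lemma slabs_lt t ts s : path <%R t ts -> s \in slabs t ts -> s.1 < s.2.
Proof.
elim: ts t => [|u ts IH] t //= /andP[tu up]; rewrite inE => /orP[/eqP ->|] //.
exact: IH.
Qed.

Lemma mid_notin t ts s a : path <%R t ts -> s \in slabs t ts -> a \in t :: ts ->
  mid s != a.
Proof.
elim: ts t => [|u ts IH] t //= /andP[tu up]; rewrite inE => /orP[/eqP ->|hs].
  rewrite !inE => /or3P[/eqP->|/eqP->|ha].
  - by apply/eqP; rewrite /mid /=; lra.
  - by apply/eqP; rewrite /mid /=; lra.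
  - have := order_path_min lt_trans up => /allP/(_ a ha) h.
    by apply/eqP; rewrite /mid /=; lra.
rewrite inE => /orP[/eqP ->|]; last exact: IH.
by rewrite gt_eqF //; apply: (slabs_above up _ hs); apply: ltW.
Qed.

(** A discrete fundamental theorem of calculus. Midpoints of slabs differ from all listed values, so
    the test [mid s < a] never meets a tie. *)
Lemma slab_sum f t ts a : path <%R t ts -> a \in t :: ts ->
  f a = f t + \sum_(s <- slabs t ts) (f s.2 - f s.1) * (mid s < a)%R%:R.
Proof.
elim: ts t => [|u ts IH] t; first by rewrite inE big_nil addr0 => _ /eqP ->.
move=> /= /andP[tu up]; rewrite big_cons /= inE => /orP[/eqP ->|ha].
  rewrite big1_seq => [|s /= hs].
    by rewrite (_ : mid _ < _ = false) ?mulr0 ?addr0 //; apply/negP; rewrite /mid /= => ?; lra.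
  have : t < mid s by apply: (slabs_above up) => //; apply: ltW.
  by case: ltgtP; rewrite ?mulr0.
have ua : u <= a.
  move: ha; rewrite inE => /orP[/eqP -> //|ha].
  by have := order_path_min lt_trans up => /allP/(_ a ha) /ltW.
rewrite (IH u up ha) (_ : mid (t, u) < a) ?mulr1; last by rewrite /mid /=; lra.
by ring.
Qed.

End Slabs.

(** * Positive area puts the inside on the left *)

Section Area.
Variables (R : realType) (D : finType) (next : {perm D}) (vec : D -> 'cV[R]_2).
Local Notation n := (nsides next).
Local Notation V := (corner next vec).
Local Notation side := (side_vec next vec).
Local Notation wind := (wind next vec).
Local Notation onb := (onb next vec).
Local Notation left_wind := (left_wind next vec).
Local Notation generic_height := (generic_height next vec).
Local Notation x_ v := (v 0 0).
Local Notation y_ v := (v 1 0).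
Implicit Types (d : D) (p q z w : 'cV[R]_2).

Hypothesis polyP : forall d, euclidean_polygon next vec d.

Lemma det_mx22 (A : 'M[R]_2) : \det A = A 0 0 * A 1 1 - A 0 1 * A 1 0.
Proof.
rewrite (expand_det_row _ 0) !big_ord_recl big_ord0 /cofactor !det_mx11 !mxE /=.
rewrite expr0 expr1 mul1r addr0 mulN1r mulrN.
by congr (_ * A _ _ - A _ _ * A _ _); apply: val_inj.
Qed.

Lemma det_row_mx (a b : 'cV[R]_2) : \det (row_mx a b : 'M[R]_2) = det2 a b.
Proof.
have e0 i : row_mx a b i (0 : 'I_2) = a i 0.
  by rewrite -(row_mxEl a b i 0); congr (_ i _); apply: val_inj.
have e1 i : row_mx a b i (1 : 'I_2) = b i 0.
  by rewrite -(row_mxEr a b i 0); congr (_ i _); apply: val_inj.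
by rewrite det_mx22 !e0 !e1 /det2; ring.
Qed.

Lemma twice_areaE d : twice_signed_area next vec d =
  \sum_(i < n d) (x_ (V d i) + x_ (V d i.+1)) * (y_ (V d i.+1) - y_ (V d i)).
Proof.
have tel : \sum_(i < n d) (x_ (V d i.+1) * y_ (V d i.+1) - x_ (V d i) * y_ (V d i)) = 0.
  rewrite -(big_mkord xpredT (fun i => x_ (V d i.+1) * y_ (V d i.+1) - x_ (V d i) * y_ (V d i))).
  rewrite (telescope_sumr (fun i => x_ (V d i) * y_ (V d i))) //.
  by rewrite (corner_nsides polyP) corner0 subrr.
apply/esym/eqP; rewrite -subr_eq0; apply/eqP; rewrite -sumrB -[RHS]tel.
apply: eq_bigr => i _; rewrite -(edge_next next vec).
by rewrite det_row_mx /det2 !mxE; ring.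
Qed.

Definition xedge d i (t : R) : R := xcross (V d i) (V d i.+1) t.
Definition sedge d i (t : R) : int := sgn_cross (V d i) (V d i.+1) t.

Lemma sum_sgn_cross d t : \sum_(i < n d) sedge d i t = 0.
Proof.
rewrite -(big_mkord xpredT (fun i => sedge d i t)).
rewrite (telescope_sumr (fun i => (t < y_ (V d i))%R%:Z)) //.
by rewrite (corner_nsides polyP) corner0 subrr.
Qed.

(** By summation by parts, the signed sum of the abscissas where a horizontal line crosses the
    polygon is the sum of the lengths of the gaps between crossings, each weighted by the winding
    number in the gap. The signs add up to zero, so no boundary term is left. *)
Lemma slab_slice_le0 d t : (forall i, t != y_ (V d i)) ->
  (forall p, generic_height d p -> ~ onb d p -> wind d p <= 0) ->
  \sum_(i < n d) (sedge d i t)%:~R * xedge d i t <= 0.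
Proof.
move=> gt neg; pose xs := sort <=%R (undup [seq xedge d i t | i <- iota 0 (n d)]).
have sx : sorted <%R xs by rewrite sort_lt_sorted undup_uniq.
have inx (i : 'I_(n d)) : xedge d i t \in xs.
  rewrite mem_sort mem_undup; apply/mapP; exists (val i) => //.
  by rewrite mem_iota /=; apply: ltn_ord.
have := nsides_gt0 next d.
case ex : xs sx inx => [|u us] /= sx inx n0; first by have := inx (Ordinal n0).
rewrite (eq_bigr (fun i : 'I_(n d) => (sedge d i t)%:~R * u + \sum_(s <- slabs u us)
   (s.2 - s.1) * ((sedge d i t)%:~R * (mid s < xedge d i t)%R%:R))); last first.
  move=> i _; rewrite {1}(slab_sum id sx (inx i)) mulrDr mulr_sumr; congr (_ + _).
  by apply: eq_bigr => s _; ring.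
rewrite big_split /= -mulr_suml.
have -> : \sum_(i < n d) (sedge d i t)%:~R = 0 :> R.
  by rewrite -rmorph_sum sum_sgn_cross.
rewrite mul0r add0r exchange_big /= big_seq; apply: sumr_le0 => s hs.
rewrite -mulr_sumr; apply: mulr_ge0_le0; first by rewrite subr_ge0 ltW // (slabs_lt sx hs).
pose p : 'cV[R]_2 := \col_i (if i == 0 then mid s else t).
have px : x_ p = mid s by rewrite mxE.
have py : y_ p = t by rewrite mxE.
have gp : generic_height d p by move=> i; rewrite py.
have nonb : ~ onb d p.
  case=> i hi [r hr ep]; have ne := mid_notin sx hs (inx (Ordinal hi)).
  case/eqP: ne; rewrite -px /xedge /= -py /xcross.
  have e0 : p 0 0 = x_ (V d i) + r * (x_ (V d i.+1) - x_ (V d i)) by rewrite ep !mxE.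
  have e1 : p 1 0 = y_ (V d i) + r * (y_ (V d i.+1) - y_ (V d i)) by rewrite ep !mxE.
  rewrite e0 e1; have := gt i; rewrite -py e1 -subr_eq0.
  have -> : y_ (V d i) + r * (y_ (V d i.+1) - y_ (V d i)) - y_ (V d i) =
     r * (y_ (V d i.+1) - y_ (V d i)) by ring.
  rewrite mulf_eq0 negb_or => /andP[_ h]; field.
  exact: h.
suff -> : \sum_(i < n d) (sedge d i t)%:~R * (mid s < xedge d i t)%R%:R = (wind d p)%:~R :> R.
  by rewrite lerz0; apply: neg.
rewrite /wind -sumrN rmorph_sum /=.
have e0 : \sum_(i < n d) (sedge d i t)%:~R = 0 :> R.
  by rewrite -rmorph_sum sum_sgn_cross.
rewrite -[RHS]addr0 -[X in _ = _ + X]e0 -big_split /=; apply: eq_bigr => i _.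
rewrite lamE ?py // px -/(xedge d i t) -/(sedge d i t).
have := mid_notin sx hs (inx i).
by case: (ltgtP (mid s) (xedge d i t)) => //= _ _; rewrite ?mulr1 ?mulr0 ?oppr0 ?add0r ?rmorphN ?addNr.
Qed.

(** If the value were 0, all winding numbers off the boundary would be nonpositive at generic
    heights. The area, integrated slice by slice, would then be nonpositive too. *)
Lemma left_wind1 d : left_wind d = 1.
Proof.
case: (left_wind01 polyP d) => // l0; exfalso.
have neg p : generic_height d p -> ~ onb d p -> wind d p <= 0.
  by move=> g h; case: (wind_values polyP g h); rewrite ?l0 => ->.
have [_ _] := polyP d; rewrite ltNge => /negP; apply; rewrite twice_areaE.
pose ys := sort <=%R (undup [seq y_ (V d i) | i <- iota 0 (n d)]).
have sy : sorted <%R ys by rewrite sort_lt_sorted undup_uniq.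
have n0 := nsides_gt0 next d.
have iny i : y_ (V d i) \in ys.
  rewrite mem_sort mem_undup; apply/mapP; exists (i %% n d)%N; last by rewrite (corner_mod polyP).
  by rewrite mem_iota /= ltn_mod.
case ey : ys sy iny => [|u us] /= sy iny; first by have := iny 0%N.
(* [k i] is the inverse slope of a side, equal to 0 for a horizontal one because the inverse of 0 is
   0. [G i] is a primitive of twice the abscissa of the side; as it is quadratic, the midpoint rule
   is exact on every slab. *)
pose k i := (y_ (V d i.+1) - y_ (V d i))^-1 * (x_ (V d i.+1) - x_ (V d i)).
pose G i t : R := 2 * x_ (V d i) * t + k i * (t - y_ (V d i)) ^+ 2.
have GE i : G i (y_ (V d i.+1)) - G i (y_ (V d i)) =
    (x_ (V d i) + x_ (V d i.+1)) * (y_ (V d i.+1) - y_ (V d i)).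
  rewrite /G /k; have [e|ne] := eqVneq (y_ (V d i.+1) - y_ (V d i)) 0.
    by move/eqP: e; rewrite subr_eq0 => /eqP ->; rewrite !subrr; ring.
  by field.
rewrite -(eq_bigr _ (fun (i : 'I_(n d)) _ => GE i)).
rewrite (eq_bigr (fun i : 'I_(n d) => \sum_(s <- slabs u us)
   2 * (s.2 - s.1) * ((sedge d i (mid s))%:~R * xedge d i (mid s)))); last first.
  move=> i _; rewrite (slab_sum (G i) sy (iny i)) (slab_sum (G i) sy (iny i.+1)).
  rewrite opprD addrACA subrr add0r -sumrB; apply: eq_bigr => s _.
  have -> : G i s.2 - G i s.1 = 2 * (s.2 - s.1) * xedge d i (mid s).
    rewrite /G /k /xedge /xcross /mid; by move: (_^-1) => y; field.
  rewrite /sedge /sgn_cross. rewrite intrB -!pmulrn; ring.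
rewrite exchange_big /= big_seq; apply: sumr_le0 => s hs.
rewrite -mulr_sumr; apply: mulr_ge0_le0.
  by rewrite mulr_ge0 // subr_ge0 ltW // (slabs_lt sy hs).
by apply: slab_slice_le0 => // i; apply: (mid_notin sy hs).
Qed.

Lemma wind01 d p : generic_height d p -> ~ onb d p -> wind d p = 0 \/ wind d p = 1.
Proof.
by move=> g h; case: (wind_values polyP g h); rewrite ?left_wind1; [left|right|left].
Qed.

End Area.

(** * Staying away from a segment for a short time *)

Section Away.
Variable R : realFieldType.
Implicit Types a b p q u v z : 'cV[R]_2.
Local Notation x_ v := (v 0 0).
Local Notation y_ v := (v 1 0).

Let lin (al be : R) v := al * x_ v + be * y_ v.

(** The functional is normal to the segment if [z] is off its line, and otherwise points along that
    line, or from [z] to the segment when the segment is a single point. *)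
Lemma separate_seg a b z : ~ on_seg a b z ->
  exists al be, lin al be z < lin al be a /\ lin al be z < lin al be b.
Proof.
move=> nz; pose w := b - a.
case: (ltrgtP (orient a b z) 0) => o.
- exists (- (y_ b - y_ a)), (x_ b - x_ a).
  by move: o; rewrite orientE /lin; split; lra.
- exists (y_ b - y_ a), (- (x_ b - x_ a)).
  by move: o; rewrite orientE /lin; split; lra.
move: o; rewrite orientE => o.
have [/eqP ab|ab] := boolP (a == b).
  exists (x_ a - x_ z), (y_ a - y_ z); rewrite -ab.
  have ne : ~ (x_ a - x_ z = 0 /\ y_ a - y_ z = 0).
    move=> [h1 h2]; apply: nz; rewrite -ab (_ : z = a); first exact: on_segl.
    by apply: cV2_eq; lra.
  suff h : 0 < (x_ a - x_ z) ^+ 2 + (y_ a - y_ z) ^+ 2.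
    by move: h; rewrite /lin !expr2; split; lra.
  rewrite lt_neqAle addr_ge0 ?sqr_ge0 // andbT eq_sym paddr_eq0 ?sqr_ge0 //.
  by rewrite !sqrf_eq0; apply/negP=> /andP[/eqP ? /eqP ?]; apply: ne.
have pos : 0 < (x_ b - x_ a) ^+ 2 + (y_ b - y_ a) ^+ 2.
  rewrite lt_neqAle addr_ge0 ?sqr_ge0 // andbT eq_sym paddr_eq0 ?sqr_ge0 //.
  rewrite !sqrf_eq0 !subr_eq0; apply/negP=> /andP[/eqP h1 /eqP h2].
  by case/eqP: ab; apply: cV2_eq.
set W := _ + _ in pos.
pose t := ((x_ b - x_ a) * (x_ z - x_ a) + (y_ b - y_ a) * (y_ z - y_ a)) / W.
have tW : t * W = (x_ b - x_ a) * (x_ z - x_ a) + (y_ b - y_ a) * (y_ z - y_ a).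
  by rewrite divfK // gt_eqF.
have ez : z = a + t *: (b - a).
  have Wn : W != 0 by rewrite gt_eqF.
  apply: cV2_eq; rewrite !mxE; apply: (mulIf Wn); rewrite mulrDl mulrAC tW /W;
    apply/eqP; rewrite -subr_eq0; apply/eqP.
  - transitivity (- (y_ b - y_ a) * ((x_ b - x_ a) * (y_ z - y_ a) -
      (y_ b - y_ a) * (x_ z - x_ a))); first by ring.
    by rewrite o mulr0.
  - transitivity ((x_ b - x_ a) * ((x_ b - x_ a) * (y_ z - y_ a) -
      (y_ b - y_ a) * (x_ z - x_ a))); first by ring.
    by rewrite o mulr0.
have nt : ~ (0 <= t <= 1) by move=> ht; apply: nz; exists t.
have ex : x_ z = x_ a + t * (x_ b - x_ a) by rewrite {1}ez !mxE.
have ey : y_ z = y_ a + t * (y_ b - y_ a) by rewrite {1}ez !mxE.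
clear nz ez ab tW.
case: (ltrP t 0) => t0.
  exists (x_ b - x_ a), (y_ b - y_ a); rewrite /lin ex ey.
  have : t * W < 0 by rewrite nmulr_rlt0.
  by move: pos; rewrite /W !expr2; split; lra.
have t1 : 1 < t by rewrite ltNge; apply/negP => t1; apply: nt; rewrite t0 t1.
exists (- (x_ b - x_ a)), (- (y_ b - y_ a)); rewrite /lin ex ey.
have : 0 < (t - 1) * W by rewrite mulr_gt0 // subr_gt0.
by move: pos; rewrite /W !expr2; split; lra.
Qed.

Lemma seg_away a b z u : ~ on_seg a b z ->
  exists2 e : R, 0 < e & forall r, `|r| <= e -> ~ on_seg a b (z + r *: u).
Proof.
move=> /separate_seg [al [be [h1 h2]]].
pose m := Num.min (lin al be a - lin al be z) (lin al be b - lin al be z).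
have m0 : 0 < m by rewrite lt_min !subr_gt0 h1 h2.
have ma : m <= lin al be a - lin al be z by rewrite ge_min lexx.
have mb : m <= lin al be b - lin al be z by rewrite ge_min lexx orbT.
pose L := `|lin al be u| + 1.
have L0 : 0 < L by rewrite ltr_wpDl.
exists (m / (2 * L)); first by rewrite divr_gt0 // mulr_gt0.
move=> r hr [s hs e].
have el : lin al be z + r * lin al be u =
   lin al be a + s * (lin al be b - lin al be a).
  move/matrixP: e => e; move: (e 0 0) (e 1 0); rewrite !mxE => e0 e1.
  transitivity (al * (x_ z + r * x_ u) + be * (y_ z + r * y_ u)); first by rewrite /lin; ring.
  by rewrite e0 e1 /lin; ring.
have big : m <= r * lin al be u.
  case/andP: hs => s0 s1.
  have h3 : 0 <= s * ((lin al be b - lin al be z) - m) by rewrite mulr_ge0 ?subr_ge0.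
  have h4 : 0 <= (1 - s) * ((lin al be a - lin al be z) - m) by rewrite mulr_ge0 ?subr_ge0.
  move: el h3 h4; clear; move: (lin _ _ _) (lin _ _ _) (lin _ _ _) (lin _ _ _) => A B C E; lra.
have : r * lin al be u <= `|r| * L.
  apply: le_trans (ler_norm _) _; rewrite normrM; apply: ler_wpM2l => //.
  by rewrite /L lerDl.
have : `|r| * L <= m / 2.
  have -> : m / 2 = m / (2 * L) * L by field; rewrite gt_eqF.
  by rewrite ler_pM2r.
lra.
Qed.

Lemma uniform_eps (m : nat) (P : nat -> R -> Prop) :
  (forall j e e', P j e -> 0 < e' <= e -> P j e') ->
  (forall j, (j < m)%N -> exists2 e, 0 < e & P j e) ->
  exists2 e, 0 < e & forall j, (j < m)%N -> P j e.
Proof.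
move=> mono; elim: m => [|m IH] h; first by exists 1.
have [|e e0 he] := IH; first by move=> j jm; apply: h; apply: ltnW.
have [e' e'0 he'] := h m (ltnSn m).
exists (Num.min e e'); first by rewrite lt_min e0.
move=> j; rewrite ltnS leq_eqVlt => /orP[/eqP ->|jm].
  by apply: mono he' _; rewrite lt_min e0 e'0 ge_min lexx orbT.
by apply: mono (he j jm) _; rewrite lt_min e0 e'0 ge_min lexx.
Qed.

End Away.

Section Free.
Variables (R : realType) (D : finType) (next : {perm D}) (vec : D -> 'cV[R]_2).
Local Notation n := (nsides next).
Local Notation V := (corner next vec).
Local Notation side := (side_vec next vec).
Local Notation wind := (wind next vec).
Local Notation onb := (onb next vec).
Implicit Types (d : D) (p q z w u : 'cV[R]_2).

Hypothesis polyP : forall d, euclidean_polygon next vec d.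

(** Around a closed polygon the [kap] terms telescope, and only the [lam] terms, which make up the
    winding numbers, survive. *)
Lemma sum_inter d p q :
  \sum_(i < n d) inter_num (V d i) (V d i.+1) p q = wind d p - wind d q.
Proof.
have tel : \sum_(i < n d) (kap p q (V d i.+1) - kap p q (V d i)) = 0.
  rewrite -(big_mkord xpredT (fun i => kap p q (V d i.+1) - kap p q (V d i))).
  rewrite (telescope_sumr (fun i => kap p q (V d i))) //.
  by rewrite (corner_nsides polyP) corner0 subrr.
rewrite /wind opprK addrC -[RHS]addr0 -[X in _ = _ + X]tel -sumrB -big_split /=.
by apply: eq_bigr => i _; rewrite /inter_num addrA.
Qed.

Lemma wind_free d p u s : 0 <= s -> (forall r, 0 <= r <= s -> ~ onb d (p + r *: u)) ->
  wind d (p + s *: u) = wind d p.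
Proof.
move=> s0 free; apply/esym/eqP; rewrite -subr_eq0 -sum_inter big1 // => i _.
apply: inter_disjoint => z hz [t ht ez].
apply: (free (t * s)); first by apply/andP; split; nra.
exists i => //; move: hz; rewrite ez; congr (on_seg _ _ _).
by rewrite [p + _]addrC addrK scalerA addrC.
Qed.

(** The other sides are avoided and contribute 0, so the change of the winding number is the
    intersection number with the side [d] alone, a transversal crossing whose sign is that of
    [det2 (vec d) u]. *)
Lemma cross_jump d p u r0 c t1 t2 : t1 < r0 < t2 -> 0 < c < 1 ->
  p + r0 *: u = c *: vec d ->
  (forall j r, (0 < j < n d)%N -> t1 <= r <= t2 ->
     ~ on_seg (V d j) (V d j.+1) (p + r *: u)) ->
  (det2 (vec d) u < 0 -> wind d (p + t2 *: u) = wind d (p + t1 *: u) - 1) /\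
  (0 < det2 (vec d) u -> wind d (p + t2 *: u) = wind d (p + t1 *: u) + 1).
Proof.
move=> /andP[h1 h2] /andP[c0 c1] ez dis.
have e0 : p 0 0 = c * vec d 0 0 - r0 * u 0 0.
  by move/matrixP: ez => /(_ 0 0); rewrite !mxE => <-; ring.
have e1 : p 1 0 = c * vec d 1 0 - r0 * u 1 0.
  by move/matrixP: ez => /(_ 1 0); rewrite !mxE => <-; ring.
have := sum_inter d (p + t1 *: u) (p + t2 *: u).
have nd : (1 < n d)%N by apply: leq_trans (nsides_ge3 polyP d).
rewrite (bigD1 (Ordinal (ltnW nd))) //= big1 ?addr0; last first.
  move=> i i0; apply: inter_disjoint => z hz [t ht ezz].
  apply: (dis i (t1 + t * (t2 - t1))).
  - by rewrite lt0n; apply/andP; split=> //; apply: contraNneq i0 => i0; apply/eqP/val_inj.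
  - by apply/andP; split; nra.
  - move: hz; rewrite ezz; congr (on_seg _ _ _).
    by apply: cV2_eq; rewrite !mxE; ring.
rewrite corner0 corner1.
set p1 := p + t1 *: u; set p2 := p + t2 *: u.
have o1 : orient 0 (vec d) p1 = - (r0 - t1) * det2 (vec d) u.
  by rewrite orientE /det2 !mxE e0 e1; ring.
have o2 : orient 0 (vec d) p2 = (t2 - r0) * det2 (vec d) u.
  by rewrite orientE /det2 !mxE e0 e1; ring.
have o3 : orient p1 p2 0 = (t2 - t1) * c * det2 (vec d) u.
  by rewrite orientE /det2 !mxE e0 e1; ring.
have o4 : orient p1 p2 (vec d) = - ((t2 - t1) * (1 - c)) * det2 (vec d) u.
  by rewrite orientE /det2 !mxE e0 e1; ring.
have a1 : 0 < r0 - t1 by lra.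
have a2 : 0 < t2 - r0 by lra.
have a3 : 0 < (t2 - t1) * c by apply: mulr_gt0 => //; lra.
have a4 : 0 < (t2 - t1) * (1 - c) by apply: mulr_gt0; lra.
move=> hw; split=> hd.
- have := @inter_crossing _ 0 (vec d) p1 p2; rewrite o1 o2 o3 o4 hw => hx.
  suff : wind d p1 - wind d p2 = 1 by move=> <-; rewrite opprB addrC subrK.
  apply: hx; first by rewrite nmulr_rgt0 // oppr_lt0.
  - by rewrite pmulr_rlt0.
  - by rewrite pmulr_rlt0.
  - by rewrite nmulr_rgt0 // oppr_lt0.
- have := @inter_crossing _ 0 (vec d) p2 p1; rewrite inter_swapr.
  rewrite !(orient_swap p1) o1 o2 o3 o4 hw => hx.
  suff : - (wind d p1 - wind d p2) = 1 by move=> <-; rewrite opprB addrC subrK.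
  apply: hx; first by rewrite pmulr_rgt0.
  - by rewrite nmulr_rlt0 // oppr_lt0.
  - by rewrite oppr_lt0 pmulr_rgt0.
  - by rewrite mulNr opprK pmulr_rgt0.
Qed.

End Free.

(** * Straight trajectories under cut and paste *)

(** The ring is meant to contain the coordinates of all surfaces involved. Density provides an
    admissible time in every interval, at which a trajectory may be interrupted. *)
Record dense_subring (R : realFieldType) (K : R -> Prop) : Prop := DenseSubring {
  dense1 : K 1;
  denseB : forall x y, K x -> K y -> K (x - y);
  denseM : forall x y, K x -> K y -> K (x * y);
  dense_between : forall a b, a < b -> exists2 k, K k & a < k < b }.

Section Generic.
Variables (R : realFieldType) (K : R -> Prop).
Hypothesis hK : dense_subring K.
Implicit Types a b p q u v w z : 'cV[R]_2.
Local Notation x_ v := (v 0 0).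
Local Notation y_ v := (v 1 0).

Lemma dense0 : K 0.
Proof. by rewrite -(subrr 1); apply: denseB => //; apply: dense1. Qed.

Lemma denseN x : K x -> K (- x).
Proof. by move=> h; rewrite -sub0r; apply: denseB => //; apply: dense0. Qed.

Lemma denseD x y : K x -> K y -> K (x + y).
Proof. by move=> h1 h2; rewrite -[y]opprK; apply: denseB => //; apply: denseN. Qed.

Definition Kvec v : Prop := K (x_ v) /\ K (y_ v).

Lemma Kvec0 : Kvec 0. Proof. by split; rewrite mxE; apply: dense0. Qed.
Lemma KvecN v : Kvec v -> Kvec (- v).
Proof. by case=> *; split; rewrite !mxE; apply: denseN. Qed.
Lemma KvecD v w : Kvec v -> Kvec w -> Kvec (v + w).
Proof. by case=> ? ? [? ?]; split; rewrite !mxE; apply: denseD. Qed.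
Lemma KvecZ k v : K k -> Kvec v -> Kvec (k *: v).
Proof. by move=> ? [? ?]; split; rewrite !mxE; apply: (denseM hK). Qed.

(* The coordinates of [p] are linearly independent over [K] modulo [K]. *)
Definition generic p : Prop := forall k1 k2 k3, K k1 -> K k2 -> K k3 ->
  k1 * x_ p + k2 * y_ p = k3 -> k1 = 0 /\ k2 = 0.

Lemma generic_add p w : Kvec w -> generic p -> generic (p + w).
Proof.
move=> [wx wy] g k1 k2 k3 h1 h2 h3; rewrite !mxE => e.
apply: (g k1 k2 (k3 - (k1 * x_ w + k2 * y_ w))) => //; last by rewrite -e; ring.
by apply: (denseB hK) => //; apply: denseD; apply: (denseM hK).
Qed.

(** The equation of a line over [K] is a nontrivial relation of the kind that genericity forbids. *)
Lemma generic_line p a v : generic p -> Kvec a -> Kvec v -> v != 0 ->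
  det2 v (p - a) != 0.
Proof.
move=> g [ax ay] [vx vy]; apply: contraNneq; rewrite /det2 !mxE => e.
have [] := g (- y_ v) (x_ v) (x_ v * y_ a - y_ v * x_ a) _ vx.
- exact: denseN.
- by apply: (denseB hK); apply: (denseM hK).
- by move: e => /(congr1 (fun t => t + (x_ v * y_ a - y_ v * x_ a))); rewrite add0r => <-; ring.
move=> /eqP; rewrite oppr_eq0 => /eqP vy0 vx0.
by apply/eqP/cV2_eq; rewrite mxE.
Qed.

(** This is how trajectories avoid vertices: hitting one would put the generic point on a line over
    [K]. *)
Lemma generic_avoid p a u r : generic p -> Kvec a -> Kvec u -> u != 0 ->
  p + r *: u <> a.
Proof.
move=> g ha hu u0 e; have := generic_line g ha hu u0.
rewrite -e opprD addrA subrr sub0r /det2 !mxE => /eqP; apply; ring.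
Qed.

End Generic.

Notation sonb X := (onb (next X) (vec X)).
Notation swind X := (wind (next X) (vec X)).
Notation scorner X := (corner (next X) (vec X)).

(** * Points of a surface, and crossings of its sides *)

Section Points.
Variable R : realType.
Implicit Types (X Y : translation_surface R) (p q u v w z : 'cV[R]_2).

(** The vector is measured from the initial endpoint of the side, in the plane of its polygon.
    Nothing forces the point to lie inside the polygon; that will be a winding number condition. *)
Definition pt X : Type := (side X * 'cV[R]_2)%type.

Definition rebase X (x : pt X) : pt X := (next X x.1, x.2 - vec X x.1).

Definition reb X (x y : pt X) : Prop := exists k, y = iter k (@rebase X) x.

Lemma iter_rebase X d p k :
  iter k (@rebase X) (d, p) = (iter k (next X) d, p - scorner X d k).
Proof.
elim: k => [|k IH]; first by rewrite corner0 subr0.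
by rewrite !iterS IH /rebase /= cornerS opprD addrA.
Qed.

Lemma reb_refl X (x : pt X) : reb x x. Proof. by exists 0%N. Qed.

Lemma reb_trans X (x y z : pt X) : reb x y -> reb y z -> reb x z.
Proof. by move=> [k ->] [l ->]; exists (l + k)%N; rewrite iterD. Qed.

Lemma iter_rebase_nsides X (x : pt X) :
  iter (nsides (next X) x.1) (@rebase X) x = x.
Proof.
case: x => d p; rewrite iter_rebase /= iter_nsides.
by rewrite (corner_nsides (@polygonP _ X)) subr0.
Qed.

Lemma reb_sym X (x y : pt X) : reb x y -> reb y x.
Proof.
move=> [k ->]; elim: k => [|k IH]; first exact: reb_refl.
apply: reb_trans IH; set z := iter k _ x.
exists (nsides (next X) (rebase z).1).-1.
rewrite iterS -iterSr prednK ?nsides_gt0 //.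
by rewrite /= nsides_next iter_rebase_nsides.
Qed.

Lemma reb_rebase X (x : pt X) : reb x (rebase x). Proof. by exists 1%N. Qed.

Lemma reb_shift X d d' p p' w : reb (d, p : 'cV[R]_2) ((d', p') : pt X) ->
  reb (d, p + w) (d', p' + w).
Proof.
by move=> [k]; rewrite iter_rebase => -[-> ->]; exists k; rewrite iter_rebase addrAC.
Qed.

Lemma reb_wind X (x y : pt X) : reb x y -> swind X y.1 y.2 = swind X x.1 x.2.
Proof.
move=> [k ->]; case: x => d p; rewrite iter_rebase /=.
exact: (wind_iter (@polygonP _ X)).
Qed.

Lemma reb_onb X (x y : pt X) : reb x y -> sonb X y.1 y.2 <-> sonb X x.1 x.2.
Proof.
move=> [k ->]; case: x => d p; rewrite iter_rebase /=.
exact: (onb_iter (@polygonP _ X)).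
Qed.

Definition free X (u : 'cV[R]_2) (d : side X) p (s : R) : Prop :=
  forall r, 0 <= r <= s -> ~ sonb X d (p + r *: u).

(* From [p] in the polygon of [d], moving for a time [s] in the direction [u]
   leads through the side [d], at time [r0], into the polygon of [glue d]. *)
Definition crossing X (u : 'cV[R]_2) (d : side X) p (s r0 c : R) : Prop :=
  [/\ 0 < r0 < s, 0 < c < 1, p + r0 *: u = c *: vec X d,
      forall r, 0 <= r < r0 -> ~ sonb X d (p + r *: u) &
      forall r, r0 < r <= s -> ~ sonb X (glue X d) (p + r *: u - vec X d)].

Section OverK.
Variable K : R -> Prop.
Hypothesis hK : dense_subring K.

Local Notation generic := (generic K).
Local Notation Kvec := (Kvec K).

Definition over X : Prop := forall d, Kvec (vec X d).

Lemma Kvec_corner X d i : over X -> Kvec (scorner X d i).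
Proof.
move=> oX; elim: i => [|i IH]; first by rewrite corner0; apply: Kvec0.
by rewrite cornerS; apply: KvecD => //; apply: oX.
Qed.

Lemma svec_neq0 X d : vec X d != 0.
Proof. exact: (vec_neq0 (@polygonP _ X)). Qed.

Lemma generic_off X d p : over X -> generic p -> ~ sonb X d p.
Proof.
move=> oX g [i hi [s hs]]; rewrite edge_next => e.
have := generic_line hK g (Kvec_corner d i oX) (oX (iter i (next X) d)) (svec_neq0 _).
rewrite e /det2 !mxE => /eqP; apply; ring.
Qed.

Lemma generic_gh X d p : over X -> generic p ->
  generic_height (next X) (vec X) d p.
Proof.
move=> oX g i; apply/eqP=> e.
have [_ ki] := Kvec_corner d i oX.
have [] := g 0 1 _ (dense0 hK) (dense1 hK) ki; first by rewrite mul0r mul1r add0r.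
by move=> _ /eqP; rewrite oner_eq0.
Qed.

Lemma generic_wind X d p : over X -> generic p -> swind X d p = 0 \/ swind X d p = 1.
Proof.
move=> oX g; apply: (wind01 (@polygonP _ X)); first exact: generic_gh.
exact: generic_off.
Qed.

Lemma reb_generic X (x y : pt X) : over X -> reb x y -> generic x.2 -> generic y.2.
Proof.
move=> oX [k ->] g; case: x g => d p g; rewrite iter_rebase /=.
by apply: generic_add => //; apply: KvecN => //; apply: Kvec_corner.
Qed.

Lemma crossing_transversal X d p u r c : over X -> generic p -> Kvec u ->
  p + r *: u = c *: vec X d -> det2 (vec X d) u != 0.
Proof.
move=> oX g hu e; have := generic_line hK g (Kvec0 hK) (oX d) (svec_neq0 d).
apply: contraNneq; rewrite subr0 => h.
have -> : p = c *: vec X d - r *: u by rewrite -e addrK.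
by apply/eqP; move: h; rewrite /det2 !mxE => h; transitivity (- r * (vec X d 0 0 * u 1 0 - vec X d 1 0 * u 0 0)); [ring|rewrite h mulr0].
Qed.

(** The point crossed is interior to the side [d], so by simplicity it is off the other sides and
    stays off them for a short time; the side [d] itself is met only once, by transversality. *)
Lemma crossing_isolated X d p u r0 c : over X -> generic p -> Kvec u ->
  0 < c < 1 -> p + r0 *: u = c *: vec X d ->
  exists2 e, 0 < e & forall r, `|r - r0| <= e ->
    (forall j, (0 < j < nsides (next X) d)%N ->
      ~ on_seg (scorner X d j) (scorner X d j.+1) (p + r *: u)) /\
    (r != r0 -> ~ sonb X d (p + r *: u)).
Proof.
move=> oX g hu hc e; have pol := @polygonP _ X.
have c01 : 0 <= c < 1 by case/andP: hc => /ltW -> ->.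
have n0 := nsides_gt0 (next X) d.
have param : c *: vec X d = scorner X d 0 + c *: side_vec (next X) (vec X) d 0.
  by rewrite corner0 add0r.
have off j : (0 < j < nsides (next X) d)%N ->
    ~ on_seg (scorner X d j) (scorner X d j.+1) (c *: vec X d).
  move=> /andP[j0 jn] /edge_point [[t ht]|ez].
    rewrite param => /(corner_param pol n0 jn c01 ht) [ej _].
    by rewrite -ej in j0.
  have [jn'|jn'] := ltnP j.+1 (nsides (next X) d).
    have [] := @corner_param _ _ _ _ pol d 0 j.+1 c 0 n0 jn' c01; rewrite ?lexx ?ltr01 //.
    by rewrite -param ez scale0r addr0.
  have ej : j.+1 = nsides (next X) d by apply/eqP; rewrite eqn_leq jn jn'.
  move/eqP: ez; rewrite ej (corner_nsides pol) scaler_eq0 (negbTE (svec_neq0 d)) orbF.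
  by case/andP: hc => hc _; rewrite gt_eqF.
have [||eps eps0 heps] := @uniform_eps _ (nsides (next X) d) (fun j e =>
   (0 < j)%N -> forall r, `|r - r0| <= e ->
     ~ on_seg (scorner X d j) (scorner X d j.+1) (p + r *: u)).
- move=> j e1 e2 h /andP[_ le] j0 r hr; apply: h => //; exact: le_trans hr le.
- move=> j jn; case: (posnP j) => [->|j0]; first by exists 1.
  have [|e1 e10 h] := seg_away u (off j _); first by rewrite j0.
  exists e1 => // _ r hr; have := h _ hr.
  by rewrite -e -addrA -scalerDl [r0 + _]addrC subrK.
exists eps => // r hr; split; first by move=> j /andP[j0 jn]; apply: heps.
move=> ne [j jn hj]; case: (posnP j) => [j0|j0]; last exact: (heps j jn j0 r hr hj).
move: hj; rewrite j0 corner0 corner1 => -[t _]; rewrite subr0 add0r => et.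
have := crossing_transversal oX g hu e.
have : (r - r0) * det2 (vec X d) u = 0.
  transitivity (det2 (vec X d) (p + r *: u) - det2 (vec X d) (p + r0 *: u)).
    by rewrite /det2 !mxE; ring.
  by rewrite et e /det2 !mxE; ring.
by move=> /eqP; rewrite mulf_eq0 subr_eq0 (negbTE ne) /= => ->.
Qed.

(** At generic points the winding number is 0 or 1, and it jumps by one across the side; the sign of
    the jump determines both values. *)
Lemma crossing_wind X d p u r0 c : over X -> generic p -> Kvec u ->
  0 < c < 1 -> p + r0 *: u = c *: vec X d ->
  exists2 e, 0 < e &
    (forall r, `|r - r0| <= e -> r != r0 -> ~ sonb X d (p + r *: u)) /\
    forall r, K r -> `|r - r0| <= e -> r != r0 ->
     swind X d (p + r *: u) = ((r < r0)%R == (det2 (vec X d) u < 0)%R)%:Z.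
Proof.
move=> oX g hu hc e; have pol := @polygonP _ X.
have [eps eps0 h] := crossing_isolated oX g hu hc e.
exists eps => //; split; first by move=> r hr ne; have [_] := h r hr; apply.
have tr := crossing_transversal oX g hu e.
have gr r : K r -> generic (p + r *: u).
  by move=> kr; apply: generic_add => //; apply: KvecZ.
have jump t1 t2 : K t1 -> K t2 -> t1 < r0 < t2 -> `|t1 - r0| <= eps -> `|t2 - r0| <= eps ->
    swind X d (p + t1 *: u) = (det2 (vec X d) u < 0)%R%:Z /\
    swind X d (p + t2 *: u) = (~~ (det2 (vec X d) u < 0)%R)%:Z.
  move=> k1 k2 t12; rewrite !ler_norml => h1 h2.
  have [|a b] := cross_jump pol (d := d) (p := p) t12 hc e.
    move=> j r hj hr; have [|h3 _] := h r; last exact: h3.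
    by rewrite ler_norml; lra.
  have w1 := generic_wind d oX (gr _ k1); have w2 := generic_wind d oX (gr _ k2).
  case: (ltrgtP (det2 (vec X d) u) 0) tr => // s _.
  - by have {b} := a s; case: w1 => ->; case: w2 => ->.
  - by have {a} := b s; case: w1 => ->; case: w2 => ->.
move=> r kr hr ne; case: (ltrgtP r r0) ne => // lr _.
(* A jump compares two times; the second one is an auxiliary time of [K] on the other side of
   [r0]. *)
- have lt2 : r0 < r0 + eps by rewrite ltrDl.
  have [t2 k2 h2] := dense_between hK lt2.
  have [] := jump r t2 kr k2 _ hr; first by rewrite lr; case/andP: h2.
    by rewrite ler_norml; lra.
  by move=> -> _; case: (_ < 0).
- have lt1 : r0 - eps < r0 by rewrite gtrBl.
  have [t1 k1 h1] := dense_between hK lt1.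
  have [] := jump t1 r k1 kr _ _ hr; first by rewrite lr andbT; case/andP: h1.
    by rewrite ler_norml; lra.
  by move=> _ ->; case: (_ < 0).
Qed.

End OverK.
End Points.

(** * Trajectories and simulations *)

Section Trajectories.
Variables (R : realType) (K : R -> Prop).
Hypothesis hK : dense_subring K.
Implicit Types (X Y Z : translation_surface R) (p q u v w z : 'cV[R]_2).

Local Notation generic := (generic K).
Local Notation Kvec := (Kvec K).
Local Notation over := (over K).

Definition good X (x : pt X) : Prop := swind X x.1 x.2 = 1 /\ generic x.2.

(* The times in [K] keep a point generic, hence off the sides of the polygons
   wherever a trajectory is interrupted. *)
Inductive tr X u : R -> pt X -> pt X -> Prop :=
| tr_nil x : tr u 0 x x
| tr_rebase t x y : tr u t x y -> tr u t x (rebase y)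
| tr_free t x d p s : tr u t x (d, p) -> K s -> 0 < s -> free u d p s ->
    tr u (t + s) x (d, p + s *: u)
| tr_cross t x d p s r c : tr u t x (d, p) -> K s -> crossing u d p s r c ->
    tr u (t + s) x (glue X d, p + s *: u - vec X d).

Lemma tr_cat X u t1 t2 (x y z : pt X) : tr u t1 x y -> tr u t2 y z -> tr u (t1 + t2) x z.
Proof.
move=> h12 h23; elim: h23 h12 => {t2 y z}
  [y|t y z _ IH|t y d p s _ IH ks s0 fr|t y d p s r c _ IH ks cr] h.
- by rewrite addr0.
- by apply: tr_rebase; apply: IH.
- by rewrite addrA; apply: tr_free => //; apply: IH.
- by rewrite addrA; apply: tr_cross ks cr; apply: IH.
Qed.

Lemma tr_reb X u (x y : pt X) : reb x y -> tr u 0 x y.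
Proof. by move=> [k ->]; elim: k => [|k IH]; [apply: tr_nil|apply: tr_rebase]. Qed.

Lemma tr_free1 X u d p s : K s -> 0 < s -> free u d p s ->
  @tr X u s (d, p) (d, p + s *: u).
Proof. by move=> *; rewrite -[X in tr _ X](add0r s); apply: tr_free => //; apply: tr_nil. Qed.

Lemma tr_cross1 X u d p s r c : K s -> crossing u d p s r c ->
  @tr X u s (d, p) (glue X d, p + s *: u - vec X d).
Proof.
by move=> ks h; rewrite -[X in tr _ X](add0r s); apply: tr_cross ks h; apply: tr_nil.
Qed.

Lemma tr_rebl X u s (x y z : pt X) : reb x y -> tr u s y z -> tr u s x z.
Proof. by move=> /(tr_reb u) h1 h2; rewrite -[s]add0r; apply: tr_cat h1 h2. Qed.

Lemma free_reb X u d p d' p' s : @reb _ X (d, p) (d', p') ->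
  free u d p s -> free u d' p' s.
Proof.
move=> h fr r hr; have := reb_onb (reb_shift (r *: u) h) => /= ->.
exact: fr.
Qed.

Lemma good_reb X (x y : pt X) : over X -> reb x y -> good x -> good y.
Proof.
by move=> oX h [w g]; split; [rewrite (reb_wind h)|apply: reb_generic h g].
Qed.

Lemma generic_time u p s : generic p -> Kvec u -> K s -> generic (p + s *: u).
Proof. by move=> g hu ks; apply: generic_add => //; apply: KvecZ. Qed.

Lemma glue_vec X d : vec X (glue X d) = - vec X d.
Proof. exact: vec_glue. Qed.

(** Just before the crossing the point is inside, which forces the direction to go from the left of
    the side to its right. The glued side has the opposite vector, so the same direction enters its
    polygon. *)
Lemma crossing_good X u d p s r c : over X -> Kvec u -> K s ->
  good ((d, p) : pt X) -> crossing u d p s r c ->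
  det2 (vec X d) u < 0 /\ good ((glue X d, p + s *: u - vec X d) : pt X).
Proof.
move=> oX hu ks [/= w g] [/andP[r0 rs] hc ez bef aft].
have pol := @polygonP _ X.
have [e e0 [_ hw]] := crossing_wind hK oX g hu hc ez.
pose e1 := Num.min e (Num.min r (s - r)).
have e10 : 0 < e1 by rewrite !lt_min e0 r0 subr_gt0.
have e1e : e1 <= e by rewrite ge_min lexx.
have e1r : e1 <= r by rewrite !ge_min lexx !orbT.
have lt1 : r - e1 < r by rewrite gtrBl.
have [t1 k1 /andP[h1 h1']] := dense_between hK lt1.
have dn : det2 (vec X d) u < 0.
  have := hw t1 k1; rewrite (lt_eqF h1') h1' /=.
  have -> : swind X d (p + t1 *: u) = swind X d p.
    apply: (wind_free pol); first lra.
    by move=> r' hr'; apply: bef; lra.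
  rewrite w eq_sym; case: (_ < 0) => // h.
  by have : 1 = 0%:Z by apply: h; rewrite // ler_norml; lra.
split=> //; split => /=; last first.
  by rewrite -addrA; apply: generic_add => //; apply: KvecD => //;
    [apply: KvecZ|apply: KvecN].
have g' : generic (p - vec X d) by apply: generic_add => //; apply: KvecN.
have ez' : p - vec X d + r *: u = (1 - c) *: vec X (glue X d).
  by rewrite addrAC ez glue_vec scalerN scalerBl scale1r opprB.
have hc' : 0 < 1 - c < 1 by lra.
have [e' e'0 [_ hw']] := crossing_wind hK oX g' hu hc' ez'.
pose e2 := Num.min e' (s - r).
have e20 : 0 < e2 by rewrite lt_min e'0 subr_gt0.
have e2e : e2 <= e' by rewrite ge_min lexx.
have e2r : e2 <= s - r by rewrite ge_min lexx orbT.
have lt2 : r < r + e2 by rewrite ltrDl.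
have [t2 k2 /andP[h2 h2']] := dense_between hK lt2.
have <- : swind X (glue X d) (p - vec X d + t2 *: u) = 1.
  rewrite (hw' t2 k2); last 2 first.
  - by rewrite ler_norml; lra.
  - by rewrite gt_eqF.
  rewrite ltNge (ltW h2) /= glue_vec (_ : (det2 _ _ < 0) = false) //.
  apply/negbTE; rewrite -leNgt; move: dn; rewrite /det2 !mxE; lra.
have -> : p + s *: u - vec X d = (p - vec X d + t2 *: u) + (s - t2) *: u.
  by rewrite -[RHS]addrA -scalerDl [t2 + _]addrC subrK addrAC.
apply: (wind_free pol); first lra.
move=> r' hr'; rewrite -addrA -scalerDl addrAC; apply: aft; lra.
Qed.

Lemma tr_good X u t (x y : pt X) : over X -> Kvec u -> tr u t x y -> good x -> good y.
Proof.
move=> oX hu; elim=> // [{}t {}x {}y _ IH gx|{}t {}x d p s _ IH ks s0 fr gx|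
  {}t {}x d p s r c _ IH ks cr gx].
- exact: good_reb (reb_rebase y) (IH gx).
- have [/= w g] := IH gx; split=> /=; last exact: generic_time.
  by rewrite (wind_free (@polygonP _ X)) // ltW.
- by have [] := crossing_good oX hu ks (IH gx) cr.
Qed.

(** A function on good points up to [reb], stated as a relation because it is not canonical on
    representatives. It carries a trajectory to one with the same direction and the same
    duration. *)
Record simulation X Y (C : pt X -> pt Y -> Prop) : Prop := Simulation {
  sim_good : forall x y, C x y -> good x /\ good y;
  sim_total : forall x, good x -> exists y, C x y;
  sim_reb : forall x x' y y', C x y -> reb x x' -> reb y y' -> C x' y';
  sim_fun : forall x y y', C x y -> C x y' -> reb y y';
  sim_tr : forall u t x x' y, Kvec u -> C x y -> tr u t x x' ->
    exists2 y', tr u t y y' & C x' y' }.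

Definition simulates X Y : Prop := exists C, @simulation X Y C.

Lemma simulates_refl X : over X -> simulates X X.
Proof.
move=> oX; exists (fun x y => good x /\ reb x y); split.
- by move=> x y [g h]; split=> //; apply: good_reb h g.
- by move=> x g; exists x; split=> //; apply: reb_refl.
- move=> x x' y y' [g h] h1 h2; split; first exact: good_reb h1 g.
  by apply: reb_trans (reb_sym h1) _; apply: reb_trans h h2.
- by move=> x y y' [_ h1] [_ h2]; apply: reb_trans (reb_sym h1) h2.
- move=> u t x x' y hu [g h] htr; exists x'; first exact: tr_rebl (reb_sym h) htr.
  by split; [apply: tr_good htr g|apply: reb_refl].
Qed.

Lemma simulates_trans X Y Z : simulates X Y -> simulates Y Z -> simulates X Z.
Proof.
move=> [C hC] [D hD]; exists (fun (x : pt X) (z : pt Z) => exists2 y, C x y & D y z); split.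
- by move=> x z [y /(sim_good hC) [gx _] /(sim_good hD) [_ gz]].
- move=> x gx; have [y Cy] := sim_total hC gx; have [_ gy] := sim_good hC Cy.
  by have [z Dz] := sim_total hD gy; exists z; exists y.
- move=> x x' z z' [y Cy Dz] h1 h2; exists y.
    by apply: (sim_reb hC) Cy h1 (reb_refl y).
  by apply: (sim_reb hD) Dz (reb_refl y) h2.
- move=> x z z' [y Cy Dz] [y' Cy' Dz']; apply: (sim_fun hD Dz).
  by apply: (sim_reb hD) Dz' (reb_sym (sim_fun hC Cy Cy')) (reb_refl z').
- move=> u t x x' z hu [y Cy Dz] htr.
  have [y' try' Cy'] := sim_tr hC hu Cy htr.
  have [z' trz' Dz'] := sim_tr hD hu Dz try'.
  by exists z' => //; exists y'.
Qed.

Section Back.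
Variables (X Y : translation_surface R) (back : pt Y -> pt X).
Hypotheses (oX : over X) (oY : over Y).

Hypothesis back_shift : forall g q w,
  back (g, q + w) = ((back (g, q)).1, (back (g, q)).2 + w).
Hypothesis back_rebase : forall y, reb (back y) (back (rebase y)).

Let C (x : pt X) (y : pt Y) : Prop := [/\ good x, good y & reb x (back y)].

Lemma back_reb y y' : reb y y' -> reb (back y) (back y').
Proof.
move=> [k ->]; elim: k => [|k IH]; first exact: reb_refl.
exact: reb_trans IH (back_rebase _).
Qed.

(** For every elementary move the correspondence comes from a map [back] on all representatives,
    which commutes with [rebase] up to [reb]. It then suffices to lift one free segment or one
    crossing at a time. *)
Lemma simulates_forward :
  (forall x, good x -> exists2 y, good y & reb x (back y)) ->
  (forall y y', good y -> good y' -> reb (back y) (back y') -> reb y y') ->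
  (forall u s y, Kvec u -> K s -> 0 < s -> good y -> good (back y) ->
     free u (back y).1 (back y).2 s ->
     exists2 y', tr u s y y' & reb (back y') ((back y).1, (back y).2 + s *: u)) ->
  (forall u s y d p r c, Kvec u -> K s -> good y -> good ((d, p) : pt X) ->
     reb (d, p) (back y) -> crossing u d p s r c ->
     exists2 y', tr u s y y' & reb (back y') (glue X d, p + s *: u - vec X d)) ->
  simulates X Y.
Proof.
move=> htot hfun hfree hcross; exists C.
have creb x x' y y' : C x y -> reb x x' -> reb y y' -> C x' y'.
  move=> [gx gy h] h1 h2; split; [exact: good_reb h1 gx|exact: good_reb h2 gy|].
  apply: reb_trans (reb_sym h1) _; apply: reb_trans h _; exact: back_reb.
split=> //.
- by move=> x y [].
- by move=> x gx; have [y gy h] := htot x gx; exists y.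
- move=> x y y' [_ gy h] [_ gy' h']; apply: hfun => //.
  exact: reb_trans (reb_sym h) h'.
- move=> u t x x' y hu Cxy htr.
  elim: htr y Cxy => {t x x'} [x|t x y _ IH|t x d p s _ IH ks s0 fr|t x d p s r c _ IH ks cr] z Cxy.
  + by exists z => //; apply: tr_nil.
  + have [z' trz Cz] := IH z Cxy; exists z' => //.
    exact: creb Cz (reb_rebase y) (reb_refl z').
  + have [z' trz [gdp gz h]] := IH z Cxy.
    case eb : (back z') h => [d' p'] h.
    have gb : good (back z') by rewrite eb; apply: good_reb h gdp.
    have [|z'' trz' h'] := hfree u s z' hu ks s0 gz gb.
      by rewrite eb; apply: free_reb h fr.
    exists z''; first exact: tr_cat trz trz'.
    have tr1 := tr_free1 ks s0 fr.
    split; [exact: tr_good tr1 gdp|exact: tr_good trz' gz|].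
    apply: reb_sym; apply: reb_trans h' _; rewrite eb /=.
    by apply: reb_sym; apply: reb_shift.
  + have [z' trz [gdp gz h]] := IH z Cxy.
    have [z'' trz' h'] := hcross u s z' d p r c hu ks gz gdp h cr.
    exists z''; first exact: tr_cat trz trz'.
    split; [exact: tr_good (tr_cross1 ks cr) gdp|exact: tr_good trz' gz|].
    exact: reb_sym.
Qed.

Lemma simulates_backward :
  (forall y, good y -> good (back y)) ->
  (forall u s g q, Kvec u -> K s -> 0 < s -> good ((g, q) : pt Y) -> free u g q s ->
     free u (back (g, q)).1 (back (g, q)).2 s) ->
  (forall u s g q r c, Kvec u -> K s -> good ((g, q) : pt Y) -> crossing u g q s r c ->
     exists2 x', tr u s (back (g, q)) x' &
       reb x' (back (glue Y g, q + s *: u - vec Y g))) ->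
  simulates Y X.
Proof.
move=> htot hfree hcross; exists (fun y x => C x y).
have creb x x' y y' : C x y -> reb x x' -> reb y y' -> C x' y'.
  move=> [gx gy h] h1 h2; split; [exact: good_reb h1 gx|exact: good_reb h2 gy|].
  apply: reb_trans (reb_sym h1) _; apply: reb_trans h _; exact: back_reb.
split.
- by move=> y x [].
- by move=> y gy; exists (back y); split=> //; [apply: htot|apply: reb_refl].
- by move=> y y' x x' h h1 h2; apply: creb h h2 h1.
- by move=> y x x' [_ _ h] [_ _ h']; apply: reb_trans h (reb_sym h').
- move=> u t y y' x hu Cxy htr.
  elim: htr x Cxy => {t y y'} [y|t y y' _ IH|t y g q s _ IH ks s0 fr|t y g q s r c _ IH ks cr] x Cxy.
  + by exists x => //; apply: tr_nil.
  + have [x' trx Cx] := IH x Cxy; exists x' => //.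
    exact: creb Cx (reb_refl x') (reb_rebase y').
  + have [x' trx [gx gy h]] := IH x Cxy.
    have fr' := hfree u s g q hu ks s0 gy fr.
    exists (back (g, q + s *: u)).
      apply: tr_cat trx _; apply: tr_rebl h _; rewrite back_shift.
      by move: fr'; case: (back (g, q)) => d p /= fr'; apply: tr_free1.
    have gy' := tr_good oY hu (tr_free1 ks s0 fr) gy.
    by split; [apply: htot|exact: gy'|apply: reb_refl].
  + have [x' trx [gx gy h]] := IH x Cxy.
    have [x'' trx' h'] := hcross u s g q r c hu ks gy cr.
    exists x''; first by apply: tr_cat trx _; apply: tr_rebl h trx'.
    split; [|exact: tr_good (tr_cross1 ks cr) gy|exact: h'].
    exact: tr_good trx' (htot _ gy).
Qed.

End Back.
End Trajectories.

Lemma ratio01 (R : realFieldType) (x y : R) : 0 < x < y -> 0 < x / y < 1.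
Proof.
move=> /andP[x0 xy]; have y0 := lt_trans x0 xy.
by rewrite divr_gt0 // ltr_pdivrMr // mul1r.
Qed.

Lemma onem01 (R : realFieldType) (x : R) : 0 < x < 1 -> 0 < 1 - x < 1.
Proof. lra. Qed.

Section Subdivision.
Variable R : realFieldType.
Implicit Types a b p q z : 'cV[R]_2.
Local Notation y_ v := (v 1 0).

Lemma orient_split t a b p :
  orient a (a + t *: (b - a)) p = t * orient a b p /\
  orient (a + t *: (b - a)) b p = (1 - t) * orient a b p.
Proof. by rewrite !orientE !mxE; split; ring. Qed.

Lemma lam_split t a b p : 0 < t < 1 ->
  lam a (a + t *: (b - a)) p + lam (a + t *: (b - a)) b p = lam a b p.
Proof.
move=> /andP[t0 t1]; rewrite /lam; have [-> ->] := orient_split t a b p.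
have t1' : 0 < 1 - t by rewrite subr_gt0.
rewrite !pmulr_rlt0 // !pmulr_rgt0 // !mxE.
set m := y_ a + _.
case: (ltrP (y_ p) (y_ a)) => pa; case: (ltrP (y_ p) (y_ b)) => pb;
 case: (ltrP (y_ p) m) => pm //=; rewrite ?addr0 ?add0r //; exfalso.
- have : 0 < t * (y_ b - y_ p) by rewrite mulr_gt0 // subr_gt0.
  have : 0 < (1 - t) * (y_ a - y_ p) by rewrite mulr_gt0 // subr_gt0.
  by move: pm; rewrite /m; lra.
- have : 0 <= t * (y_ p - y_ b) by rewrite mulr_ge0 ?subr_ge0 // ltW.
  have : 0 <= (1 - t) * (y_ p - y_ a) by rewrite mulr_ge0 ?subr_ge0 // ltW.
  by move: pm; rewrite /m; lra.
Qed.

Lemma on_seg_split t a b z : 0 < t < 1 ->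
  on_seg a b z <-> on_seg a (a + t *: (b - a)) z \/ on_seg (a + t *: (b - a)) b z.
Proof.
move=> /andP[t0 t1]; split.
- move=> [s /andP[s0 s1] ->]; case: (lerP s t) => st.
    left; exists (s / t); first by rewrite divr_ge0 ?ler_pdivrMr //= ?mul1r // ltW.
    rewrite [a + t *: _ - a]addrC addKr scalerA divfK // gt_eqF //.
  right; have d0 : 0 < 1 - t by lra.
  exists ((s - t) / (1 - t)).
    by rewrite divr_ge0 ?ler_pdivrMr //= ?mul1r; lra.
  by apply: cV2_eq; rewrite !mxE; field; rewrite gt_eqF.
- case=> -[s /andP[s0 s1] ->].
  + exists (s * t); first by rewrite mulr_ge0 //= ?mulr_ile1 // ltW.
    by apply: cV2_eq; rewrite !mxE; ring.
  + exists (t + s * (1 - t)); last by apply: cV2_eq; rewrite !mxE; ring.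
    have : 0 <= s * (1 - t) by rewrite mulr_ge0 // subr_ge0 ltW.
    have : 0 <= (1 - s) * (1 - t) by rewrite mulr_ge0 // subr_ge0 // ltW.
    by move=> h1 h2; apply/andP; split; lra.
Qed.

End Subdivision.

(** * Relabellings *)

Section Relabel.
Variables (R : realType) (K : R -> Prop).
Hypothesis hK : dense_subring K.
Variables (X Y : translation_surface R) (f : side X -> side Y).
Hypotheses (oX : over K X) (oY : over K Y) (bf : bijective f) (mf : side_morphism f).

Let f_next d : next Y (f d) = f (next X d). Proof. by case: (mf d). Qed.
Let f_glue d : glue Y (f d) = f (glue X d). Proof. by case: (mf d). Qed.
Let f_vec d : vec Y (f d) = vec X d. Proof. by case: (mf d). Qed.

Let f_iter k d : iter k (next Y) (f d) = f (iter k (next X) d).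
Proof. by elim: k => //= k ->. Qed.

Let f_corner k d : scorner Y (f d) k = scorner X d k.
Proof. by elim: k => [|k IH]; rewrite ?corner0 // !cornerS IH /side_vec f_iter f_vec. Qed.

Let f_nsides d : nsides (next Y) (f d) = nsides (next X) d.
Proof.
apply: porbit_card_eq; first exact: nsides_gt0.
  by rewrite f_iter iter_nsides.
move=> k /andP[k0 kn]; rewrite f_iter => /(bij_inj bf) e.
by apply: (@porbit_no_return _ (next X) d k) e; rewrite k0.
Qed.

Let f_onb d p : sonb Y (f d) p <-> sonb X d p.
Proof.
by split=> -[i]; rewrite ?f_nsides => hi h; exists i; move: h; rewrite ?f_nsides ?f_corner.
Qed.

Let f_wind d p : swind Y (f d) p = swind X d p.
Proof.
rewrite /wind f_nsides; congr (- _); apply: eq_bigr => i _.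
by rewrite !f_corner.
Qed.

Lemma relabelling_simulates : simulates K X Y.
Proof.
case: (bf) => g fg gf; pose back (y : pt Y) : pt X := (g y.1, y.2).
have fy y : y = (f (back y).1, (back y).2) by case: y => d q; rewrite /= gf.
have freb x x' : reb x x' -> @reb _ Y (f x.1, x.2) (f x'.1, x'.2).
  move=> [k ->]; exists k; case: x => d p; rewrite !iter_rebase /=.
  by rewrite f_iter f_corner.
apply: (@simulates_forward _ _ hK X Y back oX oY).
- move=> [d q]; exists 1%N; rewrite /rebase /back /= -{1 2}(gf d).
  by rewrite f_next f_vec fg.
- move=> [d p] [w gp]; exists (f d, p); last by rewrite /back /= fg; apply: reb_refl.
  by split; rewrite //= f_wind.
- by move=> y y' _ _ /freb; rewrite -!fy.
- move=> u s y hu ks s0 _ _ fr; exists (y.1, y.2 + s *: u).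
    case: y fr => d q /= fr; apply: tr_free1 => // r hr.
    by rewrite -(gf d) f_onb; apply: fr.
  exact: reb_refl.
- move=> u s y d p r c hu ks gy gdp h [h1 h2 h3 h4 h5].
  exists (glue Y (f d), p + s *: u - vec Y (f d)).
    apply: (@tr_rebl _ _ _ _ _ _ (f d, p)).
      by rewrite [y]fy; apply: reb_sym; apply: (freb (d, p)).
    apply: (tr_cross1 (r := r) (c := c)) => //; split=> //; rewrite ?f_vec //.
    - by move=> r' hr'; rewrite f_onb; apply: h4.
    - by move=> r' hr'; rewrite f_glue f_onb; apply: h5.
  by rewrite /back /= f_glue fg f_vec; apply: reb_refl.
Qed.

End Relabel.

(** * Edge cuts *)

Section EdgeCut.
Variables (R : realType) (K : R -> Prop).
Hypothesis hK : dense_subring K.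
Variables (X Y : translation_surface R) (old : side X -> side Y).
Hypotheses (oX : over K X) (oY : over K Y).

(** A presentation of an edge cut that is symmetric in the two sides of the edge, so that statements
    about [a'] follow from those about [a]. *)
Record edge_cut_at (a a' : side X) (b b' : side Y) (t : R) : Prop := EdgeCutAt {
  ec_t : 0 < t < 1;
  ec_glue : glue X a = a' /\ glue X a' = a;
  ec_next : forall d, next Y (old d) =
     if d == a then b else if d == a' then b' else old (next X d);
  ec_nextb : next Y b = old (next X a) /\ next Y b' = old (next X a');
  ec_glueo : forall d, d != a -> d != a' -> glue Y (old d) = old (glue X d);
  ec_gluea : glue Y (old a) = b' /\ glue Y (old a') = b;
  ec_glueb : glue Y b = old a' /\ glue Y b' = old a;
  ec_veco : forall d, d != a -> d != a' -> vec Y (old d) = vec X d;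
  ec_veca : vec Y (old a) = t *: vec X a /\ vec Y (old a') = (1 - t) *: vec X a';
  ec_vecb : vec Y b = (1 - t) *: vec X a /\ vec Y b' = t *: vec X a';
  ec_inj : injective old;
  ec_new : [/\ b <> b', forall d, old d <> b & forall d, old d <> b'];
  ec_neq : a != a' }.

Lemma edge_cut_at_sym a a' b b' t :
  edge_cut_at a a' b b' t -> edge_cut_at a' a b' b (1 - t).
Proof.
case=> ht [g1 g2] nx [n1 n2] go [ga1 ga2] [gb1 gb2] vo [va1 va2] [vb1 vb2] ij [w1 w2 w3] ne.
have e : 1 - (1 - t) = t by ring.
split=> //; rewrite ?e //.
- by lra.
- by move=> d; rewrite nx; case: (eqVneq d a) => [->|_]; rewrite ?(negbTE ne).
- by move=> d h1 h2; apply: go.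
- by move=> d h1 h2; apply: vo.
- by split=> //; apply/nesym.
- by rewrite eq_sym.
Qed.

Variables (a a' : side X) (b b' : side Y) (t : R).
Hypothesis ec : edge_cut_at a a' b b' t.

(* The first [k] sides of the polygon of [d] become [m] sides. *)
Let subdivided d k m : Prop := [/\ (k <= m <= k + k)%N,
  iter m (next Y) (old d) = old (iter k (next X) d) /\
  scorner Y (old d) m = scorner X d k,
  forall p, \sum_(i < m) lam (scorner Y (old d) i) (scorner Y (old d) i.+1) p =
    \sum_(i < k) lam (scorner X d i) (scorner X d i.+1) p,
  forall p, (exists2 i, (i < m)%N & on_seg (scorner Y (old d) i) (scorner Y (old d) i.+1) p) <->
    (exists2 i, (i < k)%N & on_seg (scorner X d i) (scorner X d i.+1) p) &
  forall j, (0 < j < m)%N -> iter j (next Y) (old d) = old d ->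
    exists2 i, (0 < i < k)%N & iter i (next X) d = d].

Lemma edge_cut_sides d k : exists m, subdivided d k m.
Proof.
have [w1 w2 w3] := ec_new ec.
elim: k => [|k [m [km [im cm] lm om rm]]].
  exists 0%N; split=> //; first by split=> //=; rewrite !corner0.
  - by move=> p; rewrite !big_ord0.
  - by move=> p; split=> -[].
  - by move=> j /andP[_]; rewrite ltn0.
set dk := iter k (next X) d in im.
have ret j : (0 < j < m.+1)%N -> iter j (next Y) (old d) = old d ->
    exists2 i, (0 < i < k.+1)%N & iter i (next X) d = d.
  move=> /andP[j0]; rewrite ltnS leq_eqVlt => /orP[/eqP ej|jm] e; last first.
    have [|i /andP[i0 ik] ei] := rm j _ e; first by rewrite j0.
    by exists i; rewrite // i0 (leq_trans ik).
  move: e; rewrite ej im => /(ec_inj ec) e; exists k; rewrite // ltnSn andbT.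
  by case/andP: km => _; case: (k) => //; rewrite addn0 leqn0 -ej; case: (j) j0.
have dst b0 (s : R) : 0 < s < 1 -> next Y (old dk) = b0 ->
   next Y b0 = old (next X dk) -> vec Y (old dk) = s *: vec X dk ->
   vec Y b0 = (1 - s) *: vec X dk -> (forall d, old d <> b0) ->
   exists m, subdivided d k.+1 m.
  move=> hs nb0 nnb v1 v2 nold; exists m.+2.
  have c1 : scorner Y (old d) m.+1 = scorner X d k + s *: (scorner X d k.+1 - scorner X d k).
    by rewrite cornerS cm /side_vec im v1 edge_next.
  have c2 : scorner Y (old d) m.+2 = scorner X d k.+1.
    rewrite cornerS c1 edge_next /side_vec iterS im nb0 v2 -addrA -scalerDl.
    by rewrite [s + _]addrC subrK scale1r -cornerS.
  split.
  - by move: km; clear; lia.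
  - by rewrite !iterS im nb0 nnb.
  - by move=> p; rewrite !big_ord_recr /= lm c2 c1 cm -addrA lam_split.
  - move=> p; split=> -[i].
    + rewrite ltnS leq_eqVlt => /orP[/eqP ->|].
        rewrite c1 c2 => h; exists k => //; apply/(on_seg_split _ _ _ hs); by right.
      rewrite ltnS leq_eqVlt => /orP[/eqP ->|im'] h.
        exists k => //; apply/(on_seg_split _ _ _ hs); left.
        by rewrite -c1 -cm.
      have /om [i' i'k h'] : exists2 i, (i < m)%N & on_seg (scorner Y (old d) i) (scorner Y (old d) i.+1) p by exists i.
      by exists i' => //; apply: leq_trans i'k _.
    + rewrite ltnS leq_eqVlt => /orP[/eqP ->|ik] h.
        case/(on_seg_split _ _ _ hs): h => h; last by exists m.+1; rewrite // c1 c2.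
        by exists m; rewrite // cm c1.
      have /om [i' i'k h'] : exists2 i, (i < k)%N & on_seg (scorner X d i) (scorner X d i.+1) p by exists i.
      by exists i' => //; rewrite ltnS ltnW // (leq_trans i'k).
  - move=> j /andP[j0]; rewrite ltnS leq_eqVlt => /orP[/eqP ->|jm]; last by apply: ret; rewrite j0.
    by rewrite iterS im nb0 => e; case: (nold d).
have [n1 n2] := ec_nextb ec; have [v1 v2] := ec_veca ec; have [v3 v4] := ec_vecb ec.
have ht := ec_t ec.
have ht' := onem01 ht.
case: (eqVneq dk a) => ea.
  by apply: (dst b t); rewrite ?(ec_next ec) ?ea ?eqxx.
case: (eqVneq dk a') => ea'.
  apply: (dst b' (1 - t)); rewrite ?(ec_next ec) ?ea' ?eqxx //.
    by rewrite eq_sym (negbTE (ec_neq ec)).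
  by rewrite v4; congr (_ *: _); ring.
have c1 : scorner Y (old d) m.+1 = scorner X d k.+1.
  by rewrite cornerS cm /side_vec im (ec_veco ec) // -cornerS.
exists m.+1; split=> //.
- by move: km; clear; lia.
- by rewrite !iterS im (ec_next ec) (negbTE ea) (negbTE ea').
- by move=> p; rewrite !big_ord_recr /= lm c1 cm.
- move=> p; split=> -[i].
  + rewrite ltnS leq_eqVlt => /orP[/eqP ->|im'] h; first by exists k; rewrite // -c1 -cm.
    have /om [i' i'k h'] : exists2 i, (i < m)%N & on_seg (scorner Y (old d) i) (scorner Y (old d) i.+1) p by exists i.
    by exists i' => //; apply: leq_trans i'k _.
  + rewrite ltnS leq_eqVlt => /orP[/eqP ->|ik] h; first by exists m; rewrite // c1 cm.
    have /om [i' i'k h'] : exists2 i, (i < k)%N & on_seg (scorner X d i) (scorner X d i.+1) p by exists i.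
    by exists i' => //; apply: leq_trans i'k _.
Qed.

(** The last clause of [subdivided] excludes an early return to the first side, so the subdivided
    sides are exactly those of the new polygon. *)
Lemma edge_cut_polygon d :
  (forall p, swind Y (old d) p = swind X d p) /\
  (forall p, sonb Y (old d) p <-> sonb X d p).
Proof.
have n0 := nsides_gt0 (next X) d.
have [m [/andP[nm _] [im cm] lm om rm]] := edge_cut_sides d (nsides (next X) d).
have em : nsides (next Y) (old d) = m.
  apply: porbit_card_eq; first exact: leq_trans n0 nm.
    by rewrite im iter_nsides.
  move=> k hk /(rm _ hk) [i hi ei].
  exact: porbit_no_return hi ei.
by split=> p; rewrite /wind /onb em; [rewrite lm|apply: om].
Qed.

Let oldp (x : pt X) : pt Y := (old x.1, x.2).

Lemma edge_cut_reb x x' : reb x x' -> reb (oldp x) (oldp x').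
Proof.
have [n1 n2] := ec_nextb ec; have [v1 v2] := ec_veca ec; have [v3 v4] := ec_vecb ec.
move=> [k ->]; elim: k => [|k IH]; first exact: reb_refl.
apply: reb_trans IH _; rewrite iterS; case: (iter k _ x) => d p.
rewrite /oldp /rebase /=.
case: (eqVneq d a) => [->|na].
  exists 2%N; rewrite /rebase /= (ec_next ec) eqxx n1 v1 v3.
  by rewrite -addrA -opprD -scalerDl [t + _]addrC subrK scale1r.
case: (eqVneq d a') => [->|na'].
  exists 2%N; rewrite /rebase /= (ec_next ec) eqxx eq_sym (negbTE (ec_neq ec)) n2 v2 v4.
  by rewrite -addrA -opprD -scalerDl subrK scale1r.
by exists 1%N; rewrite /rebase /= (ec_next ec) (negbTE na) (negbTE na') (ec_veco ec).
Qed.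

(** The new vertex has its coordinates in [K], so a generic trajectory misses it and crosses exactly
    one half of the edge, decided by comparing [c] with [t]. *)
Lemma edge_cut_cross_at u s p r c : Kvec K u -> u != 0 -> K s -> generic K p ->
  crossing u a p s r c ->
  exists2 y', tr K u s (oldp (a, p)) y' & reb y' (oldp (a', p + s *: u - vec X a)).
Proof.
have [n1 n2] := ec_nextb ec; have [v1 v2] := ec_veca ec; have [v3 v4] := ec_vecb ec.
have [ga1 ga2] := ec_gluea ec; have [gb1 gb2] := ec_glueb ec; have [gl1 gl2] := ec_glue ec.
have /andP[t0 t1] := ec_t ec.
move=> hu u0 ks g [h1 h2 h3 h4 h5]; have va : vec X a' = - vec X a by rewrite -gl1 vec_glue.
have na' : (a' == a) = false by rewrite eq_sym (negbTE (ec_neq ec)).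
have rb : @reb _ Y (old a', p + s *: u - vec X a) (b', p + s *: u - t *: vec X a).
  exists 1%N; rewrite /rebase /= (ec_next ec) eqxx na' v2 va.
  by congr (_, _); apply: cV2_eq; rewrite !mxE; ring.
have pc := edge_cut_polygon.
case: (ltrgtP c t) => ct; last first.
- exfalso; apply: (generic_avoid hK g (oY (old a)) hu u0 (r := r)).
  by rewrite h3 ct v1.
- exists (glue Y b, (p - t *: vec X a) + s *: u - vec Y b); last first.
    rewrite gb1 v3 /oldp /= scalerBl scale1r.
    rewrite (_ : p - t *: vec X a + s *: u - (vec X a - t *: vec X a) = p + s *: u - vec X a).
      exact: reb_refl.
    by apply: cV2_eq; rewrite !mxE; ring.
  have rb1 : @reb _ Y (old a, p) (b, p - t *: vec X a).
    by exists 1%N; rewrite /rebase /= (ec_next ec) eqxx v1.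
  apply: (tr_rebl rb1); apply: (tr_cross1 (r := r) (c := (c - t) / (1 - t))) => //.
  have t1' : 0 < 1 - t by rewrite subr_gt0.
  split=> //.
  + by apply: ratio01; case/andP: h2 => _ c1; rewrite subr_gt0 ct ltrD2r.
  + by rewrite addrAC h3 v3 scalerA divfK ?gt_eqF // scalerBl.
  + move=> r' hr'; have := reb_onb (reb_shift (r' *: u) rb1) => /= ->.
    by rewrite (pc a).2; apply: h4.
  + move=> r' hr'; rewrite gb1 v3 (pc a').2.
    rewrite (_ : p - t *: vec X a + r' *: u - (1 - t) *: vec X a = p + r' *: u - vec X a).
      by rewrite -gl1; apply: h5.
    by apply: cV2_eq; rewrite !mxE; ring.
- exists (glue Y (old a), p + s *: u - vec Y (old a)); last first.
    by rewrite ga1 v1; apply: reb_sym.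
  apply: (tr_cross1 (r := r) (c := c / t)) => //; split=> //.
  + by apply: ratio01; case/andP: h2 => -> _; rewrite ct.
  + by rewrite h3 v1 scalerA divfK ?gt_eqF.
  + by move=> r' hr'; rewrite (pc a).2; apply: h4.
  + move=> r' hr'; rewrite ga1 v1.
    have := reb_onb (reb_shift ((r' - s) *: u) rb) => /=.
    rewrite (_ : p + s *: u - vec X a + (r' - s) *: u = p + r' *: u - vec X a); last first.
      by apply: cV2_eq; rewrite !mxE; ring.
    rewrite (_ : p + s *: u - t *: vec X a + (r' - s) *: u = p + r' *: u - t *: vec X a); last first.
      by apply: cV2_eq; rewrite !mxE; ring.
    by move=> ->; rewrite (pc a').2 -gl1; apply: h5.
Qed.

End EdgeCut.

Section EdgeCutSimulation.
Variables (R : realType) (K : R -> Prop).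
Hypothesis hK : dense_subring K.
Variables (X Y : translation_surface R).
Hypotheses (oX : over K X) (oY : over K Y).
Variables (h : side X + bool -> side Y) (h' : side Y -> side X + bool).
Hypotheses (hK1 : cancel h h') (hK2 : cancel h' h).
Variables (a a' : side X) (t : R).
Let old d := h (inl d).
Let b := h (inr true).
Let b' := h (inr false).
Hypothesis ec : edge_cut_at old a a' b b' t.

(** The initial endpoint of a new side lies at the fraction [t], or [1 - t], of the side of [X] that
    was cut, whence the added vectors. *)
Let back (y : pt Y) : pt X :=
  match h' y.1 with
  | inl d => (d, y.2)
  | inr true => (a, y.2 + t *: vec X a)
  | inr false => (a', y.2 + (1 - t) *: vec X a')
  end.
Let oldp (x : pt X) : pt Y := (old x.1, x.2).

Let back_old x : back (oldp x) = x.
Proof. by case: x => d p; rewrite /back /= hK1. Qed.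
Let back_b q : back (b, q) = (a, q + t *: vec X a).
Proof. by rewrite /back hK1. Qed.
Let back_b' q : back (b', q) = (a', q + (1 - t) *: vec X a').
Proof. by rewrite /back hK1. Qed.

Let side_cases g : [\/ exists d, g = old d, g = b | g = b'].
Proof.
rewrite -(hK2 g); case: (h' g) => [d|[]]; [apply: Or31; by exists d|exact: Or32|exact: Or33].
Qed.

Let old_reb x x' : reb x x' -> reb (oldp x) (oldp x') := edge_cut_reb ec (x:=x) (x':=x').

Let reb_oldback y : reb (oldp (back y)) y.
Proof.
have [v1 v2] := ec_veca ec.
case: y => g q; have [[d ->]|->|->] := side_cases g.
- by rewrite [(_, _)]/(oldp (d, q)) back_old; apply: reb_refl.
- rewrite back_b; exists 1%N; rewrite /rebase /= (ec_next ec) eqxx v1.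
  by congr (_, _); apply: cV2_eq; rewrite !mxE; ring.
- rewrite back_b'; exists 1%N; rewrite /rebase /= (ec_next ec) eqxx.
  rewrite eq_sym (negbTE (ec_neq ec)) v2.
  by congr (_, _); apply: cV2_eq; rewrite !mxE; ring.
Qed.

Let back_rebase y : reb (back y) (back (rebase y)).
Proof.
have [n1 n2] := ec_nextb ec; have [v1 v2] := ec_veca ec; have [v3 v4] := ec_vecb ec.
have na' : (a' == a) = false by rewrite eq_sym (negbTE (ec_neq ec)).
case: y => g q; have [[d ->]|->|->] := side_cases g.
- rewrite [X in back X]/(oldp (d, q)) back_old /rebase /= (ec_next ec).
  case: (eqVneq d a) => [->|na].
    rewrite back_b v1; exists 0%N; congr (_, _).
    by apply: cV2_eq; rewrite !mxE; ring.
  case: (eqVneq d a') => [->|nna].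
    rewrite back_b' v2; exists 0%N; congr (_, _).
    by apply: cV2_eq; rewrite !mxE; ring.
  by rewrite -[(old _, _)]/(oldp (_, _)) back_old (ec_veco ec) //; apply: reb_rebase.
- rewrite back_b /rebase /= n1 -[(old _, _)]/(oldp (_, _)) back_old v3; exists 1%N.
  by congr (_, _); apply: cV2_eq; rewrite !mxE; ring.
- rewrite back_b' /rebase /= n2 -[(old _, _)]/(oldp (_, _)) back_old v4; exists 1%N.
  by congr (_, _); apply: cV2_eq; rewrite !mxE; ring.
Qed.

Let back_shift g q w : back (g, q + w) = ((back (g, q)).1, (back (g, q)).2 + w).
Proof. by rewrite /back /=; case: (h' g) => [d|[]] //=; rewrite addrAC. Qed.

Let good_old x : good K x -> good K (oldp x).
Proof. by case: x => d p [w g]; split=> //=; rewrite (edge_cut_polygon ec d).1. Qed.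

Let good_back y : good K y -> good K (back y).
Proof.
move=> /(good_reb hK oY (reb_sym (reb_oldback y))) [w g].
by split=> //; rewrite -(edge_cut_polygon ec _).1.
Qed.

Let free_back u g q s : free u g q s -> free u (back (g, q)).1 (back (g, q)).2 s.
Proof.
move=> fr r hr; rewrite -(edge_cut_polygon ec _).2.
have := reb_sym (reb_oldback (g, q)); rewrite /oldp => rb.
exact: (free_reb rb fr).
Qed.

Let crossing_u (Z : translation_surface R) u (d : side Z) p s r c : over K Z ->
  generic K p -> crossing u d p s r c -> u != 0.
Proof.
move=> oZ g [_ _ e _ _]; apply/eqP=> u0; have := generic_line hK g (Kvec0 hK) (oZ d) (svec_neq0 d).
by move: e; rewrite u0 scaler0 addr0 => ->; rewrite subr0 /det2 !mxE => /eqP; apply; ring.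
Qed.

Lemma edge_cut_forward : simulates K X Y.
Proof.
apply: (@simulates_forward _ _ hK X Y back oX oY back_rebase).
- move=> x gx; exists (oldp x); first exact: good_old.
  by rewrite back_old; apply: reb_refl.
- move=> y y' _ _ /old_reb rb.
  exact: reb_trans (reb_sym (reb_oldback y)) (reb_trans rb (reb_oldback y')).
- move=> u s y hu ks s0 _ _ fr; exists (oldp ((back y).1, (back y).2 + s *: u)).
    apply: (tr_rebl (reb_sym (reb_oldback y))); apply: tr_free1 => // r hr.
    by rewrite (edge_cut_polygon ec _).2; apply: fr.
  by rewrite back_old; apply: reb_refl.
- move=> u s y d p r c hu ks gy [/= w g] rb cr.
  have u0 := crossing_u oX g cr.
  have rby : reb y (oldp (d, p)).
    exact: reb_trans (reb_sym (reb_oldback y)) (old_reb (reb_sym rb)).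
  have [gl1 gl2] := ec_glue ec.
  suff [y' htr hy'] : exists2 y', tr K u s (oldp (d, p)) y' &
      reb y' (oldp (glue X d, p + s *: u - vec X d)).
    exists y'; first exact: tr_rebl rby htr.
    by have := back_reb back_rebase hy'; rewrite back_old.
  case: (eqVneq d a) cr => [->|na] cr.
    by rewrite gl1; apply: (edge_cut_cross_at hK oY ec hu u0 ks g cr).
  case: (eqVneq d a') cr => [->|na'] cr.
    by rewrite gl2; apply: (edge_cut_cross_at hK oY (edge_cut_at_sym ec) hu u0 ks g cr).
  exists (glue Y (old d), p + s *: u - vec Y (old d)); last first.
    by rewrite (ec_glueo ec) // (ec_veco ec) //; apply: reb_refl.
  case: cr => h1 h2 h3 h4 h5.
  apply: (tr_cross1 (r := r) (c := c)) => //; split=> //; rewrite ?(ec_veco ec) //.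
  + by move=> r' hr'; rewrite (edge_cut_polygon ec _).2; apply: h4.
  + by move=> r' hr'; rewrite (ec_glueo ec) // (edge_cut_polygon ec _).2; apply: h5.
Qed.

Let back_glue g q : back (glue Y g, q - vec Y g) =
  (glue X (back (g, q)).1, (back (g, q)).2 - vec X (back (g, q)).1).
Proof.
have [v1 v2] := ec_veca ec; have [v3 v4] := ec_vecb ec.
have [ga1 ga2] := ec_gluea ec; have [gb1 gb2] := ec_glueb ec; have [gl1 gl2] := ec_glue ec.
have va : vec X a' = - vec X a by rewrite -gl1 vec_glue.
have bo d p : back (old d, p) = (d, p) by rewrite -[(old d, p)]/(oldp (d, p)) back_old.
have [[d ->]|->|->] := side_cases g.
- rewrite bo /=; case: (eqVneq d a) => [->|na].
    rewrite ga1 v1 back_b' gl1 va; congr (_, _).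
    by apply: cV2_eq; rewrite !mxE; ring.
  case: (eqVneq d a') => [->|na'].
    rewrite ga2 v2 back_b gl2 va; congr (_, _).
    by apply: cV2_eq; rewrite !mxE; ring.
  by rewrite (ec_glueo ec) // (ec_veco ec) // bo.
- rewrite gb1 v3 back_b bo /= gl1; congr (_, _).
  by apply: cV2_eq; rewrite !mxE; ring.
- rewrite gb2 v4 back_b' bo /= gl2; congr (_, _).
  by apply: cV2_eq; rewrite !mxE; ring.
Qed.

Let back_on_side g q w c : 0 < c < 1 -> q + w = c *: vec Y g ->
  exists2 c0, 0 < c0 < 1 & (back (g, q)).2 + w = c0 *: vec X (back (g, q)).1.
Proof.
have [v1 v2] := ec_veca ec; have [v3 v4] := ec_vecb ec.
have ht := ec_t ec; have ht' := onem01 ht.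
have mul01 (x y : R) : 0 < x < 1 -> 0 < y < 1 -> 0 < x * y < 1.
  by move=> /andP[x0 x1] /andP[y0 y1]; rewrite mulr_gt0 //= mulr_ilt1 // ltW.
have add01 (x y : R) : 0 < x < 1 -> 0 < y < 1 -> 0 < x + y * (1 - x) < 1.
  move=> /andP[x0 x1] /andP[y0 y1]; have := mul01 (1 - x) (1 - y).
  rewrite !subr_gt0 x1 y1 !gtrBl x0 y0 => /(_ isT isT); lra.
have bo d p : back (old d, p) = (d, p) by rewrite -[(old d, p)]/(oldp (d, p)) back_old.
have [[d ->]|->|->] := side_cases g => hc e.
- rewrite bo /= e; case: (eqVneq d a) => [->|na].
    by exists (c * t); rewrite ?mul01 // v1 scalerA.
  case: (eqVneq d a') => [->|na'].
    by exists (c * (1 - t)); rewrite ?mul01 // v2 scalerA.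
  by exists c; rewrite // (ec_veco ec).
- rewrite back_b /= addrAC e v3 scalerA -scalerDl addrC.
  by exists (t + c * (1 - t)); first exact: add01.
- rewrite back_b' /= addrAC e v4 scalerA -scalerDl addrC.
  exists (1 - t + c * t) => //.
  by have := add01 (1 - t) c ht' hc; rewrite opprB addrCA subrr addr0.
Qed.

Lemma edge_cut_backward : simulates K Y X.
Proof.
apply: (@simulates_backward _ _ hK X Y back oX oY back_shift back_rebase good_back).
  by move=> u s g q hu ks s0 gy; apply: free_back.
move=> u s g q r c hu ks gy [h1 h2 h3 h4 h5].
have onb_back g' q' : sonb X (back (g', q')).1 (back (g', q')).2 <-> sonb Y g' q'.
  by rewrite -(edge_cut_polygon ec _).2 -(reb_onb (reb_oldback (g', q'))).
have [c0 hc0 e0] := back_on_side h2 h3.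
have sh w : back (glue Y g, q + w - vec Y g) =
    (glue X (back (g, q)).1, (back (g, q)).2 + w - vec X (back (g, q)).1).
  by rewrite addrAC back_shift back_glue /= addrAC.
exists (back (glue Y g, q + s *: u - vec Y g)); last exact: reb_refl.
rewrite sh; case eb : (back (g, q)) e0 sh => [d p] /= e0 sh.
apply: (tr_cross1 (r := r) (c := c0)) => //; split=> //.
- move=> r' hr'; have := back_shift g q (r' *: u); rewrite eb /= => e.
  by have := onb_back g (q + r' *: u); rewrite e /= => ->; apply: h4.
- move=> r' hr'; have := onb_back (glue Y g) (q + r' *: u - vec Y g).
  by rewrite sh /= => ->; apply: h5.
Qed.

End EdgeCutSimulation.

(** * Polygon cuts *)

Section Piece.
Variables (R : realType) (X Y : translation_surface R) (old : side X -> side Y).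
Local Notation V := (scorner X).
Implicit Types (p q u v w z : 'cV[R]_2).

(* The polygon of [a] is cut from the initial endpoint of [a] to that of [b],
   the [m]-th side after [a]. *)
Record polygon_cut_at (a b : side X) (e e' : side Y) (m : nat) : Prop := PolygonCutAt {
  pc_m : (0 < m < nsides (next X) a)%N;
  pc_b : iter m (next X) a = b;
  pc_next : forall d, next Y (old d) =
     if next X d == b then e else if next X d == a then e' else old (next X d);
  pc_nexte : next Y e = old a /\ next Y e' = old b;
  pc_glueo : forall d, glue Y (old d) = old (glue X d);
  pc_gluee : glue Y e = e' /\ glue Y e' = e;
  pc_vec : forall d, vec Y (old d) = vec X d;
  pc_inj : injective old;
  pc_new : [/\ e <> e', forall d, old d <> e & forall d, old d <> e'] }.

Lemma polygon_cut_at_neq a b e e' m : polygon_cut_at a b e e' m -> a != b.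
Proof.
move=> pc; have /andP[m0 mn] := pc_m pc; rewrite -(pc_b pc) eq_sym.
by apply/eqP; apply: porbit_no_return; rewrite m0.
Qed.

(** Every fact about the piece of [a] yields by this symmetry the same fact about the piece of
    [b]. *)
Lemma polygon_cut_at_sym a b e e' m : polygon_cut_at a b e e' m ->
  polygon_cut_at b a e' e (nsides (next X) a - m).
Proof.
move=> pc; have ne := polygon_cut_at_neq pc; have /andP[m0 mn] := pc_m pc.
case: pc => _ hb nx [n1 n2] go [g1 g2] vo ij [w1 w2 w3].
split=> //.
- by rewrite -hb nsides_iter subn_gt0 mn /= -{2}[nsides _ a]subn0 ltn_sub2l // (leq_trans _ mn).
- by rewrite -hb -iterD subnK ?iter_nsides // ltnW.
- move=> d; rewrite nx; case: (eqVneq (next X d) b) => [->|//].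
  by rewrite eq_sym (negbTE ne).
- by split=> //; apply/nesym.
Qed.

Variables (a b : side X) (e e' : side Y) (m : nat).
Hypothesis pc : polygon_cut_at a b e e' m.
Local Notation n := (nsides (next X) a).

Let m0 : (0 < m)%N. Proof. by case/andP: (pc_m pc). Qed.
Let mn : (m < n)%N. Proof. by case/andP: (pc_m pc). Qed.

Lemma piece_iter i : (i < m)%N -> iter i (next Y) (old a) = old (iter i (next X) a).
Proof.
elim: i => [//|i IH] im; rewrite iterS IH ?(ltnW im) // (pc_next pc) -iterS.
rewrite -(pc_b pc) ifN; last first.
  apply/eqP=> /(iter_porbit_inj (ltn_trans im mn) mn) e1.
  by rewrite e1 ltnn in im.
rewrite ifN //; apply/eqP; apply: porbit_no_return.
by rewrite ltn0Sn /= (ltn_trans im mn).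
Qed.

Lemma piece_iter_m : iter m (next Y) (old a) = e.
Proof.
rewrite -(prednK m0) iterS piece_iter ?prednK // (pc_next pc) -iterS prednK //.
by rewrite (pc_b pc) eqxx.
Qed.

Lemma piece_nsides : nsides (next Y) (old a) = m.+1.
Proof.
have [w1 w2 w3] := pc_new pc.
apply: porbit_card_eq => //; first by rewrite iterS piece_iter_m; case: (pc_nexte pc).
move=> k /andP[k0]; rewrite ltnS leq_eqVlt => /orP[/eqP ->|km].
  by rewrite piece_iter_m => /esym; apply: w2.
rewrite piece_iter // => /(pc_inj pc); apply: porbit_no_return.
by rewrite k0 (ltn_trans km mn).
Qed.

Lemma piece_corner i : (i <= m)%N -> scorner Y (old a) i = V a i.
Proof.
elim: i => [|i IH] im; first by rewrite !corner0.
by rewrite !cornerS IH ?(ltnW im) // /side_vec piece_iter // (pc_vec pc).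
Qed.

Lemma piece_vec : vec Y e = - V a m.
Proof.
have := corner_nsides (@polygonP _ Y) (old a); rewrite piece_nsides cornerS.
rewrite /side_vec piece_iter_m piece_corner // => h.
by apply/eqP; rewrite -addr_eq0 addrC h.
Qed.

Lemma piece_wind p : swind Y (old a) p =
  - (\sum_(i < m) lam (V a i) (V a i.+1) p + lam (V a m) 0 p).
Proof.
have c0 : scorner Y (old a) m.+1 = 0.
  by rewrite -piece_nsides (corner_nsides (@polygonP _ Y)).
rewrite /wind piece_nsides big_ord_recr /= c0 piece_corner //; congr (- (_ + _)).
by apply: eq_bigr => i _; rewrite !piece_corner // ltnW.
Qed.

Lemma piece_onb p : sonb Y (old a) p <->
  (exists2 i, (i < m)%N & on_seg (V a i) (V a i.+1) p) \/ on_seg (V a m) 0 p.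
Proof.
have c0 : scorner Y (old a) m.+1 = 0.
  by rewrite -piece_nsides (corner_nsides (@polygonP _ Y)).
split=> [[i]|[[i im h]|h]].
- rewrite piece_nsides ltnS leq_eqVlt => /orP[/eqP ->|im] h; [right|left].
    by rewrite -c0 -(piece_corner (leqnn m)).
  by exists i; rewrite // -!piece_corner // ltnW.
- by exists i; rewrite ?piece_nsides ?piece_corner // ltnW.
- by exists m; rewrite ?piece_nsides // c0 piece_corner.
Qed.

Lemma piece_reb_e p : @reb _ Y (old a, p) (e, p - V a m).
Proof. by exists m; rewrite iter_rebase piece_iter_m piece_corner. Qed.

Lemma piece_reb i p : (i < m)%N ->
  @reb _ Y (old a, p) (old (iter i (next X) a), p - V a i).
Proof. by move=> im; exists i; rewrite iter_rebase piece_iter // piece_corner // ltnW. Qed.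

Lemma outside_iter d i : d \notin porbit (next X) a ->
  iter i (next Y) (old d) = old (iter i (next X) d).
Proof.
move=> hd; elim: i => //= i ->; rewrite (pc_next pc) -iterS.
have out : iter i.+1 (next X) d \notin porbit (next X) a.
  by rewrite -permX -eq_porbit_mem porbit_perm eq_porbit_mem.
rewrite ifN; last first.
  by apply: contraNneq out => ->; rewrite -(pc_b pc) -permX mem_porbit.
by rewrite ifN //; apply: contraNneq out => ->; apply: porbit_id.
Qed.

Lemma outside_corner d i : d \notin porbit (next X) a ->
  scorner Y (old d) i = V d i.
Proof.
move=> hd; elim: i => [|i IH]; first by rewrite !corner0.
by rewrite !cornerS IH /side_vec outside_iter // (pc_vec pc).
Qed.

Lemma outside_nsides d : d \notin porbit (next X) a ->
  nsides (next Y) (old d) = nsides (next X) d.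
Proof.
move=> hd; apply: porbit_card_eq; first exact: nsides_gt0.
  by rewrite outside_iter // iter_nsides.
move=> k hk; rewrite outside_iter // => /(pc_inj pc); exact: porbit_no_return.
Qed.

Lemma outside_wind d p : d \notin porbit (next X) a -> swind Y (old d) p = swind X d p.
Proof.
move=> hd; rewrite /wind outside_nsides //; congr (- _).
by apply: eq_bigr => i _; rewrite !outside_corner.
Qed.

Lemma outside_onb d p : d \notin porbit (next X) a -> sonb Y (old d) p <-> sonb X d p.
Proof.
move=> hd; split=> -[i]; rewrite ?outside_nsides // => hi h; exists i;
  by rewrite ?outside_nsides //; move: h; rewrite !outside_corner.
Qed.

End Piece.

Section TwoPieces.
Variables (R : realType) (X Y : translation_surface R) (old : side X -> side Y).
Local Notation V := (scorner X).
Implicit Types (p q u v w z : 'cV[R]_2).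
Variables (a b : side X) (e e' : side Y) (m : nat).
Hypothesis pc : polygon_cut_at old a b e e' m.
Local Notation n := (nsides (next X) a).

Let m0 : (0 < m)%N. Proof. by case/andP: (pc_m pc). Qed.
Let mn : (m < n)%N. Proof. by case/andP: (pc_m pc). Qed.
Let pc' := polygon_cut_at_sym pc.

Let corner_b i : V b i = V a (m + i)%N - V a m.
Proof. by rewrite corner_add (pc_b pc) addrC addKr. Qed.

(** The two copies of the chord are traversed in opposite directions and cancel. *)
Lemma cut_wind p : swind X a p = swind Y (old a) p + swind Y (old b) (p - V a m).
Proof.
rewrite (piece_wind pc) (piece_wind pc') /wind -opprD; congr (- _).
have -> : lam (V b (n - m)) 0 (p - V a m) = - lam (V a m) 0 p.
  rewrite -lam_swap -(lamT (V a m)) subrK add0r corner_b subnKC ?(ltnW mn) //.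
  by rewrite subrK (corner_nsides (@polygonP _ X)).
rewrite addrACA subrr addr0.
rewrite -!(big_mkord xpredT (fun i => lam (V a i) (V a i.+1) p)).
rewrite (big_cat_nat (n := m)) ?(ltnW mn) //=; congr (_ + _).
rewrite -{1}[m]add0n big_addn big_mkord; apply: eq_bigr => i _.
by rewrite -[RHS](lamT (V a m)) subrK !corner_b !subrK addnS addnC.
Qed.

Lemma onb_cut p : sonb Y (old a) p -> sonb X a p \/ on_seg (V a m) 0 p.
Proof.
move/(piece_onb pc) => [[i im h]|h]; [left|by right].
by exists i => //; apply: ltn_trans im mn.
Qed.

Lemma reb_ab p : @reb _ X (a, p) (b, p - V a m).
Proof. by exists m; rewrite iter_rebase (pc_b pc). Qed.

End TwoPieces.

Section PieceTrajectories.
Variables (R : realType) (K : R -> Prop).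
Hypothesis hK : dense_subring K.
Variables (X Y : translation_surface R) (old : side X -> side Y).
Hypotheses (oX : over K X) (oY : over K Y).
Local Notation V := (scorner X).
Implicit Types (p q u v w z : 'cV[R]_2).
Variables (a b : side X) (e e' : side Y) (m : nat).
Hypothesis pc : polygon_cut_at old a b e e' m.
Local Notation n := (nsides (next X) a).

Let pc' := polygon_cut_at_sym pc.
Let KV : Kvec K (V a m). Proof. exact: Kvec_corner. Qed.

(** The winding numbers of the pieces add up to that of the polygon, which is at most 1 at a generic
    point. *)
Lemma not_both_pieces p : generic K p -> swind Y (old a) p = 1 ->
  swind Y (old b) (p - V a m) = 1 -> False.
Proof.
move=> g w1 w2; have := cut_wind pc p; rewrite w1 w2.
by case: (generic_wind hK a oX g) => ->.
Qed.

Lemma piece_inside p : generic K p -> swind Y (old a) p = 1 -> swind X a p = 1.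
Proof.
move=> g w1; have := cut_wind pc p; rewrite w1.
have g' : generic K (p - V a m) by apply: generic_add => //; apply: KvecN.
case: (generic_wind hK (old b) oY g') => ->; first by rewrite addr0.
by case: (generic_wind hK a oX g) => ->.
Qed.

Lemma chord_vec_neq0 : V a m != 0.
Proof. by have := svec_neq0 e; rewrite (piece_vec pc) oppr_eq0. Qed.

Let det2_on_line v c : det2 v (c *: v) = 0.
Proof. by rewrite /det2 !mxE; ring. Qed.

Lemma generic_off_chord p c : generic K p -> p <> c *: V a m.
Proof.
move=> g ep; have := generic_line hK g (Kvec0 hK) KV chord_vec_neq0.
by rewrite subr0 ep det2_on_line eqxx.
Qed.

(** The boundary of a piece consists of sides of the polygon and of the chord. A segment free in the
    polygon can meet only the chord, once by transversality, and not at its endpoints, which are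
    corners of the polygon. *)
Lemma piece_forward u s p : Kvec K u -> K s -> generic K p -> free u a p s ->
  free u (old a) p s \/ exists r c, crossing u e (p - V a m) s r c.
Proof.
move=> hu ks g fr; have [g1 g2] := pc_gluee pc; have [n1 n2] := pc_nexte pc.
case: (pselect (exists2 r, 0 <= r <= s & on_seg (V a m) 0 (p + r *: u))); last first.
  move=> nh; left=> r hr /(onb_cut pc) [|h]; first exact: fr.
  by apply: nh; exists r.
move=> [r hr [t ht et]]; right; exists r, t.
have etV : p + r *: u = (1 - t) *: V a m.
  by rewrite et; apply: cV2_eq; rewrite !mxE; ring.
have gr0 : r != 0.
  by apply: contra_notN (generic_off_chord (c := 1 - t) g) => /eqP r0; rewrite -etV r0 scale0r addr0.
have grs : r != s.
  apply: contra_notN (generic_off_chord (c := 1 - t) (generic_time hK g hu ks)) => /eqP rs.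
  by rewrite -etV rs.
have t0 : t != 0.
  apply/eqP=> t0; apply: (fr r hr); exists m; first by case/andP: (pc_m pc).
  by rewrite etV t0 subr0 scale1r; apply: on_segl.
have t1 : t != 1.
  apply/eqP=> t1; apply: (fr r hr); exists 0%N; first exact: nsides_gt0.
  by rewrite etV t1 subrr scale0r corner0; apply: on_segl.
have ge : generic K (p - V a m) by apply: generic_add => //; apply: KvecN.
have ee : p - V a m + r *: u = t *: vec Y e.
  by rewrite addrAC etV (piece_vec pc); apply: cV2_eq; rewrite !mxE; ring.
have tv := crossing_transversal hK oY ge hu ee.
have line r' c : p + r' *: u = c *: V a m -> r' = r.
  move=> er'; apply/eqP; rewrite -subr_eq0.
  have : (r' - r) * det2 (vec Y e) u = 0.
    transitivity (det2 (vec Y e) (p + r' *: u) - det2 (vec Y e) (p + r *: u)).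
      by rewrite /det2 !mxE; ring.
    by rewrite er' etV (piece_vec pc) /det2 !mxE; ring.
  by move/eqP; rewrite mulf_eq0 (negbTE tv) orbF.
case/andP: hr => r0 rs; case/andP: (ht) => tt0 tt1.
split=> //.
- by rewrite !lt_neqAle r0 rs grs eq_sym gr0.
- by rewrite !lt_neqAle tt0 tt1 t1 eq_sym t0.
- move=> r' /andP[r'0 r'r]; have := reb_onb (reb_shift (r' *: u) (piece_reb_e pc p)) => /= ->.
  move=> /(onb_cut pc) [|[c _ ec]].
    by apply: fr; rewrite r'0 (le_trans (ltW r'r)).
  suff er : r' = r by rewrite er ltxx in r'r.
  by apply: (line r' (1 - c)); rewrite ec; apply: cV2_eq; rewrite !mxE; ring.
- move=> r' /andP[rr' r's]; rewrite g1.
  have ve' : vec Y e' = V a m by rewrite -g1 vec_glue (piece_vec pc) opprK.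
  have -> : p - V a m + r' *: u - vec Y e = p + r' *: u.
    by rewrite (piece_vec pc); apply: cV2_eq; rewrite !mxE; ring.
  have rb : @reb _ Y (e', p + r' *: u) (old b, p + r' *: u - V a m).
    by exists 1%N; rewrite /rebase /= n2 ve'.
  have := reb_onb rb => /= <-; move=> /(onb_cut pc') [|[c _ ec]].
    have := reb_onb (reb_ab pc (p + r' *: u)) => /= ->.
    by apply: fr; rewrite r's (le_trans r0 (ltW rr')).
  suff er : r' = r by rewrite er ltxx in rr'.
  have eb : V b (n - m) = - V a m by have := piece_vec pc'; rewrite ve' => ->; rewrite opprK.
  apply: (line r' c); have -> : p + r' *: u = (p + r' *: u - V a m) + V a m by rewrite subrK.
  by rewrite ec eb; apply: cV2_eq; rewrite !mxE; ring.
Qed.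

(** A trajectory inside one piece cannot run into the sides of the other. Shortly before or after
    meeting such a side it would be inside that other piece while still inside the first, against
    [not_both_pieces]. *)
Lemma piece_backward u s p : Kvec K u -> K s -> generic K p ->
  swind Y (old a) p = 1 -> free u (old a) p s -> free u a p s.
Proof.
move=> hu ks g w1 fr r hr [i hi].
have [u0|u0] := eqVneq u 0.
  by move=> h; apply: (generic_off hK oX g (d := a)); exists i; move: h; rewrite ?u0 ?scaler0 ?addr0.
case: (ltnP i m) => im; first by move=> h; apply: (fr r hr); apply/(piece_onb pc); left; exists i.
move=> hon; pose j := (i - m)%N; pose d1 := iter j (next X) b.
have jm : (j < n - m)%N by rewrite ltn_sub2r // (leq_ltn_trans im).
have ed1 : d1 = iter i (next X) a by rewrite /d1 -(pc_b pc) -iterD subnK.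
pose p1 := p - V a i.
have g1 : generic K p1 by apply: generic_add => //; apply: KvecN => //; apply: Kvec_corner.
have [c hc ec] : exists2 c, 0 <= c <= 1 & p1 + r *: u = c *: vec Y (old d1).
  case: hon => c hc; rewrite edge_next => ec; exists c => //.
  by rewrite (pc_vec pc) ed1 /p1 addrAC ec addrC addKr.
have r0 : r != 0.
  apply/eqP=> r0; apply: (generic_off hK oX g (d := a)); exists i => //.
  by move: hon; rewrite r0 scale0r addr0.
have rs : r != s.
  apply/eqP=> rs; apply: (generic_off hK oX (generic_time hK g hu ks) (d := a)); exists i => //.
  by rewrite -rs.
have hr' : 0 < r < s by case/andP: hr => ? ?; rewrite !lt_neqAle rs eq_sym r0; apply/and3P.
have c0 : c != 0.
  by apply/eqP=> c0; apply: (generic_avoid hK g1 (Kvec0 hK) hu u0 (r := r)); rewrite ec c0 scale0r.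
have c1 : c != 1.
  by apply/eqP=> c1; apply: (generic_avoid hK g1 (oY (old d1)) hu u0 (r := r)); rewrite ec c1 scale1r.
have hc' : 0 < c < 1 by case/andP: hc => ? ?; rewrite !lt_neqAle c1 eq_sym c0; apply/and3P.
have [e1 e10 [_ hw]] := crossing_wind hK oY g1 hu hc' ec.
have tv := crossing_transversal hK oY g1 hu ec.
suff [t kt [ht wt]] : exists2 t, K t & 0 <= t <= s /\ swind Y (old d1) (p1 + t *: u) = 1.
  apply: (@not_both_pieces (p + t *: u)); first exact: generic_time.
    rewrite (wind_free (@polygonP _ Y)) //; first by case/andP: ht.
    by move=> r' /andP[h1 h2]; apply: fr; rewrite h1 (le_trans h2) //; case/andP: ht.
  have := piece_reb pc' (p + t *: u - V a m) jm => /reb_wind /=.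
  rewrite -/d1 => <-; rewrite -wt; congr (swind Y _ _).
  rewrite /p1 -[in V a i](subnKC im) corner_add (pc_b pc).
  by apply: cV2_eq; rewrite !mxE; ring.
case/andP: hr' => hr0 hrs.
(* According to its direction the trajectory leaves or enters the other piece at time [r], so the
   contradictory time is taken just before or just after [r]. *)
case: (ltrgtP (det2 (vec Y (old d1)) u) 0) tv => // dt _.
- have lt1 : Num.max 0 (r - e1) < r by rewrite gt_max hr0 gtrBl.
  have [t kt] := dense_between hK lt1; rewrite gt_max -andbA => /and3P[t1 t2 t3].
  exists t => //; split; first by rewrite (ltW t1) (ltW (lt_trans t3 hrs)).
  rewrite (hw t kt) ?t3 ?dt //; last by rewrite lt_eqF.
  by rewrite ler_norml; apply/andP; split; lra.
- have lt1 : r < Num.min s (r + e1) by rewrite lt_min hrs ltrDl.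
  have [t kt] := dense_between hK lt1; rewrite lt_min => /and3P[t1 t2 t3].
  exists t => //; split; first by rewrite (ltW (lt_trans hr0 t1)) (ltW t2).
  rewrite (hw t kt); last 2 first.
  + by rewrite ler_norml; apply/andP; split; lra.
  + by rewrite gt_eqF.
  by rewrite ltNge (ltW t1) /= ltNge (ltW dt).
Qed.

(** An interior point of the side [e] lies on no other side of the simple polygon of [e]. *)
Lemma chord_off_piece u q r c i : Kvec K u -> generic K q -> 0 < c < 1 ->
  q + r *: u = c *: vec Y e -> (i < m)%N ->
  ~ on_seg (V a i) (V a i.+1) (q - vec Y e + r *: u).
Proof.
move=> hu g hc ec im hon; have [n1 _] := pc_nexte pc.
have [eps eps0 hiso] := crossing_isolated hK oY g hu hc ec.
have [] := hiso r; first by rewrite subrr normr0 ltW.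
move=> /(_ i.+1) + _; apply.
  by rewrite /= -(nsides_next (next Y) e) n1 (piece_nsides pc).
have ce j : (j <= m)%N -> scorner Y e j.+1 = V a j + vec Y e.
  by move=> jm; rewrite -(piece_corner pc jm) -n1 corner_next subrK.
rewrite !ce ?(ltnW im) //.
have -> : q + r *: u = q - vec Y e + r *: u + vec Y e by rewrite addrAC subrK.
by apply/on_segT.
Qed.

End PieceTrajectories.

(** A rebasing that returns to the same side goes round the closed polygon a whole number of times,
    so the vector is unchanged. *)
Lemma reb_same (R : realType) (X : translation_surface R) (d : side X) p p' :
  @reb _ X (d, p) (d, p') -> p' = p.
Proof.
move=> [k]; rewrite iter_rebase => -[ed ->].
rewrite (corner_mod (@polygonP _ X)).
have n0 := nsides_gt0 (next X) d; set n := nsides _ _ in n0 *.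
have it : iter (k %% n) (next X) d = d.
  rewrite {2}ed {2}(divn_eq k n) addnC iterD; congr iter.
  by elim: (k %/ n)%N => // j IH; rewrite mulSn iterD -IH iter_nsides.
have [->|k0] := posnP (k %% n); first by rewrite corner0 subr0.
by case: (@porbit_no_return _ (next X) d (k %% n)); rewrite // k0 ltn_mod.
Qed.

Section PolygonCutSimulation.
Variables (R : realType) (K : R -> Prop).
Hypothesis hK : dense_subring K.
Variables (X Y : translation_surface R).
Hypotheses (oX : over K X) (oY : over K Y).
Variables (h : side X + bool -> side Y) (h' : side Y -> side X + bool).
Hypotheses (hK1 : cancel h h') (hK2 : cancel h' h).
Variables (a b : side X) (m : nat).
Let old d := h (inl d).
Let e := h (inr true).
Let e' := h (inr false).
Hypothesis pc : polygon_cut_at old a b e e' m.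
Local Notation V := (scorner X).
Local Notation n := (nsides (next X) a).

Let pc' := polygon_cut_at_sym pc.

Let back (y : pt Y) : pt X :=
  match h' y.1 with
  | inl d => (d, y.2)
  | inr true => (a, y.2 - vec Y e)
  | inr false => (b, y.2 - vec Y e')
  end.
Let oldp (x : pt X) : pt Y := (old x.1, x.2).

Let back_old x : back (oldp x) = x.
Proof. by case: x => d p; rewrite /back /= hK1. Qed.
Let back_oldd d p : back (old d, p) = (d, p).
Proof. by rewrite /back hK1. Qed.
Let back_e q : back (e, q) = (a, q - vec Y e).
Proof. by rewrite /back hK1. Qed.
Let back_e' q : back (e', q) = (b, q - vec Y e').
Proof. by rewrite /back hK1. Qed.

Let side_cases g : [\/ exists d, g = old d, g = e | g = e'].
Proof.
rewrite -(hK2 g); case: (h' g) => [d|[]]; [apply: Or31; by exists d|exact: Or32|exact: Or33].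
Qed.

Let back_shift g q w : back (g, q + w) = ((back (g, q)).1, (back (g, q)).2 + w).
Proof. by rewrite /back /=; case: (h' g) => [d|[]] //=; rewrite addrAC. Qed.

Let reb_oldback y : reb (oldp (back y)) y.
Proof.
have [n1 n2] := pc_nexte pc.
case: y => g q; have [[d ->]|->|->] := side_cases g.
- by rewrite back_oldd; apply: reb_refl.
- by rewrite back_e; apply: reb_sym; exists 1%N; rewrite /rebase /= n1.
- by rewrite back_e'; apply: reb_sym; exists 1%N; rewrite /rebase /= n2.
Qed.

Let back_rebase y : reb (back y) (back (rebase y)).
Proof.
have [n1 n2] := pc_nexte pc; have ve := piece_vec pc; have ve' := piece_vec pc'.
case: y => g q; have [[d ->]|->|->] := side_cases g.
- rewrite back_oldd /rebase /= (pc_next pc) (pc_vec pc).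
  case: (eqVneq (next X d) b) => [nb|_].
    rewrite back_e ve opprK; apply: reb_trans (reb_rebase _) _; rewrite /rebase /= nb.
    by apply: reb_sym; have := reb_ab pc (q - vec X d + V a m); rewrite addrK.
  case: (eqVneq (next X d) a) => [na|_].
    rewrite back_e' ve' opprK; apply: reb_trans (reb_rebase _) _; rewrite /rebase /= na.
    by apply: reb_sym; have := reb_ab pc' (q - vec X d + V b (n - m)); rewrite addrK.
  by rewrite back_oldd; apply: reb_rebase.
- by rewrite back_e /rebase /= n1 back_oldd; apply: reb_refl.
- by rewrite back_e' /rebase /= n2 back_oldd; apply: reb_refl.
Qed.

Let pieces d p : [\/ d \notin porbit (next X) a,
  exists2 p0, @reb _ X (a, p0) (d, p) & @reb _ Y (old a, p0) (old d, p) |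
  exists2 p0, @reb _ X (b, p0) (d, p) & @reb _ Y (old b, p0) (old d, p)].
Proof.
case: (boolP (d \in porbit (next X) a)) => hd; last exact: Or31.
move/porbitP: (hd) => [i]; rewrite permX => ed.
have n0 := nsides_gt0 (next X) a.
have it : iter (i %% n) (next X) a = d.
  rewrite ed {2}(divn_eq i n) addnC iterD; congr iter.
  by elim: (i %/ n)%N => // j IH; rewrite mulSn iterD -IH iter_nsides.
have hin : (i %% n < n)%N by rewrite ltn_mod.
case: (ltnP (i %% n) m) => im.
- apply: Or32; exists (p + V a (i %% n)).
    by exists (i %% n)%N; rewrite iter_rebase it addrK.
  by have := piece_reb pc (p + V a (i %% n)) im; rewrite it addrK.
- apply: Or33; pose j := (i %% n - m)%N.
  have jm : (j < n - m)%N by rewrite ltn_sub2r // (leq_ltn_trans im).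
  have it' : iter j (next X) b = d by rewrite -(pc_b pc) -iterD subnK.
  exists (p + V b j); first by exists j; rewrite iter_rebase it' addrK.
  by have := piece_reb pc' (p + V b j) jm; rewrite it' addrK.
Qed.

Let porbit_reb (x x' : pt X) : reb x x' ->
  (x'.1 \in porbit (next X) a) = (x.1 \in porbit (next X) a).
Proof.
move=> [k ->]; case: x => d p; rewrite iter_rebase /=.
by rewrite -permX -eq_porbit_mem porbit_perm eq_porbit_mem.
Qed.

Let b_in : b \in porbit (next X) a.
Proof. by rewrite -(pc_b pc) -permX mem_porbit. Qed.

(** In [Y] no rebasing leads from one piece to the other. Being good says in which piece a point
    lies, and [not_both_pieces] prevents two representatives of one point of [X] from lying in
    different pieces. *)
Let good_old_fun x x' : good K (oldp x) -> good K (oldp x') -> reb x x' ->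
  reb (oldp x) (oldp x').
Proof.
case: x x' => [d p] [d' p'] gx gx' rb; rewrite /oldp /= in gx gx' *.
have contra p0 p0' : @reb _ X (a, p0) (b, p0') -> good K ((old a, p0) : pt Y) ->
    good K ((old b, p0') : pt Y) -> False.
  move=> r [/= w1 g1] [/= w2 _]; apply: (not_both_pieces hK oX pc g1 w1).
  by rewrite (reb_same (reb_trans (reb_sym r) (reb_ab pc p0))).
case: (pieces d p) => [hd|[p0 r1 r2]|[p0 r1 r2]].
- case: rb => k; rewrite iter_rebase => -[-> ->]; exists k; rewrite iter_rebase.
  by rewrite (outside_iter pc) // (outside_corner pc).
- have ina : d' \in porbit (next X) a.
    by rewrite (porbit_reb rb) (porbit_reb r1) porbit_id.
  case: (pieces d' p') => [|[p1 r3 r4]|[p1 r3 r4]]; first by rewrite ina.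
    have r13 := reb_trans r1 (reb_trans rb (reb_sym r3)).
    by rewrite (reb_same r13) in r4; apply: reb_trans (reb_sym r2) r4.
  exfalso; apply: (contra p0 p1); first exact: reb_trans r1 (reb_trans rb (reb_sym r3)).
    exact: good_reb (reb_sym r2) gx.
  exact: good_reb (reb_sym r4) gx'.
- have ina : d' \in porbit (next X) a.
    by rewrite (porbit_reb rb) (porbit_reb r1) b_in.
  case: (pieces d' p') => [|[p1 r3 r4]|[p1 r3 r4]]; first by rewrite ina.
    exfalso; apply: (contra p1 p0); first exact: reb_trans r3 (reb_trans (reb_sym rb) (reb_sym r1)).
      exact: good_reb (reb_sym r4) gx'.
    exact: good_reb (reb_sym r2) gx.
  have r13 := reb_trans r1 (reb_trans rb (reb_sym r3)).
  by rewrite (reb_same r13) in r4; apply: reb_trans (reb_sym r2) r4.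
Qed.

Let good_oldE x : good K (oldp x) -> good K x.
Proof.
case: x => d p gx; case: (pieces d p) => [hd|[p0 r1 r2]|[p0 r1 r2]].
- by case: gx => w g; split=> //; rewrite -(outside_wind pc).
- have [/= w g] := good_reb hK oY (reb_sym r2) gx.
  apply: good_reb r1 _ => //; split=> //; exact: (piece_inside hK oX oY pc).
- have [/= w g] := good_reb hK oY (reb_sym r2) gx.
  apply: good_reb r1 _ => //; split=> //; exact: (piece_inside hK oX oY pc').
Qed.

Let good_back y : good K y -> good K (back y).
Proof. by move=> gy; apply: good_oldE; apply: good_reb (reb_sym (reb_oldback y)) gy. Qed.

Let old_free_backward u s d p : Kvec K u -> K s -> good K (oldp (d, p)) ->
  free u (old d) p s -> free u d p s.
Proof.
move=> hu ks gx fr; case: (pieces d p) => [hd|[p0 r1 r2]|[p0 r1 r2]].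
- by move=> r hr; rewrite -(outside_onb pc) //; apply: fr.
- have [/= w g] := good_reb hK oY (reb_sym r2) gx.
  apply: (free_reb r1); apply: (piece_backward hK oX oY pc) => //.
  exact: (free_reb (reb_sym r2)).
- have [/= w g] := good_reb hK oY (reb_sym r2) gx.
  apply: (free_reb r1); apply: (piece_backward hK oX oY pc') => //.
  exact: (free_reb (reb_sym r2)).
Qed.

Let free_backward u s g q : Kvec K u -> K s -> good K ((g, q) : pt Y) -> free u g q s ->
  free u (back (g, q)).1 (back (g, q)).2 s.
Proof.
move=> hu ks gy fr; have rb := reb_oldback (g, q).
apply: old_free_backward => //; first exact: good_reb (reb_sym rb) gy.
by move: rb; rewrite /oldp; case: (back _) => d p /= rb; apply: (free_reb (reb_sym rb)).
Qed.

Let old_free_forward u s d p : Kvec K u -> K s -> 0 < s -> good K (oldp (d, p)) ->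
  free u d p s ->
  exists2 y', tr K u s (oldp (d, p)) y' & reb (back y') (d, p + s *: u).
Proof.
move=> hu ks s0 gx fr.
have [gl1 gl2] := pc_gluee pc; have ve := piece_vec pc; have ve' := piece_vec pc'.
case: (pieces d p) => [hd|[p0 r1 r2]|[p0 r1 r2]].
- exists (old d, p + s *: u); last by rewrite back_oldd; apply: reb_refl.
  by apply: tr_free1 => // r hr; rewrite (outside_onb pc) //; apply: fr.
- have [/= w g] := good_reb hK oY (reb_sym r2) gx.
  have fr0 := free_reb (reb_sym r1) fr.
  have [fr'|[r [c cr]]] := piece_forward hK oX oY pc hu ks g fr0.
    exists (old a, p0 + s *: u); last by rewrite back_oldd; apply: reb_shift.
    by apply: (tr_rebl (reb_sym r2)); apply: tr_free1.
  exists (glue Y e, p0 - V a m + s *: u - vec Y e); last first.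
    rewrite gl1 back_e'; apply: reb_trans (reb_shift (s *: u) r1).
    apply: reb_sym; apply: reb_trans (reb_ab pc (p0 + s *: u)) _.
    have -> : vec Y e' = - vec Y e by rewrite -gl1 vec_glue.
    exists 0%N; congr (_, _).
    by apply: cV2_eq; rewrite !mxE; ring.
  apply: (tr_rebl (reb_sym r2)); apply: (tr_rebl (piece_reb_e pc p0)).
  exact: tr_cross1 cr.
- have [/= w g] := good_reb hK oY (reb_sym r2) gx.
  have fr0 := free_reb (reb_sym r1) fr.
  have [fr'|[r [c cr]]] := piece_forward hK oX oY pc' hu ks g fr0.
    exists (old b, p0 + s *: u); last by rewrite back_oldd; apply: reb_shift.
    by apply: (tr_rebl (reb_sym r2)); apply: tr_free1.
  exists (glue Y e', p0 - V b (n - m) + s *: u - vec Y e'); last first.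
    rewrite gl2 back_e; apply: reb_trans (reb_shift (s *: u) r1).
    apply: reb_sym; apply: reb_trans (reb_ab pc' (p0 + s *: u)) _.
    have -> : vec Y e' = - vec Y e by rewrite -gl1 vec_glue.
    exists 0%N; congr (_, _).
    by apply: cV2_eq; rewrite !mxE; ring.
  apply: (tr_rebl (reb_sym r2)); apply: (tr_rebl (piece_reb_e pc' p0)).
  exact: tr_cross1 cr.
Qed.

(** A segment free in [X] may have to cross the chord in [Y]. A crossing in [X] is split in three: a
    free segment up to [t1], the crossing of the same side in [Y] between [t1] and [t2], and a free
    segment up to [s]. *)
Lemma polygon_cut_forward : simulates K X Y.
Proof.
have rebf y y' : good K y -> good K y' -> reb (back y) (back y') -> reb y y'.
  move=> gy gy' rb; apply: reb_trans (reb_sym (reb_oldback y)) _.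
  apply: reb_trans (reb_oldback y'); apply: good_old_fun => //.
    exact: good_reb (reb_sym (reb_oldback y)) gy.
  exact: good_reb (reb_sym (reb_oldback y')) gy'.
have ffree u s y d p : Kvec K u -> K s -> 0 < s -> good K y -> reb (d, p) (back y) ->
     free u d p s ->
     exists2 y', tr K u s y y' & reb (back y') (d, p + s *: u).
  move=> hu ks s0 gy rb fr.
  case eb : (back y) rb => [d' p'] rb; have rby := reb_oldback y; rewrite eb in rby.
  have [|y' htr hy'] := old_free_forward hu ks s0 _ (free_reb rb fr).
    exact: good_reb (reb_sym rby) gy.
  exists y'; first exact: tr_rebl (reb_sym rby) htr.
  exact: reb_trans hy' (reb_shift (s *: u) (reb_sym rb)).
apply: (@simulates_forward _ _ hK X Y back oX oY back_rebase _ rebf).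
- move=> [d p] gx; case: (boolP (d \in porbit (next X) a)) => hd; last first.
    exists (old d, p); last by rewrite back_oldd; apply: reb_refl.
    by case: gx => w g; split=> //=; rewrite (outside_wind pc).
  have [p0 rb] : exists p0, @reb _ X (a, p0) (d, p).
    case: (pieces d p) => [|[p0 r1 _]|[p0 r1 _]]; first by rewrite hd.
      by exists p0.
    exists (p0 + V a m); apply: reb_trans (reb_ab pc _) _.
    by rewrite addrK.
  have [/= w g] := good_reb hK oX (reb_sym rb) gx.
  have g' : generic K (p0 - V a m).
    by apply: generic_add => //; apply: KvecN => //; apply: Kvec_corner.
  have := cut_wind pc p0; rewrite w.
  case: (generic_wind hK (old a) oY g) => w1.
    rewrite w1 add0r => w2; exists (old b, p0 - V a m); first by split.
    by rewrite back_oldd; apply: reb_trans (reb_sym rb) (reb_ab pc p0).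
  move=> _; exists (old a, p0); first by split.
  by rewrite back_oldd; apply: reb_sym.
- move=> u s y hu ks s0 gy gb fr; apply: ffree => //.
  by case: (back y) => ? ?; apply: reb_refl.
- move=> u s y d p r c hu ks gy gx rb cr.
  have [dneg gx'] := crossing_good hK oX hu ks gx cr.
  have [/= w g] := gx.
  case: cr => /andP[r0 rs] hc ec bef aft.
  have eY : p + r *: u = c *: vec Y (old d) by rewrite (pc_vec pc).
  have [e1 e10 [off1 hw1]] := crossing_wind hK oY g hu hc eY.
  have g' : generic K (p - vec X d) by apply: generic_add => //; apply: KvecN.
  have eY' : p - vec X d + r *: u = (1 - c) *: vec Y (old (glue X d)).
    by rewrite addrAC ec (pc_vec pc) vec_glue; apply: cV2_eq; rewrite !mxE; ring.
  have [e2 e20 [off2 hw2]] := crossing_wind hK oY g' hu (onem01 hc) eY'.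
  (* The times [t1] and [t2] are chosen so close to [r] that between them the crossed side is the
     only one met, in both new polygons. *)
  have lt1 : Num.max 0 (r - e1) < r by rewrite gt_max r0 gtrBl.
  have [t1 k1] := dense_between hK lt1; rewrite gt_max -andbA => /and3P[t1a t1b t1c].
  have lt2 : r < Num.min s (r + e2) by rewrite lt_min rs ltrDl.
  have [t2 k2] := dense_between hK lt2; rewrite lt_min => /and3P[t2a t2b t2c].
  have fr1 : free u d p t1.
    by move=> r' /andP[h1 h2]; apply: bef; rewrite h1 (le_lt_trans h2).
  have [y1 htr1 hy1] := ffree u t1 y d p hu k1 t1a gy rb fr1.
  have gy1 := tr_good hK oY hu htr1 gy.
  have near1 : forall r', t1 <= r' <= r -> `|r' - r| <= e1.
    by move=> r' /andP[h1 h2]; rewrite ler_norml; apply/andP; split; lra.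
  have near2 : forall r', r <= r' <= t2 -> `|r' - r| <= e2.
    by move=> r' /andP[h1 h2]; rewrite ler_norml; apply/andP; split; lra.
  have gold : good K ((old d, p + t1 *: u) : pt Y).
    split; last exact: generic_time.
    rewrite /= (hw1 t1 k1) ?near1 ?lexx ?(ltW t1c) //; last by rewrite lt_eqF.
    by rewrite t1c (pc_vec pc) dneg.
  have rb1 : reb y1 (old d, p + t1 *: u).
    by apply: rebf => //; rewrite back_oldd.
  have cr2 : crossing u (old d) (p + t1 *: u) (t2 - t1) (r - t1) c.
    have shift (r' : R) : p + t1 *: u + r' *: u = p + (t1 + r') *: u.
      by rewrite scalerDl addrA.
    split=> //.
    - by rewrite subr_gt0 t1c ltrD2r.
    - by rewrite shift [t1 + _]addrC subrK.
    - move=> r' /andP[h1 h2]; rewrite shift; apply: off1.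
        by apply: near1; rewrite lerDl h1 /= -lerBrDl ltW.
      by rewrite lt_eqF // -ltrBrDl.
    - move=> r' /andP[h1 h2]; rewrite shift (pc_glueo pc) (pc_vec pc) addrAC; apply: off2.
        by apply: near2; rewrite -lerBlDl ltW //= -lerBrDl.
      by rewrite gt_eqF // -ltrBlDl.
  have ks2 : K (t2 - t1) by apply: denseB.
  have htr2 := tr_cross1 ks2 cr2.
  have gy2 := tr_good hK oY hu htr2 gold.
  have ks3 : K (s - t2) by apply: denseB.
  have s3 : 0 < s - t2 by rewrite subr_gt0.
  have pos2 : p + t1 *: u + (t2 - t1) *: u - vec Y (old d) = p + t2 *: u - vec X d.
    by rewrite (pc_vec pc) -(addrA p) -scalerDl [t1 + _]addrC subrK.
  rewrite pos2 (pc_glueo pc) in htr2 gy2.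
  have [||y3 htr3 hy3] := ffree u (s - t2) (old (glue X d), p + t2 *: u - vec X d)
     (glue X d) (p + t2 *: u - vec X d) hu ks3 s3 gy2.
  + by rewrite back_oldd; apply: reb_refl.
  + move=> r' /andP[h1 h2]; rewrite addrAC -(addrA p) -scalerDl; apply: aft.
    by rewrite (lt_le_trans t2a) ?lerDl //= -lerBrDl.
  exists y3.
    have -> : s = t1 + (t2 - t1 + (s - t2)) by ring.
    by apply: (tr_cat htr1); apply: (tr_rebl rb1); apply: tr_cat htr2 htr3.
  apply: reb_trans hy3 _; exists 0%N; congr (_, _).
  by apply: cV2_eq; rewrite !mxE; ring.
Qed.

(** An interior point of the chord is off the boundary of the uncut polygon: each half of that
    boundary belongs to a piece, where [chord_off_piece] applies. *)
Let chord_off u q r c : Kvec K u -> generic K q -> 0 < c < 1 ->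
  q + r *: u = c *: vec Y e -> ~ sonb X a (q - vec Y e + r *: u).
Proof.
have [gl1 gl2] := pc_gluee pc; have ve := piece_vec pc.
have ve' : vec Y e' = - vec Y e by rewrite -gl1 vec_glue.
move=> hu g hc ec [i hi hon]; case: (ltnP i m) => im.
  exact: (chord_off_piece hK oY pc hu g hc ec im hon).
have jm : (i - m < n - m)%N by rewrite ltn_sub2r // (leq_ltn_trans im).
have g' : generic K (q - vec Y e) by apply: generic_add => //; apply: KvecN.
apply: (@chord_off_piece _ _ hK X Y old oY b a e' e _ pc' u (q - vec Y e) r (1 - c) _ hu g' (onem01 hc) _ jm).
  by rewrite addrAC ec ve'; apply: cV2_eq; rewrite !mxE; ring.
have cb j : V b j = V a (m + j)%N - V a m.
  by rewrite corner_add (pc_b pc) addrC addKr.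
rewrite !cb addnS subnKC //.
have -> : q - vec Y e - vec Y e' + r *: u = q - vec Y e + r *: u - V a m.
  by rewrite ve' ve; apply: cV2_eq; rewrite !mxE; ring.
by apply/on_segT.
Qed.

Let chord_off' u q r c : Kvec K u -> generic K q -> 0 < c < 1 ->
  q + r *: u = c *: vec Y e' -> ~ sonb X b (q - vec Y e' + r *: u).
Proof.
have [gl1 gl2] := pc_gluee pc; have ve := piece_vec pc.
have ve' : vec Y e' = - vec Y e by rewrite -gl1 vec_glue.
move=> hu g hc ec.
have g' : generic K (q + vec Y e) by apply: generic_add.
have := @chord_off u (q - vec Y e') r (1 - c) hu _ (onem01 hc).
rewrite {1 2}ve' opprK => /(_ g') h1 h2; apply: h1.
  by rewrite addrAC ec ve'; apply: cV2_eq; rewrite !mxE; ring.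
have := reb_onb (reb_ab pc (q - vec Y e' - vec Y e + r *: u)) => /= <-.
move: h2; rewrite ve' ve; congr (sonb X b _).
by apply: cV2_eq; rewrite !mxE; ring.
Qed.

(** A crossing of the chord becomes a free segment of [X], and a crossing of an old side stays
    one. *)
Lemma polygon_cut_backward : simulates K Y X.
Proof.
have [gl1 gl2] := pc_gluee pc; have ve := piece_vec pc.
have ve' : vec Y e' = - vec Y e by rewrite -gl1 vec_glue.
apply: (@simulates_backward _ _ hK X Y back oX oY back_shift back_rebase good_back).
  by move=> u s g q hu ks s0; apply: free_backward.
move=> u s g q r c hu ks gy cr.
have [h1 hc ec h4 h5] := cr; have /andP[r0 rs] := h1.
(* A time of [K] between [r'] and [r] ends a segment that is free in [Y], hence in [X]. The times
   after the crossing are treated alike. *)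
have bef r' : 0 <= r' < r -> ~ sonb X (back (g, q)).1 ((back (g, q)).2 + r' *: u).
  move=> /andP[r'0 r'r]; have [t kt /andP[t1 t2]] := dense_between hK r'r.
  have fr : free u g q t.
    by move=> x /andP[x0 xt]; apply: h4; rewrite x0 (le_lt_trans xt).
  by apply: (free_backward hu kt gy fr); rewrite r'0 (ltW t1).
have aft r' : r < r' <= s ->
    ~ sonb X (back (glue Y g, q - vec Y g)).1 ((back (glue Y g, q - vec Y g)).2 + r' *: u).
  move=> /andP[rr' r's]; have [t kt /andP[t1 t2]] := dense_between hK rr'.
  have crt : crossing u g q t r c.
    split=> //; first by rewrite r0.
    by move=> x /andP[x0 xt]; apply: h5; rewrite x0 (le_trans xt) // (le_trans (ltW t2)).
  have [_ gz] := crossing_good hK oY hu kt gy crt.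
  have kst : K (s - t) by apply: denseB.
  have fr : free u (glue Y g) (q + t *: u - vec Y g) (s - t).
    move=> x /andP[x0 xs]; rewrite addrAC -(addrA q) -scalerDl; apply: h5.
    by rewrite (lt_le_trans t1) ?lerDl //= -lerBrDl.
  have := free_backward hu kst gz fr (r := r' - t).
  rewrite addrAC (back_shift _ (q - vec Y g) (t *: u)) /=; case: (back (glue Y g, q - vec Y g)) => d0 p0 /=.
  rewrite -addrA -scalerDl [t + _]addrC subrK; apply.
  by rewrite subr_ge0 (ltW t2) lerB.
have [/= w gq] := gy.
have [[d eg]|eg|eg] := side_cases g; subst g.
- exists (glue X d, q + s *: u - vec X d); last first.
    by rewrite (pc_glueo pc) (pc_vec pc) back_oldd; apply: reb_refl.
  rewrite back_oldd in bef *; rewrite (pc_glueo pc) (pc_vec pc) back_oldd /= in aft.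
  apply: (tr_cross1 (r := r) (c := c)) => //; split=> //.
    by rewrite -(pc_vec pc).
  by move=> r' hr'; rewrite addrAC; apply: aft.
- exists (a, q - vec Y e + s *: u).
    rewrite back_e in bef *; rewrite gl1 back_e' /= ve' addrK in aft.
    apply: tr_free1 => //; first exact: lt_trans r0 rs.
    move=> x /andP[x0 xs]; case: (ltrgtP x r) => xr; first by apply: bef; rewrite x0.
      have := reb_onb (reb_ab pc (q - vec Y e + x *: u)) => /= <-.
      have := aft x; rewrite xr xs => /(_ isT).
      by congr (~ sonb X b _); rewrite ve; apply: cV2_eq; rewrite !mxE; ring.
    by rewrite xr; apply: chord_off hu gq hc ec.
  rewrite gl1 back_e'; apply: reb_trans (reb_ab pc _) _; exists 0%N; congr (_, _).
  by rewrite ve' ve; apply: cV2_eq; rewrite !mxE; ring.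
- exists (b, q - vec Y e' + s *: u).
    rewrite back_e' in bef *; rewrite gl2 back_e /= ve' opprK addrK in aft.
    apply: tr_free1 => //; first exact: lt_trans r0 rs.
    move=> x /andP[x0 xs]; case: (ltrgtP x r) => xr; first by apply: bef; rewrite x0.
      have -> : q - vec Y e' + x *: u = q + x *: u - V a m.
        by rewrite ve' ve; apply: cV2_eq; rewrite !mxE; ring.
      have := reb_onb (reb_ab pc (q + x *: u)) => /= ->.
      by apply: aft; rewrite xr xs.
    by rewrite xr; apply: chord_off' hu gq hc ec.
  rewrite gl2 back_e; apply: reb_sym; apply: reb_trans (reb_ab pc _) _.
  exists 0%N; congr (_, _).
  by rewrite ve' ve; apply: cV2_eq; rewrite !mxE; ring.
Qed.

End PolygonCutSimulation.

(** * Invariance under cut-and-paste equivalence *)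

Section CutPaste.
Variable R : realType.
Implicit Types (X Y : translation_surface R) (K : R -> Prop).

Lemma glue_neq X (a : side X) : a != glue X a.
Proof.
apply/eqP=> ea; have := vec_glue a; rewrite -ea => /eqP.
rewrite -subr_eq0 opprK -mulr2n -scaler_nat scaler_eq0 pnatr_eq0 /=.
by rewrite (negbTE (svec_neq0 a)).
Qed.

Lemma edge_cut_atP X Y (h : side X + bool -> side Y) (a : side X) (t : R) :
  let old d := h (inl d) in
  let b := h (inr true) in
  let b' := h (inr false) in
  [/\ bijective h, 0 < t < 1,
      (forall d, next Y (old d) =
         if d == a then b else if d == glue X a then b'
         else old (next X d)) /\
      next Y b = old (next X a) /\
      next Y b' = old (next X (glue X a)),
      (forall d, d != a -> d != glue X a ->
         glue Y (old d) = old (glue X d)) /\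
      glue Y (old a) = b' /\
      glue Y b = old (glue X a) &
      (forall d, d != a -> d != glue X a -> vec Y (old d) = vec X d) /\
      vec Y (old a) = t *: vec X a /\
      vec Y b = (1 - t) *: vec X a] ->
  edge_cut_at old a (glue X a) b b' t.
Proof.
move=> old b b' [bh ht [nx [n1 n2]] [go [g1 g2]] [vo [v1 v2]]].
have ih := bij_inj bh.
have va : vec X (glue X a) = - vec X a by rewrite vec_glue.
split=> //.
- by rewrite glueK.
- by split=> //; rewrite -g2 glueK.
- by split=> //; rewrite -g1 glueK.
- by split=> //; rewrite -g2 vec_glue v2 va scalerN.
- by split=> //; rewrite -g1 vec_glue v1 va scalerN.
- by move=> d d' /ih [].
- by split=> [/ih []|d /ih|d /ih].
- exact: glue_neq.
Qed.

Lemma polygon_cut_atP X Y (h : side X + bool -> side Y) (a b : side X) :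
  let old d := h (inl d) in
  let e := h (inr true) in
  let e' := h (inr false) in
  [/\ bijective h, a != b /\ b \in porbit (next X) a,
      (forall d, next Y (old d) =
         if next X d == b then e else if next X d == a then e'
         else old (next X d)) /\
      next Y e = old a /\
      next Y e' = old b,
      (forall d, glue Y (old d) = old (glue X d)) /\ glue Y e = e' &
      forall d, vec Y (old d) = vec X d] ->
  exists m, polygon_cut_at old a b e e' m.
Proof.
move=> old e e' [bh [ne /porbitP [i eb]] [nx [n1 n2]] [go g1] vo].
rewrite permX in eb; have ih := bij_inj bh.
have n0 := nsides_gt0 (next X) a; set n := nsides (next X) a in n0.
have it : iter (i %% n) (next X) a = b.
  rewrite eb {2}(divn_eq i n) addnC iterD; congr iter.
  by elim: (i %/ n)%N => // j IH; rewrite mulSn iterD -IH iter_nsides.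
exists (i %% n)%N; split=> //.
- rewrite ltn_mod n0 andbT lt0n; apply: contraNneq ne => i0.
  by rewrite -it i0.
- by split=> //; rewrite -g1 glueK.
- by move=> d d' /ih [].
- by split=> [/ih []|d /ih|d /ih].
Qed.

Lemma cut_simulates K X Y : dense_subring K -> over K X -> over K Y -> cut X Y ->
  simulates K X Y /\ simulates K Y X.
Proof.
move=> hK oX oY [[f bf mf]|[h [a [t H]]]|[h [a [b H]]]].
- split; first exact: (relabelling_simulates hK oX oY bf mf).
  case: (bf) => g fg gf; apply: (relabelling_simulates (f := g) hK oY oX).
    by exists f.
  move=> d; case: (mf (g d)) => h1 h2 h3; rewrite !gf in h1 h2 h3.
  by rewrite -h1 -h2 !fg -h3.
- have ec := edge_cut_atP H; case: H => -[h' hK1 hK2] _ _ _ _.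
  split; first exact: (edge_cut_forward hK oX oY hK1 hK2 ec).
  exact: (edge_cut_backward hK oX oY hK1 hK2 ec).
- have [m pc] := polygon_cut_atP H; case: H => -[h' hK1 hK2] _ _ _ _.
  split; first exact: (polygon_cut_forward hK oX oY hK1 hK2 pc).
  exact: (polygon_cut_backward hK oX oY hK1 hK2 pc).
Qed.

Definition coords X : seq R :=
  [seq vec X d 0 0 | d <- enum (side X)] ++ [seq vec X d 1 0 | d <- enum (side X)].

Lemma over_coords K X : (forall x, x \in coords X -> K x) -> over K X.
Proof.
by move=> h d; split; apply: h; rewrite mem_cat; apply/orP; [left|right];
  apply: map_f; rewrite mem_enum.
Qed.

(** The list [F] records the coordinates of the intermediate surfaces of a chain of moves: the ring
    can be chosen only once the chain is known. *)
Lemma cut_paste_simulates X Y : cut_paste_equiv X Y ->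
  exists F : seq R, forall K, dense_subring K -> (forall x, x \in F -> K x) ->
    over K X -> over K Y -> simulates K X Y /\ simulates K Y X.
Proof.
elim=> {X Y} [X Y hc|X|X Y _ [F IH]|X Y Z _ [F IH] _ [G IH']].
- by exists [::] => K hK _ oX oY; apply: cut_simulates.
- by exists [::] => K hK _ oX _; split; apply: simulates_refl.
- by exists F => K hK hF oY oX; have [] := IH K hK hF oX oY.
- exists (F ++ G ++ coords Y) => K hK hF oX oZ.
  have oY : over K Y by apply: over_coords => x hx; apply: hF; rewrite 2!mem_cat hx !orbT.
  have [|h1 h2] := IH K hK _ oX oY; first by move=> x hx; apply: hF; rewrite mem_cat hx.
  have [|h3 h4] := IH' K hK _ oY oZ; first by move=> x hx; apply: hF; rewrite 2!mem_cat hx orbT.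
  by split; apply: simulates_trans; [exact: h1|exact: h3|exact: h4|exact: h2].
Qed.

End CutPaste.

(** * Euler characteristic *)

Section EulerCharacteristic.
Variable R : realType.
Implicit Types X Y : translation_surface R.

Lemma card_edges X : (#|porbits (glue X)| * 2)%N = #|side X|.
Proof.
apply: card_porbits_free_involution => [d|d]; first exact: glueK.
by rewrite eq_sym; apply: glue_neq.
Qed.

Lemma euler_charE X : euler_char X =
  (#|porbits (vertex_perm X)|%:Z + #|porbits (next X)|%:Z - #|porbits (glue X)|%:Z)%R.
Proof. by rewrite /euler_char addrAC. Qed.

Lemma vertex_permE X d : vertex_perm X d = next X (glue X d).
Proof. by rewrite permM. Qed.

Lemma relabelling_euler X Y : relabelling X Y -> euler_char Y = euler_char X.
Proof.
move=> [f bf mf]; rewrite /euler_char.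
congr (_%:Z - _%:Z + _%:Z)%R; apply: (card_porbits_conj bf) => x; have [h1 h2 _] := mf x.
- by rewrite !vertex_permE -h2; have [-> _ _] := mf (glue X x).
- by rewrite h2.
- by rewrite h1.
Qed.

(** One more vertex and one more edge, with as many faces. *)
Lemma edge_cut_euler X Y : edge_cut X Y -> euler_char Y = euler_char X.
Proof.
move=> [h [a [t [bh _ [nx [n1 n2]] [go [g1 g2]] _]]]].
set a' := glue X a in nx n2 go g2 *.
set b := h (inr true) in nx n1 n2 go g1 g2; set b' := h (inr false) in nx n1 n2 go g1 g2.
have na : a != a' := glue_neq a.
have gK : glue X a' = a by apply: glueK.
have cE : #|side Y| = (#|side X| + 2)%N.
  by rewrite -(bij_eq_card bh) card_sum card_bool.
have eE := card_edges X; have eE' := card_edges Y.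
have ga' : glue Y (h (inl a')) = b by rewrite -g2 glueK.
have gb' : glue Y b' = h (inl a) by rewrite -g1 glueK.
(* [s1] inserts the new side [b'] after [a'], and [s2] inserts [b] after [a]. *)
pose s1 := (tperm (inl a') (inr false) * ext (next X))%g.
pose s2 := (tperm (inl a) (inr true) * s1)%g.
have F0 : #|porbits s2| = #|porbits (next X)|.
  have h1 : (#|porbits s1| + 1)%N = #|porbits (ext (next X))|.
    by apply: card_porbits_tperm_fixed; rewrite ?permE.
  have h2 : (#|porbits s2| + 1)%N = #|porbits s1|.
    by apply: card_porbits_tperm_fixed => //; rewrite permM tpermD // permE.
  by move: h1 h2; rewrite card_porbits_ext; lia.
have FE : #|porbits (next Y)| = #|porbits s2|.
  apply: (card_porbits_conj bh) => -[d|[]]; rewrite !permM.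
  - rewrite nx; case: (eqVneq d a) => [->|nd].
      by rewrite tpermL tpermD // permE.
    rewrite (@tpermD _ (inl a)) //; last by rewrite eq_sym; apply: contra nd => /eqP [->].
    case: (eqVneq d a') => [->|nd']; first by rewrite tpermL permE.
    by rewrite tpermD ?permE //; rewrite eq_sym; apply: contra nd' => /eqP [->].
  - by rewrite tpermR tpermD ?permE //; rewrite eq_sym; apply: contra na => /eqP [->].
  - by rewrite (@tpermD _ (inl a)) // tpermR permE n2.
(* The two new sides are exchanged by the rotation around the new vertex. *)
pose w := (tperm (inr true) (inr false) * ext (vertex_perm X))%g.
have V0 : (#|porbits w| + 1)%N = (#|porbits (vertex_perm X)| + 2)%N.
  by rewrite -card_porbits_ext; apply: card_porbits_tperm_fixed; rewrite ?permE.
have VE : #|porbits (vertex_perm Y)| = #|porbits w|.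
  apply: (card_porbits_conj bh) => -[d|[]]; rewrite !vertex_permE permM.
  - rewrite tpermD // permE /= vertex_permE.
    case: (eqVneq d a) => [->|nd]; first by rewrite g1 n2.
    case: (eqVneq d a') => [->|nd']; first by rewrite ga' n1 gK.
    rewrite go // nx ifN; last by apply: contra nd' => /eqP e; rewrite /a' -e glueK.
    by rewrite ifN //; apply: contra nd => /eqP /perm_inj ->.
  - by rewrite tpermL permE g2 nx eqxx eq_sym (negbTE na).
  - by rewrite tpermR permE gb' nx eqxx.
by rewrite !euler_charE FE F0 VE; move: V0 eE eE' cE; clear; lia.
Qed.

(** One more edge and one more face, with as many vertices. *)
Lemma polygon_cut_euler X Y : polygon_cut X Y -> euler_char Y = euler_char X.
Proof.
move=> [h [a [b [bh [ne ab] [nx [n1 n2]] [go g1] _]]]].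
set e := h (inr true) in nx n1 n2 g1; set e' := h (inr false) in nx n1 n2 g1.
have cE : #|side Y| = (#|side X| + 2)%N.
  by rewrite -(bij_eq_card bh) card_sum card_bool.
have eE := card_edges X; have eE' := card_edges Y.
have g2 : glue Y e' = e by rewrite -g1 glueK.
have inl_neq (x y : side X) : x != y -> inl x != inl y :> side X + bool.
  by apply: contra => /eqP [->].
pose A := (next X)^-1%g a; pose B := (next X)^-1%g b.
have NA : next X A = a by rewrite permKV.
have NB : next X B = b by rewrite permKV.
have nAB : B != A by rewrite eq_sym (inj_eq perm_inj).
(* [s1] inserts [e'] before [b]. The transposition of [s2] splits the cycle in two, leaving [e']
   with [b], and [s3] inserts [e] in the other part, before [a]. *)
pose s1 := (tperm (inl B) (inr false) * ext (next X))%g.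
pose s2 := (tperm (inl B) (inl A) * s1)%g.
pose s3 := (tperm (inl B) (inr true) * s2)%g.
have s1E x : s1 (inl x) = if x == B then inr false else inl (next X x).
  rewrite permM; case: eqVneq => [->|nx']; first by rewrite tpermL permE.
  by rewrite tpermD ?permE // eq_sym; apply: inl_neq.
have s1e : s1 (inr false) = inl b by rewrite permM tpermR permE /= NB.
have F0 : #|porbits s3| = (#|porbits (next X)| + 1)%N.
  have h1 : (#|porbits s1| + 1)%N = #|porbits (ext (next X))|.
    by apply: card_porbits_tperm_fixed; rewrite ?permE.
  have mem : inl B \in porbit s1 (inl A).
    have cl x y : y \in porbit s1 x -> s1 y \in porbit s1 x.
      by rewrite -!eq_porbit_mem => /eqP <-; rewrite eq_porbit_mem -{1}[s1]expg1 mem_porbit.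
    have all i : inl (iter i (next X) A) \in porbit s1 (inl A).
      elim: i => [|i /cl IH]; first exact: porbit_id.
      move: IH; rewrite s1E /=; case: eqVneq => [->|//] /cl.
      by rewrite s1e NB.
    have /mem_porbit_iter [i eb] := ab.
    have -> : B = iter i (next X) A; last exact: all.
    by apply: (@perm_inj _ (next X)); rewrite NB -iterS iterSr NA.
  have h2 : #|porbits s2| = (#|porbits s1| + 1)%N.
    by have := porbits_mul_tperm s1 (inl B) (inl A); rewrite inl_neq // mem /= double0 addn0.
  have h3 : (#|porbits s3| + 1)%N = #|porbits s2|.
    by apply: card_porbits_tperm_fixed => //; rewrite !permM !tpermD // permE.
  by move: h1 h2 h3; rewrite card_porbits_ext; clear; lia.
have FE : #|porbits (next Y)| = #|porbits s3|.
  apply: (card_porbits_conj bh) => -[d|[]].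
  - rewrite nx (permM _ s2); case: (eqVneq (next X d) b) => [eb|nb].
      have -> : d = B by apply: (@perm_inj _ (next X)); rewrite NB.
      by rewrite tpermL (permM _ s1) tpermD // permM tpermD // permE.
    have dB : d != B by apply: contra nb => /eqP ->; rewrite NB.
    rewrite tpermD //; last by rewrite eq_sym inl_neq.
    rewrite (permM _ s1); case: (eqVneq (next X d) a) => [ea|na].
      have -> : d = A by apply: (@perm_inj _ (next X)); rewrite NA.
      by rewrite tpermR s1E eqxx.
    have dA : d != A by apply: contra na => /eqP ->; rewrite NA.
    by rewrite tpermD ?s1E ?(negbTE dB) // eq_sym inl_neq.
  - by rewrite n1 (permM _ s2) tpermR (permM _ s1) tpermL s1E eq_sym (negbTE nAB) NA.
  - by rewrite n2 (permM _ s2) tpermD // (permM _ s1) tpermD // s1e.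
pose V := vertex_perm X.
pose A' := V^-1%g a; pose B' := V^-1%g b.
have VA : V A' = a by rewrite permKV.
have VB : V B' = b by rewrite permKV.
have nAB' : B' != A' by rewrite eq_sym (inj_eq perm_inj).
(* The chord leaves both of its endpoints: [e'] is inserted in the rotation around the vertex of
   [a], and [e] in that around the vertex of [b]. *)
pose w1 := (tperm (inl A') (inr false) * ext V)%g.
pose w2 := (tperm (inl B') (inr true) * w1)%g.
have V0 : #|porbits w2| = #|porbits V|.
  have h1 : (#|porbits w1| + 1)%N = #|porbits (ext V)|.
    by apply: card_porbits_tperm_fixed; rewrite ?permE.
  have h2 : (#|porbits w2| + 1)%N = #|porbits w1|.
    by apply: card_porbits_tperm_fixed => //; rewrite permM tpermD // permE.
  by move: h1 h2; rewrite card_porbits_ext; lia.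
have VE : #|porbits (vertex_perm Y)| = #|porbits w2|.
  apply: (card_porbits_conj bh) => -[d|[]]; rewrite vertex_permE (permM _ w1).
  - rewrite go nx -vertex_permE -/V; case: (eqVneq (V d) b) => [eb|nb].
      have -> : d = B' by apply: (@perm_inj _ V); rewrite VB.
      by rewrite tpermL permM tpermD // permE.
    have dB : d != B' by apply: contra nb => /eqP ->; rewrite VB.
    rewrite tpermD //; last by rewrite eq_sym inl_neq.
    rewrite (permM _ (ext V)); case: (eqVneq (V d) a) => [ea|na].
      have -> : d = A' by apply: (@perm_inj _ V); rewrite VA.
      by rewrite tpermL permE.
    have dA : d != A' by apply: contra na => /eqP ->; rewrite VA.
    by rewrite tpermD //; [rewrite (permE (@ext_inj _ V))|rewrite eq_sym inl_neq].
  - by rewrite g1 n2 tpermR (permM _ (ext V)) tpermD ?permE /= ?VB // eq_sym inl_neq.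
  - by rewrite g2 n1 tpermD // (permM _ (ext V)) tpermR permE /= VA.
by rewrite !euler_charE FE F0 VE V0; move: eE eE' cE; rewrite -/V; clear; lia.
Qed.

Lemma cut_paste_euler X Y : cut_paste_equiv X Y -> euler_char Y = euler_char X.
Proof.
elim=> {X Y} [X Y|//|X Y _ ->//|X Y Z _ <- _ ->//].
by case; [apply: relabelling_euler|apply: edge_cut_euler|apply: polygon_cut_euler].
Qed.

End EulerCharacteristic.

(** * Square-tiled surfaces *)

Section Directions.
Variable R : realType.
Local Notation e1 := (e1 R).
Local Notation e2 := (e2 R).

Lemma e1E : (e1 0 0 = 1) * (e1 1 0 = 0).
Proof. by rewrite !mxE. Qed.

Lemma e2E : (e2 0 0 = 0) * (e2 1 0 = 1).
Proof. by rewrite !mxE. Qed.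

Lemma quarter_turnE (v : 'cV[R]_2) :
  (quarter_turn v 0 0 = - v 1 0) * (quarter_turn v 1 0 = v 0 0).
Proof. by rewrite !mxE /=; split; ring. Qed.

Lemma quarter_turn2 (v : 'cV[R]_2) : quarter_turn (quarter_turn v) = - v.
Proof. by apply: cV2_eq; rewrite !quarter_turnE mxE. Qed.

Lemma quarter_turnN (v : 'cV[R]_2) : quarter_turn (- v) = - quarter_turn v.
Proof. by apply: cV2_eq; rewrite [RHS]mxE !quarter_turnE !mxE. Qed.

Lemma quarter_turn_e1 : quarter_turn e1 = e2.
Proof. by apply: cV2_eq; rewrite !quarter_turnE !(e1E, e2E) ?oppr0. Qed.

Lemma quarter_turn_e2 : quarter_turn e2 = - e1.
Proof. by apply: cV2_eq; rewrite !quarter_turnE !mxE ?oppr0. Qed.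

Lemma e1_neq : [/\ - e1 != e1, e2 != e1 & - e2 != e1].
Proof.
by split; apply/eqP=> /(congr1 (fun v : 'cV[R]_2 => v 0 0)) /eqP; rewrite !mxE /= ?oppr0;
  apply/negP; rewrite ?eqNr ?oner_eq0 // eq_sym oner_eq0.
Qed.

Variables (T : Type) (vec : T -> 'cV[R]_2) (f : T -> T) (s : bool).
Hypothesis turn : forall d, vec (f d) = (-1) ^+ s *: quarter_turn (vec d).
Hypothesis axial : forall d, vec d \in [:: e1; e2; - e1; - e2].

Lemma vec_turn2 d : vec (f (f d)) = - vec d.
Proof.
rewrite !turn; case: (s); rewrite ?expr0 ?scale1r ?quarter_turn2 //.
by rewrite expr1 !scaleN1r quarter_turnN quarter_turn2 opprK.
Qed.

(** The sign [s] serves two uses: the sides of a square turn counterclockwise, those leaving a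
    vertex clockwise. *)
Lemma turns_to_e1 d : exists i, vec (iter i f d) = e1.
Proof.
have := axial d; rewrite !inE => /or4P[]/eqP hd.
- by exists 0%N.
- have h1 : vec (f d) = e1 \/ vec (f d) = - e1.
    by rewrite turn hd quarter_turn_e2; case: (s); [left|right];
      rewrite ?expr0 ?expr1 ?scale1r ?scaleN1r ?opprK.
  by case: h1 => h1; [exists 1%N|exists 3%N]; rewrite //= vec_turn2 h1 opprK.
- by exists 2%N; rewrite /= vec_turn2 hd opprK.
- have h1 : vec (f d) = e1 \/ vec (f d) = - e1.
    by rewrite turn hd quarter_turnN quarter_turn_e2 opprK; case: (s); [right|left];
      rewrite ?expr0 ?expr1 ?scale1r ?scaleN1r.
  by case: h1 => h1; [exists 1%N|exists 3%N]; rewrite //= vec_turn2 h1 opprK.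
Qed.

Lemma turns_dvd4 d i : vec d = e1 -> vec (iter i f d) = e1 -> (4 %| i)%N.
Proof.
have [n1 n2 n3] := e1_neq.
have h4 k d' : vec (iter (k * 4) f d') = vec d'.
  by elim: k => // k IH; rewrite mulSn iterD /= !vec_turn2 opprK.
move=> hd; rewrite (divn_eq i 4) iterD h4 dvdn_addr ?dvdn_mull //.
have := ltn_pmod i (isT : (0 < 4)%N); case: (i %% 4)%N => [|[|[|[|//]]]] //= _ /eqP.
- rewrite turn hd quarter_turn_e1; case: (s); rewrite ?expr0 ?expr1 ?scale1r ?scaleN1r.
    by rewrite (negbTE n3).
  by rewrite (negbTE n2).
- by rewrite vec_turn2 hd (negbTE n1).
- rewrite vec_turn2 turn hd quarter_turn_e1; case: (s); rewrite ?expr0 ?expr1 ?scale1r ?scaleN1r.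
    by rewrite opprK (negbTE n2).
  by rewrite (negbTE n3).
Qed.

End Directions.

(** * Monodromy of a square-tiled surface *)

Section Squares.
Variables (R : realType) (Q : translation_surface R).
Hypothesis hQ : made_of_unit_squares Q.
Local Notation N := (next Q).
Local Notation g := (glue Q).
Local Notation e1 := (e1 R).
Local Notation e2 := (e2 R).

Definition bottom_side := {d : side Q | vec Q d == e1}.
Local Notation E := bottom_side.

Lemma next4 d : N (N (N (N d))) = d.
Proof. by have := iter_nsides N d; have [-> _ _] := hQ d. Qed.

Lemma vec_next d : vec Q (N d) = quarter_turn (vec Q d).
Proof. by case: (hQ d). Qed.

Lemma axial_side d : vec Q d \in [:: e1; e2; - e1; - e2].
Proof. by case: (hQ d). Qed.

Lemma bottomP (e : E) : vec Q (val e) = e1.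
Proof. exact/eqP/(valP e). Qed.

Lemma right_subproof (e : E) : vec Q (N (g (N (val e)))) == e1.
Proof.
by rewrite vec_next vec_glue vec_next quarter_turnN quarter_turn2 opprK bottomP.
Qed.

Lemma above_subproof (e : E) : vec Q (g (N (N (val e)))) == e1.
Proof. by rewrite vec_glue !vec_next quarter_turn2 opprK bottomP. Qed.

Definition right_fun (e : E) : E := @exist _ (fun d => vec Q d == e1) _ (right_subproof e).
Definition above_fun (e : E) : E := @exist _ (fun d => vec Q d == e1) _ (above_subproof e).

Lemma right_inj : injective right_fun.
Proof. by move=> d e /(congr1 val) /= /perm_inj/perm_inj/perm_inj/val_inj. Qed.

Lemma above_inj : injective above_fun.
Proof. by move=> d e /(congr1 val) /= /perm_inj/perm_inj/perm_inj/val_inj. Qed.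

(* The squares to the right and above, a square being given by its bottom side. *)
Definition hperm : {perm E} := perm right_inj.
Definition vperm : {perm E} := perm above_inj.

Lemma hpermE e : val (hperm e) = N (g (N (val e))).
Proof. by rewrite permE. Qed.

Lemma vpermE e : val (vperm e) = g (N (N (val e))).
Proof. by rewrite permE. Qed.

Lemma hpermV e : val (hperm^-1 e)%g = N (N (N (g (N (N (N (val e))))))).
Proof.
by rewrite -{2}(permKV hperm e) hpermE next4 glueK next4.
Qed.

Lemma vpermV e : val (vperm^-1 e)%g = N (N (g (val e))).
Proof. by rewrite -{2}(permKV vperm e) vpermE glueK next4. Qed.

Lemma bottom_iter (d e : E) i : val e = iter i N (val d) -> e = d.
Proof.
move=> ei; have : (4 %| i)%N.
  apply: (@turns_dvd4 _ _ (vec Q) N false _ (val d)).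
  - by move=> d'; rewrite expr0 scale1r vec_next.
  - exact: bottomP.
  - by rewrite -ei bottomP.
move=> /dvdnP [k ek]; apply: val_inj; rewrite ei ek.
by elim: k {ek} => // k IH; rewrite mulSn iterD /= next4.
Qed.

(** This is connectedness: gluing leads from a square to one of its four neighbours, and closure
    under inverses is automatic for permutations of a finite set. *)
Lemma squares_transitive (P : E -> Prop) : (exists x, P x) ->
  (forall x, P x -> P (hperm x) /\ P (vperm x)) -> forall x, P x.
Proof.
move=> [x0 P0] cl.
have hV := perm_closedV (fun x px => (cl x px).1).
have vV := perm_closedV (fun x px => (cl x px).2).
pose S d := exists2 e, P e & val e \in porbit N d.
have SN d : S (N d) <-> S d.
  rewrite /S -[N d]/((iter 1 N) d) -permX porbit_perm //.
have Sg d : S d -> S (g d).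
  move=> [e pe]; rewrite porbit_sym => /porbitP [i ->].
  have it k : iter (k * 4) N (val e) = val e.
    by elim: k => // k IH; rewrite mulSn iterD /= next4.
  rewrite permX (divn_eq i 4) addnC iterD it.
  have := ltn_pmod i (isT : (0 < 4)%N); case: (i %% 4)%N => [|[|[|[|//]]]] //= _.
  - by exists (vperm^-1 e)%g; [apply: vV|apply/mem_porbit_iter; exists 2%N; rewrite vpermV].
  - exists (hperm e); first by case: (cl e pe).
    by apply/mem_porbit_iter; exists 1%N; rewrite hpermE.
  - exists (vperm e); first by case: (cl e pe).
    by apply/mem_porbit_iter; exists 0%N; rewrite vpermE.
  - by exists (hperm^-1 e)%g; [apply: hV|apply/mem_porbit_iter; exists 3%N; rewrite hpermV].
have [d0 con] := connectedP Q.
have S0 d : S d <-> S d0.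
  have /connectP [p hp ->] := con d.
  elim: p d0 {con} hp => //= d1 p IH d0 /andP[hd hp].
  apply: iff_trans (IH d1 hp) _.
  case/orP: hd => /eqP ->; first exact: SN.
  by split=> [/Sg|/Sg //]; rewrite glueK.
move=> x; have [e pe] : S (val x).
  by apply/S0/(S0 (val x0)); exists x0; rewrite ?porbit_id.
by move=> /mem_porbit_iter [i /bottom_iter <-].
Qed.

Local Notation w := (vertex_perm Q).
Local Notation c := [~ hperm, vperm]%g.

(** Four quarter turns around a corner lead through four squares, along the path spelled by the
    commutator. *)
Lemma vertex_perm4 e : val (c^-1%g e) = w (w (w (w (val e)))).
Proof.
rewrite !vertex_permE invg_comm /commg /conjg !permM.
by rewrite hpermE vpermE hpermV next4 vpermV !next4.
Qed.

(** Around each vertex exactly every fourth side is a bottom side, so the cycles of the rotation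
    correspond to those of its fourth power on bottom sides. *)
Lemma card_vertices : #|porbits w| = #|porbits c|.
Proof.
have -> : porbits c = porbits c^-1%g.
  by apply: eq_imset => x; rewrite porbitV.
apply: (card_porbits_transfer (f := val)).
- move=> d; have [||i hi] := @turns_to_e1 _ _ (vec Q) w true _ _ d.
  + by move=> x; rewrite vertex_permE vec_next vec_glue quarter_turnN expr1 scaleN1r.
  + exact: axial_side.
  + exists (@exist _ (fun d => vec Q d == e1) _ (introT eqP hi)); rewrite porbit_sym; apply/mem_porbit_iter.
    by exists i.
- move=> x y; apply/mem_porbit_iter/mem_porbit_iter => -[i ei].
    have : (4 %| i)%N.
      apply: (@turns_dvd4 _ _ (vec Q) w true _ (val x)).
      * by move=> d; rewrite vertex_permE vec_next vec_glue quarter_turnN expr1 scaleN1r.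
      * exact: bottomP.
      * by rewrite -ei bottomP.
    move=> /dvdnP [k ek]; exists k; apply: val_inj; rewrite ei ek.
    by elim: k {ek ei} => // k IH; rewrite mulSn iterD /= vertex_perm4 IH.
  exists (i * 4)%N; rewrite ei.
  by elim: i {ei} => // i IH; rewrite mulSn iterD /= vertex_perm4 IH.
Qed.

Lemma card_squares : (#|porbits N| * 4)%N = #|side Q| /\ #|porbits N| = #|{: E}|.
Proof.
split.
  have c4 O : O \in porbits N -> #|O| = 4%N by move=> /imsetP [d _ ->]; case: (hQ d).
  by rewrite -cardsT (card_uniform_partition c4 (partition_porbits N)).
have <- : #|[set porbit N (val e) | e in [set: E]]| = #|{: E}|.
  rewrite -[RHS]cardsT; apply: card_in_imset => e e' _ _ /eqP.
  by rewrite eq_porbit_mem porbit_sym => /mem_porbit_iter [i /bottom_iter].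
congr #|pred_of_set _|; apply/setP=> O; apply/imsetP/imsetP => [[d _ ->]|[e _ ->]]; last by exists (val e).
have [||i hi] := @turns_to_e1 _ _ (vec Q) N false _ _ d.
- by move=> x; rewrite expr0 scale1r vec_next.
- exact: axial_side.
exists (@exist _ (fun d => vec Q d == e1) _ (introT eqP hi)); rewrite ?inE //=.
by apply/eqP; rewrite eq_porbit_mem porbit_sym; apply/mem_porbit_iter; exists i.
Qed.

(** There are twice as many edges as squares, so an Euler characteristic of -2 leaves two vertices
    fewer than squares. *)
Lemma genus2_squares : has_genus Q 2 -> (#|porbits c| + 2)%N = #|{: E}|.
Proof.
have [c1 c2] := card_squares; have c3 := card_edges Q.
rewrite /has_genus euler_charE card_vertices.
by move: c1 c2 c3; clear; lia.
Qed.

End Squares.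

Lemma reb_lt (R : realType) (X : translation_surface R) (x y : pt X) : reb x y ->
  exists2 k, (k < nsides (next X) x.1)%N & y = iter k (@rebase R X) x.
Proof.
move=> [k ->]; exists (k %% nsides (next X) x.1)%N; first by rewrite ltn_mod nsides_gt0.
rewrite {1}(divn_eq k (nsides (next X) x.1)) addnC iterD; congr iter.
by elim: (k %/ _)%N => // j IH; rewrite mulSn addnC iterD iter_rebase_nsides.
Qed.

Section Linear.
Variables (R : realType) (A : 'M[R]_2) (hA : \det A = 1) (X : translation_surface R).
Local Notation AX := (act hA X).

Lemma act_corner d k : scorner AX d k = A *m scorner X d k.
Proof. by rewrite /corner mulmx_sumr. Qed.

Lemma act_injective : injective (mulmx A : 'cV[R]_2 -> 'cV[R]_2).
Proof.
have uA : A \in unitmx by rewrite unitmxE hA unitr1.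
by move=> p q /(congr1 (mulmx (invmx A))); rewrite !mulKmx.
Qed.

Lemma act_onb d p : sonb AX d (A *m p) <-> sonb X d p.
Proof.
have seg a b z : on_seg (A *m a) (A *m b) (A *m z) <-> on_seg a b z.
  split=> -[s hs e]; exists s => //.
    by apply: act_injective; rewrite e mulmxDr -scalemxAr mulmxBr.
  by rewrite e mulmxDr -scalemxAr mulmxBr.
by split=> -[i hi h]; exists i => //; move: h; rewrite !act_corner; apply: (seg _ _ _).1 || apply: (seg _ _ _).2.
Qed.

Let actp (x : pt X) : pt AX := (x.1, A *m x.2).

Lemma act_tr K u t x y : tr K u t x y -> tr K (A *m u) t (actp x) (actp y).
Proof.
have lin p s v : A *m (p + s *: v) = A *m p + s *: (A *m v) by rewrite mulmxDr -scalemxAr.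
elim=> {t x y} [x|t x y _ IH|t x d p s _ IH ks s0 fr|t x d p s r c _ IH ks [h1 h2 h3 h4 h5]].
- exact: tr_nil.
- have -> : actp (rebase y) = rebase (actp y) by rewrite /actp /rebase /= mulmxBr.
  exact: tr_rebase.
- rewrite /actp /= lin; apply: tr_free => // r hr; rewrite -lin => /act_onb.
  exact: fr.
- rewrite /actp /= mulmxBr lin; apply: (tr_cross (X := AX) (r := r) (c := c)) => //; split=> //.
  + by rewrite -lin h3 -scalemxAr.
  + by move=> r' hr'; rewrite -lin => /act_onb; apply: h4.
  + by move=> r' hr'; rewrite -lin -mulmxBr => /act_onb; apply: h5.
Qed.

End Linear.

(** The winding number is constant up to the first boundary point, and there the side is crossed
    from left to right. A point is thus shown to be inside without computing its winding number. *)
Lemma exits_good (R : realType) (K : R -> Prop) (hK : dense_subring K)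
  (X : translation_surface R) d p u r c : over K X -> Kvec K u -> generic K p ->
  0 < r -> 0 < c < 1 -> p + r *: u = c *: vec X d -> det2 (vec X d) u < 0 ->
  (forall r', 0 <= r' < r -> ~ sonb X d (p + r' *: u)) -> swind X d p = 1.
Proof.
move=> oX hu gp r0 hc e dn bef.
have [eps eps0 [_ hw]] := crossing_wind hK oX gp hu hc e.
pose m := Num.min eps r.
have m0 : 0 < m by rewrite lt_min eps0 r0.
have me : m <= eps by rewrite ge_min lexx.
have mr : m <= r by rewrite ge_min lexx orbT.
have lt1 : r - m < r by rewrite gtrBl.
have [t k /andP[h1 h2]] := dense_between hK lt1.
have := hw t k; rewrite (lt_eqF h2) h2 dn /= => hwt.
have <- : swind X d (p + t *: u) = 1.
  by rewrite hwt // ler_norml; lra.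
apply/esym; apply: (wind_free (@polygonP _ X)); first lra.
by move=> r' hr'; apply: bef; lra.
Qed.

(** * Trajectories on a square-tiled surface *)

Section SquareTrajectories.
Variables (R : realType) (Q : translation_surface R).
Hypothesis hQ : made_of_unit_squares Q.
Local Notation N := (next Q).
Local Notation g := (glue Q).
Local Notation e1 := (e1 R).
Local Notation e2 := (e2 R).
Local Notation E := (bottom_side Q).
Local Notation h := (hperm hQ).
Local Notation v := (vperm hQ).
Local Notation x_ p := (p 0 0).
Local Notation y_ p := (p 1 0).
Implicit Types (e : E) (p q u : 'cV[R]_2).

Lemma square_sides e :
  [/\ vec Q (val e) = e1, vec Q (N (val e)) = e2, vec Q (N (N (val e))) = - e1 &
      vec Q (N (N (N (val e)))) = - e2].
Proof.
rewrite !(vec_next hQ) (bottomP e) quarter_turn2 quarter_turn_e1.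
by rewrite quarter_turnN quarter_turn_e1.
Qed.

Lemma square_corners e :
  [/\ scorner Q (val e) 0 = 0, scorner Q (val e) 1 = e1, scorner Q (val e) 2 = e1 + e2,
      scorner Q (val e) 3 = e2 & scorner Q (val e) 4 = 0].
Proof.
have [s0 s1 s2 s3] := square_sides e.
rewrite !cornerS corner0 /side_vec /= s0 s1 s2 s3 !add0r.
have -> : e1 + e2 - e1 = e2 by rewrite addrC addKr.
by rewrite subrr.
Qed.

Definition interior p : Prop := 0 < x_ p < 1 /\ 0 < y_ p < 1.

Lemma interior_off e p : interior p -> ~ sonb Q (val e) p.
Proof.
have [c0 c1 c2 c3 c4] := square_corners e.
move=> [hx hy] [i]; have [-> _ _] := hQ (val e).
case: i => [|[|[|[|//]]]] _; rewrite ?c0 ?c1 ?c2 ?c3 ?c4 => -[s hs ep];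
  move: hx hy; rewrite ep !mxE /=; clear ep c0 c1 c2 c3 c4; lra.
Qed.

Section Deterministic.
Variable K : R -> Prop.
Hypothesis hK : dense_subring K.

Lemma Kvec_e1 : Kvec K e1.
Proof. by split; rewrite e1E; [apply: dense1|apply: dense0]. Qed.

Lemma Kvec_e2 : Kvec K e2.
Proof. by split; rewrite e2E; [apply: dense0|apply: dense1]. Qed.

Lemma over_squares : over K Q.
Proof.
move=> d; have := axial_side hQ d; have k1 := Kvec_e1; have k2 := Kvec_e2.
by rewrite !inE => /or4P[]/eqP -> //; apply: (KvecN hK).
Qed.

Lemma generic_neq p (a : R) : K a -> generic K p -> x_ p != a /\ y_ p != a.
Proof.
move=> ka gp; have k0 := dense0 hK; have k1 := dense1 hK; split; apply/eqP=> e.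
  have [] := gp 1 0 a k1 k0 ka; first by rewrite e; ring.
  by move=> /eqP; rewrite oner_eq0.
have [] := gp 0 1 a k0 k1 ka; first by rewrite e; ring.
by move=> _ /eqP; rewrite oner_eq0.
Qed.

Lemma good_interior e p : good K ((val e, p) : pt Q) -> interior p.
Proof.
have [c0 c1 c2 c3 c4] := square_corners e.
move=> [/= w gp]; have [x0 y0] := generic_neq (dense0 hK) gp.
have [x1 y1] := generic_neq (dense1 hK) gp.
move: w; rewrite /wind; have [-> _ _] := hQ (val e).
rewrite !big_ord_recl big_ord0 /= c0 c1 c2 c3 c4 /lam !orientE !mxE /=.
rewrite /interior.
move: (x_ p) (y_ p) x0 y0 x1 y1 => x y x0 y0 x1 y1.
rewrite !(oppr0, subr0, addr0, add0r, sub0r, mul0r, mulr0, mul1r, subrr).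
rewrite !mulN1r !opprK !oppr_lt0 !oppr_gt0 !subr_gt0 !subr_lt0.
case: (ltrgtP y 0) y0 => // y0 _; case: (ltrgtP y 1) y1 => // y1 _ /=.
- by move: (lt_trans (lt_trans y1 y0) ltr01); rewrite ltxx.
- case: (ltrgtP x 1) x1 => // x1 _; case: (ltrgtP x 0) x0 => // x0 _ //.
Qed.

(** From an interior point, a direction with nonnegative coordinates can reach neither the bottom
    nor the left side. *)
Lemma square_exit u e q d p s r c : interior q -> 0 <= x_ u -> 0 <= y_ u ->
  @reb _ Q (val e, q) (d, p) -> crossing u d p s r c ->
  [/\ x_ q + r * x_ u = 1, 0 < y_ q + r * y_ u < 1 &
      reb (g d, p + s *: u - vec Q d) (val (h e), q + s *: u - e1)] \/
  [/\ y_ q + r * y_ u = 1, 0 < x_ q + r * x_ u < 1 &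
      reb (g d, p + s *: u - vec Q d) (val (v e), q + s *: u - e2)].
Proof.
have [c0 c1 c2 c3 _] := square_corners e; have [s0 s1 s2 s3] := square_sides e.
move=> [/andP[qx _] /andP[qy _]] ux uy /reb_lt [k]; have [-> _ _] := hQ (val e).
move=> k4; rewrite iter_rebase => -[-> ->] [/andP[r0 _] /andP[c0' c1'] hit _ _].
have hx := congr1 (fun z : 'cV[R]_2 => x_ z) hit.
have hy := congr1 (fun z : 'cV[R]_2 => y_ z) hit.
have rux : 0 <= r * x_ u by rewrite mulr_ge0 // ltW.
have ruy : 0 <= r * y_ u by rewrite mulr_ge0 // ltW.
case: k k4 hx hy {hit} => [|[|[|[|//]]]] _ /=;
  rewrite ?c0 ?c1 ?c2 ?c3 ?s0 ?s1 ?s2 ?s3 !mxE /= => hx hy.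
- by exfalso; clear c0 c1 c2 c3 s0 s1 s2 s3; lra.
- left; split; [clear c0 c1 c2 c3 s0 s1 s2 s3; lra|clear c0 c1 c2 c3 s0 s1 s2 s3; lra|].
  exists 1%N; rewrite /rebase /= hpermE vec_glue s1; congr (_, _).
  by apply: cV2_eq; rewrite !mxE; ring.
- right; split; [clear c0 c1 c2 c3 s0 s1 s2 s3; lra|clear c0 c1 c2 c3 s0 s1 s2 s3; lra|].
  exists 0%N; rewrite /= vpermE; congr (_, _).
  by apply: cV2_eq; rewrite !mxE; ring.
- by exfalso; clear c0 c1 c2 c3 s0 s1 s2 s3; lra.
Qed.

(* [W k l e'] says that [e'] can be reached from the first square by [k] moves
   to the right and [l] moves up. *)
Lemma tr_squares (W : nat -> nat -> E -> Prop) u e p t y :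
  Kvec K u -> 0 <= x_ u -> 0 <= y_ u -> W 0%N 0%N e ->
  (forall k l e' t', W k l e' -> x_ p + t' * x_ u = k.+1%:R ->
     l%:R < y_ p + t' * y_ u < l.+1%:R -> W k.+1 l (h e')) ->
  (forall k l e' t', W k l e' -> y_ p + t' * y_ u = l.+1%:R ->
     k%:R < x_ p + t' * x_ u < k.+1%:R -> W k l.+1 (v e')) ->
  good K ((val e, p) : pt Q) -> tr K u t ((val e, p) : pt Q) y ->
  exists k l e', [/\ W k l e', k%:R < x_ p + t * x_ u < k.+1%:R,
    l%:R < y_ p + t * y_ u < l.+1%:R &
    reb y (val e', p + t *: u - (k%:R *: e1 + l%:R *: e2))].
Proof.
move=> hu ux uy W0 Wr Wu gp htr.
suff [k [l [e' [We' rb]]]] : exists k l e', W k l e' /\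
    reb y (val e', p + t *: u - (k%:R *: e1 + l%:R *: e2)).
  (* The endpoint is good, hence interior to its square, which gives the bounds on [k] and [l]. *)
  exists k, l, e'; have gy := tr_good hK over_squares hu htr gp.
  have /good_interior [] := good_reb hK over_squares rb gy.
  rewrite !mxE /= -(natr1 k) -(natr1 l) => hx hy.
  split=> //; clear rb gy; lra.
have [x0 ex0] : exists x0 : pt Q, x0 = (val e, p) by exists (val e, p).
move: htr gp; rewrite -{1}ex0 => htr gp.
elim: htr ex0 gp => {t x0 y} [x|t x y _ IH|t x d q s tr1 IH ks s0 fr|t x d q s r c tr1 IH ks cr] ex gp.
- rewrite ex; exists 0%N, 0%N, e; split=> //; rewrite scale0r !scale0r !addr0 subr0; exact: reb_refl.
- have [k [l [e' [We' rb]]]] := IH ex gp; exists k, l, e'; split=> //.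
  exact: reb_trans (reb_sym (reb_rebase y)) rb.
- have [k [l [e' [We' rb]]]] := IH ex gp; exists k, l, e'; split=> //.
  rewrite scalerDl addrA [_ + s *: u - _]addrAC; exact: reb_shift.
- have [k [l [e' [We' rb]]]] := IH ex gp.
  have gd : good K ((d, q) : pt Q) by apply: (tr_good hK over_squares hu tr1); rewrite ex.
  have int := good_interior (good_reb hK over_squares rb gd).
  have [rs _ _ _ _] := cr.
  case: (square_exit int ux uy (reb_sym rb) cr) => -[]; rewrite !mxE /= => hx hy rb'.
  + exists k.+1, l, (h e'); split.
      apply: (Wr k l e' (t + r) We'); rewrite -natr1 ?mulrDl.
        by clear rb gd int rb' ex cr; lra.
      by clear rb gd int rb' ex cr; lra.
    move: rb'; congr (reb _ (_, _)); apply: cV2_eq; rewrite !mxE -natr1 /=; ring.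
  + exists k, l.+1, (v e'); split.
      apply: (Wu k l e' (t + r) We'); rewrite -natr1 ?mulrDl.
        by clear rb gd int rb' ex cr; lra.
      by clear rb gd int rb' ex cr; lra.
    move: rb'; congr (reb _ (_, _)); apply: cV2_eq; rewrite !mxE -natr1 /=; ring.
Qed.

Lemma tr_square_e1 e p y : good K ((val e, p) : pt Q) ->
  tr K e1 1 ((val e, p) : pt Q) y -> reb y (val (h e), p).
Proof.
move=> gp htr; have [/andP[px0 px1] /andP[py0 py1]] := good_interior gp.
have [|||k l e' t'|k l e' t'|k [l [e' []]]] :=
    tr_squares (W := fun k l e' => l = 0%N /\ e' = iter k h e) Kvec_e1 _ _ _ _ _ gp htr;
  rewrite ?e1E ?mulr1 ?mulr0 ?addr0 ?ler01 //.
- by move=> [-> ->].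
- by move=> [-> _] py; move: py1; rewrite py ltxx.
move=> [-> ->] /andP[k1 k2] _.
have -> : k = 1%N.
  have : (k < 2)%N by rewrite -(ltr_nat R) (lt_trans k1) // -natr1 ltrD2r.
  have : (1 < k.+1)%N by rewrite -(ltr_nat R) (lt_trans _ k2) // ltrDr.
  by move: k1 k2 => _ _; clear; lia.
by rewrite !scale1r scale0r addr0 addrK.
Qed.

Lemma tr_square_e2 e p y : good K ((val e, p) : pt Q) ->
  tr K e2 1 ((val e, p) : pt Q) y -> reb y (val (v e), p).
Proof.
move=> gp htr; have [/andP[px0 px1] /andP[py0 py1]] := good_interior gp.
have [|||k l e' t'|k l e' t'|k [l [e' []]]] :=
    tr_squares (W := fun k l e' => k = 0%N /\ e' = iter l v e) Kvec_e2 _ _ _ _ _ gp htr;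
  rewrite ?e2E ?mulr1 ?mulr0 ?addr0 ?ler01 //.
- by move=> [-> _] px; move: px1; rewrite px ltxx.
- by move=> [-> ->].
move=> [-> ->] _ /andP[k1 k2].
have -> : l = 1%N.
  have : (l < 2)%N by rewrite -(ltr_nat R) (lt_trans k1) // -natr1 ltrD2r.
  have : (1 < l.+1)%N by rewrite -(ltr_nat R) (lt_trans _ k2) // ltrDr.
  by move: k1 k2 => _ _; clear; lia.
by rewrite !scale1r scale0r add0r addrK.
Qed.

Lemma tr_square_diagonal e p y : good K ((val e, p) : pt Q) ->
  tr K (e1 + e2) 1 ((val e, p) : pt Q) y ->
  reb y (val (if x_ p < y_ p then h (v e) else v (h e)), p).
Proof.
move=> gp htr; have [/andP[px0 px1] /andP[py0 py1]] := good_interior gp.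
have hu : Kvec K (e1 + e2) by apply: (KvecD hK); [apply: Kvec_e1|apply: Kvec_e2].
(* Until the cell (1, 1) the square is determined by the cell and by the side met first. Beyond it
   nothing is recorded, since the trajectory ends in that cell. *)
pose W k l e' := [\/ [/\ k = 0%N, l = 0%N & e' = e],
  [/\ k = 1%N, l = 0%N, e' = h e & y_ p < x_ p],
  [/\ k = 0%N, l = 1%N, e' = v e & x_ p < y_ p] |
  ((0 < k) && (0 < l))%N /\
    (k = 1%N -> l = 1%N -> e' = if x_ p < y_ p then h (v e) else v (h e))].
have ux : x_ (e1 + e2) = 1 by rewrite !mxE /= addr0.
have uy : y_ (e1 + e2) = 1 by rewrite !mxE /= add0r.
have [|||k l e' t'|k l e' t'|k [l [e' []]]] := tr_squares (W := W) hu _ _ _ _ _ gp htr;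
  rewrite ?ux ?uy ?mulr1 ?ler01 //.
- by apply: Or41.
- move=> [[-> -> ->]|[-> -> _ _]|[-> -> -> hxy]|[hkl _]] ex /andP[ey0 ey1].
  + apply: Or42; split=> //; move: ey1; rewrite -ex ltrD2r //.
  + by exfalso; lra.
  + apply: Or44; split=> // _ _; by rewrite hxy.
  + apply: Or44; split; first by move: hkl; clear; lia.
    by move=> [k0]; move: hkl; rewrite k0.
- move=> [[-> -> ->]|[-> -> -> hxy]|[-> -> _ _]|[hkl _]] ey /andP[ex0 ex1].
  + apply: Or43; split=> //; move: ex1; rewrite -ey ltrD2r //.
  + by apply: Or44; split=> // _ _; rewrite (lt_gtF hxy).
  + by exfalso; lra.
  + apply: Or44; split; first by move: hkl; clear; lia.
    by move=> _ [l0]; move: hkl; rewrite l0 andbF.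
move=> We' /andP[k1 k2] /andP[l1 l2].
have ek : k = 1%N.
  have : (k < 2)%N by rewrite -(ltr_nat R) (lt_trans k1) // -natr1 ltrD2r.
  have : (1 < k.+1)%N by rewrite -(ltr_nat R) (lt_trans _ k2) // ltrDr.
  by clear; lia.
have el : l = 1%N.
  have : (l < 2)%N by rewrite -(ltr_nat R) (lt_trans l1) // -natr1 ltrD2r.
  have : (1 < l.+1)%N by rewrite -(ltr_nat R) (lt_trans _ l2) // ltrDr.
  by clear; lia.
move: We'; rewrite ek el => -[[]|[]|[]|[_ ->]] //.
by rewrite !scale1r addrK.
Qed.

End Deterministic.

Lemma interior_right r e p : interior p -> 0 <= r <= 1 -> 1 - x_ p <> r ->
  r < 1 - x_ p /\ ~ sonb Q (N (val e)) (p + r *: e1 - e1) \/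
  1 - x_ p < r /\ ~ sonb Q (g (N (val e))) (p + r *: e1 - e1 - e2).
Proof.
move=> [hx hy] hr ne; have [_ s1 _ _] := square_sides e.
case: (ltrgtP r (1 - x_ p)) => [lr|lr|er]; [left|right|by case: ne]; split=> //.
  have := reb_onb (reb_rebase ((val e, p + r *: e1) : pt Q)).
  rewrite /= bottomP => ->; apply: interior_off; rewrite /interior !mxE /=; clear s1; lra.
have := reb_onb (reb_rebase ((g (N (val e)), p + r *: e1 - e1 - e2) : pt Q)).
rewrite /= vec_glue s1 opprK subrK -hpermE => <-; apply: interior_off.
rewrite /interior !mxE /=; clear s1; lra.
Qed.

(** The existence counterpart of [tr_square_e1]. Its image under a linear map is the trajectory that
    will be carried back to [Q]. *)
Lemma tr_right K e p : dense_subring K -> interior p ->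
  tr K e1 1 ((val e, p) : pt Q) (val (h e), p).
Proof.
move=> hK hp; have [_ s1 _ _] := square_sides e.
have rb0 : @reb _ Q (val e, p) (N (val e), p - e1).
  by exists 1%N; rewrite /rebase /= bottomP.
apply: tr_rebl rb0 _.
have -> : ((val (h e), p) : pt Q) = rebase (g (N (val e)), p - e1 + 1 *: e1 - e2).
  by rewrite /rebase /= vec_glue s1 hpermE scale1r !subrK opprK subrK.
apply: tr_rebase; rewrite -s1.
case: (hp) => hx hy.
apply: (tr_cross1 (r := 1 - x_ p) (c := y_ p)); first exact: dense1.
split=> //; first by clear s1; lra.
- by rewrite s1; apply: cV2_eq; rewrite !mxE /=; ring.
- move=> r hr; have ne : 1 - x_ p <> r by move=> er; clear s1; lra.
  rewrite addrAC; have [|[//]|[]] := interior_right e hp _ ne; clear s1; lra.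
- move=> r hr; have ne : 1 - x_ p <> r by move=> er; clear s1; lra.
  rewrite [p - e1 + _]addrAC s1; have [|[]|[//]] := interior_right e hp _ ne; clear s1; lra.
Qed.

Lemma interior_above r e p : interior p -> 0 <= r <= 1 -> 1 - y_ p <> r ->
  r < 1 - y_ p /\ ~ sonb Q (N (N (val e))) (p + r *: e2 - e1 - e2) \/
  1 - y_ p < r /\ ~ sonb Q (g (N (N (val e)))) (p + r *: e2 - e2).
Proof.
move=> [hx hy] hr ne; have [s0 s1 _ _] := square_sides e.
case: (ltrgtP r (1 - y_ p)) => [lr|lr|er]; [left|right|by case: ne]; split=> //.
  have : @reb _ Q (val e, p + r *: e2) (N (N (val e)), p + r *: e2 - e1 - e2).
    by exists 2%N; rewrite /rebase /= s0 s1.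
  move=> /reb_onb /= ->; apply: interior_off; rewrite /interior !mxE /=; clear s0 s1; lra.
rewrite -(vpermE hQ); apply: interior_off.
rewrite /interior !mxE /=; clear s0 s1; lra.
Qed.

Lemma tr_above K e p : dense_subring K -> interior p ->
  tr K e2 1 ((val e, p) : pt Q) (val (v e), p).
Proof.
move=> hK hp; have [s0 s1 s2 _] := square_sides e.
have rb0 : @reb _ Q (val e, p) (N (N (val e)), p - e1 - e2).
  by exists 2%N; rewrite /rebase /= s0 s1.
apply: tr_rebl rb0 _.
have -> : ((val (v e), p) : pt Q) = (g (N (N (val e))), p - e1 - e2 + 1 *: e2 - vec Q (N (N (val e)))).
  by rewrite s2 vpermE scale1r opprK !subrK.
case: (hp) => hx hy.
apply: (tr_cross1 (r := 1 - y_ p) (c := 1 - x_ p)); first exact: dense1.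
split; first by clear s0 s1 s2; lra.
- by clear s0 s1 s2; lra.
- by rewrite s2; apply: cV2_eq; rewrite !mxE /=; ring.
- move=> r hr; have ne : 1 - y_ p <> r by move=> er; clear s0 s1 s2; lra.
  have -> : p - e1 - e2 + r *: e2 = p + r *: e2 - e1 - e2 by rewrite addrAC [p - e1 + _]addrAC.
  have [|[//]|[]] := interior_above e hp _ ne; clear s0 s1 s2; lra.
- move=> r hr; have ne : 1 - y_ p <> r by move=> er; clear s0 s1 s2; lra.
  have -> : p - e1 - e2 + r *: e2 - vec Q (N (N (val e))) = p + r *: e2 - e2.
    by rewrite s2; apply: cV2_eq; rewrite !mxE /=; ring.
  have [|[]|[//]] := interior_above e hp _ ne; clear s0 s1 s2; lra.
Qed.

End SquareTrajectories.

(** * Existence of generic points *)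

Section UncountableInterval.
Import classical_sets set_interval cardinality constructive_ereal ereal measure lebesgue_measure.
Local Open Scope classical_set_scope.

(** The unit interval has Lebesgue measure 1, whereas a countable set is null. *)
Lemma avoid_countable (R : realType) (T : countType) (f : T -> R) :
  exists2 x : R, 0 < x < 1 & forall t, x <> f t.
Proof.
apply/not_exists2P => H.
pose A := [set` (`]0, 1[%R : interval R)].
have sub : A `<=` range f.
  move=> x hx; have {}hx : 0 < x < 1 by move: hx; rewrite /A set_itvE.
  have [//|/existsNP [t /contrapT ->]] := H x.
  by exists t.
have cA : countable A.
  apply: sub_countable (subset_card_le sub) _.
  exact: sub_countable (card_image_le f setT) (countableP _).
have /= := countable_lebesgue_measure0 cA.
rewrite /A lebesgue_measure_itv /= lte_fin ltr01 sube0 => /eqP.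
by rewrite eqe oner_eq0.
Qed.

End UncountableInterval.

Section Generated.
Variables (R : realType) (F : seq R).

(** Syntax trees for the ring generated by [F] and the rationals. The trees form a countable type,
    so the ring is countable; the rationals make it dense. *)
Fixpoint eval (t : GenTree.tree (rat + nat)) : R :=
  match t with
  | GenTree.Leaf (inl q) => ratr q
  | GenTree.Leaf (inr n) => nth 0 F n
  | GenTree.Node 0 [:: a; b] => eval a - eval b
  | GenTree.Node _ [:: a; b] => eval a * eval b
  | _ => 0
  end.

Definition generated (x : R) : Prop := exists t, eval t = x.

Lemma generated_dense : dense_subring generated.
Proof.
split.
- by exists (GenTree.Leaf (inl 1)); rewrite /= rmorph1.
- by move=> _ _ [a <-] [b <-]; exists (GenTree.Node 0 [:: a; b]).
- by move=> _ _ [a <-] [b <-]; exists (GenTree.Node 1 [:: a; b]).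
- move=> a b /rat_in_itvoo [q]; rewrite in_itv /= => hq; exists (ratr q) => //.
  by exists (GenTree.Leaf (inl q)).
Qed.

Lemma generated_mem x : x \in F -> generated x.
Proof. by move=> hx; exists (GenTree.Leaf (inr (index x F))); rewrite /= nth_index. Qed.

(** The first coordinate avoids all quotients of elements of the ring, and the second all solutions
    of linear equations in which the first appears with coefficients from the ring. *)
Lemma generic_point : exists2 p : 'cV[R]_2, interior p & generic generated p.
Proof.
have [x hx nx] := avoid_countable (fun t => eval t.1 / eval t.2).
have [y hy ny] := avoid_countable (fun t => (eval t.1 - eval t.2.1 * x) / eval t.2.2).
exists (\col_i (if i == 0 then x else y)); first by rewrite /interior !mxE.
move=> _ _ _ [t1 <-] [t2 <-] [t3 <-]; rewrite !mxE /= => e.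
have k2 : eval t2 = 0.
  apply: contra_notP (ny (t3, (t1, t2))) => /eqP n2 /=.
  by rewrite -e addrAC subrr add0r mulrC mulKf.
split=> //; apply: contra_notP (nx (t3, t1)) => /eqP n1 /=.
by rewrite -e k2 mul0r addr0 mulrC mulKf.
Qed.

End Generated.

(** The image of [f] is stable under [a] and [b], hence under [h] and [v]. By transitivity [f] is
    onto, and finiteness makes it a permutation. *)
Lemma intertwiner_perm (T : finType) (h v a b : {perm T}) (f : T -> T) :
  (forall P : T -> Prop, (exists x, P x) -> (forall x, P x -> P (h x) /\ P (v x)) ->
    forall x, P x) ->
  (forall P : T -> Prop, (forall x, P x -> P (a x) /\ P (b x)) ->
    forall x, P x -> P (h x) /\ P (v x)) ->
  (forall x, f (h x) = a (f x)) -> (forall x, f (v x) = b (f x)) ->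
  exists psi : {perm T}, (h ^ psi = a /\ v ^ psi = b)%g.
Proof.
move=> trans gen fh fv.
have onto y : exists x, f x = y.
  apply: (trans (fun y => exists x, f x = y)); first by exists (f y), y.
  apply: gen => _ [x <-]; split; [by exists (h x)|by exists (v x)].
have inj : injective f.
  apply/injectiveP/card_uniqP; rewrite size_codom; apply: eq_card => y.
  by rewrite inE; have [x <-] := onto y; rewrite codom_f.
exists (perm inj); split; apply/permP=> y; have [x <-] := onto y.
  by rewrite -[f x](permE inj) permJ !permE fh.
by rewrite -[f x](permE inj) permJ !permE fv.
Qed.

(** * From a linear symmetry to a permutation of the squares *)

Section LinearImage.
Variables (R : realType) (A : 'M[R]_2) (hA : \det A = 1).

Lemma act_cut X Y : cut X Y -> cut (act hA X) (act hA Y).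
Proof.
case=> [[f bf mf]|[h [a [t [bh ht nx gl [vo [v1 v2]]]]]]|[h [a [b [bh ab nx gl vo]]]]].
- apply: Or31; exists f => // d; have [h1 h2 h3] := mf d; split=> //=.
  by rewrite h3.
- apply: Or32; exists h, a, t; split=> //; split=> /=; first by move=> d da da'; rewrite vo.
  by rewrite v1 v2 !scalemxAr.
- by apply: Or33; exists h, a, b; split=> //= d; rewrite vo.
Qed.

Lemma act_equiv X Y : cut_paste_equiv X Y -> cut_paste_equiv (act hA X) (act hA Y).
Proof.
elim=> {X Y} [X Y /act_cut|X|X Y _|X Y Z _ h1 _ h2].
- exact: rst_step.
- exact: rst_refl.
- exact: rst_sym.
- exact: rst_trans h1 h2.
Qed.

Lemma mulmx2E (p : 'cV[R]_2) : ((A *m p) 0 0 = A 0 0 * p 0 0 + A 0 1 * p 1 0) *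
  ((A *m p) 1 0 = A 1 0 * p 0 0 + A 1 1 * p 1 0).
Proof.
by split; rewrite !mxE !big_ord_recl !big_ord0 !addr0;
  congr (_ + A _ _ * p _ _); apply: val_inj.
Qed.

Lemma det2E : A 0 0 * A 1 1 - A 1 0 * A 0 1 = 1.
Proof. by rewrite -hA det_mx22 [A 1 0 * _]mulrC. Qed.

Variable K : R -> Prop.
Hypotheses (hK : dense_subring K) (KA : forall i j, K (A i j)).

Lemma Kvec_act (w : 'cV[R]_2) : Kvec K w -> Kvec K (A *m w).
Proof.
by case=> wx wy; split; rewrite mulmx2E; apply: denseD => //; apply: (denseM hK).
Qed.

Lemma over_act X : over K X -> over K (act hA X).
Proof. by move=> oX d; apply: Kvec_act. Qed.

Lemma generic_act p : generic K p -> generic K (A *m p).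
Proof.
move=> gp k1 k2 k3 h1 h2 h3; rewrite !mulmx2E => e.
have [] := gp (k1 * A 0 0 + k2 * A 1 0) (k1 * A 0 1 + k2 * A 1 1) k3 _ _ h3.
- by apply: denseD => //; apply: (denseM hK).
- by apply: denseD => //; apply: (denseM hK).
- by rewrite -e; ring.
have := det2E => d1 e1 e2; split.
  rewrite -[k1]mulr1 -d1.
  transitivity ((k1 * A 0 0 + k2 * A 1 0) * A 1 1 - (k1 * A 0 1 + k2 * A 1 1) * A 1 0).
    by ring.
  by rewrite e1 e2; ring.
rewrite -[k2]mulr1 -d1.
transitivity ((k1 * A 0 1 + k2 * A 1 1) * A 0 0 - (k1 * A 0 0 + k2 * A 1 0) * A 0 1).
  by ring.
by rewrite e1 e2; ring.
Qed.

Variables (Q : translation_surface R) (hQ : made_of_unit_squares Q).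
Local Notation e1 := (e1 R).
Local Notation e2 := (e2 R).

(** The image of the downward vertical leaves the sheared square through the image of its bottom
    side, so [exits_good] applies. *)
Lemma good_act (e : bottom_side Q) p : interior p -> generic K p ->
  good K ((val e, A *m p) : pt (act hA Q)).
Proof.
move=> hp gp; have gAp := generic_act gp; split=> //.
have [hx /andP[y0 y1]] := hp.
apply: (exits_good (u := A *m (- e2)) (r := p 1 0) (c := p 0 0) hK) => //.
- by apply: over_act; apply: over_squares hQ _ hK.
- by apply: Kvec_act; apply: (KvecN hK); apply: Kvec_e2.
- rewrite scalemxAr -mulmxDr /= bottomP scalemxAr; congr (_ *m _).
  by apply: cV2_eq; rewrite !mxE /=; ring.
- rewrite /det2 /= bottomP !mulmx2E !mxE /=.
  rewrite (_ : _ - _ = - (A 0 0 * A 1 1 - A 1 0 * A 0 1)); last by ring.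
  by rewrite det2E ltrN10.
- move=> r hr; rewrite scalemxAr -mulmxDr => /act_onb; apply: (interior_off hQ).
  move: hr => /andP[r0 ry]; rewrite /interior !mxE /=; lra.
Qed.

Local Notation h := (hperm hQ).
Local Notation v := (vperm hQ).

(* Straight segments with displacement [u] act on the squares by [f], whatever
   the starting point; when it depends on the point, [f] ranges over [P]. *)
Definition translates_by (u : 'cV[R]_2) (P : {perm bottom_side Q} -> Prop) : Prop :=
  forall p, exists2 f, P f & forall e y, good K ((val e, p) : pt Q) ->
    tr K u 1 ((val e, p) : pt Q) y -> reb y (val (f e), p).

(** Every square carries a copy of [p0], and unit moves lead from one copy to any other. The
    simulation sends one copy to a position [p] in some square; the moves in [Q] keep that position,
    so copies of [p0] are matched with squares. Since [p] is not under control, [translates_by]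
    covers all positions. *)
Lemma symmetry_of_squares (Ph Pv : {perm bottom_side Q} -> Prop) p0 :
  simulates K (act hA Q) Q -> interior p0 -> generic K p0 ->
  translates_by (A *m e1) Ph -> translates_by (A *m e2) Pv ->
  exists a b (psi : bottom_side Q -> bottom_side Q), [/\ Ph a, Pv b,
    forall e, psi (h e) = a (psi e) & forall e, psi (v e) = b (psi e)].
Proof.
move=> [C sC] ip gp th tv.
have [d0 _] := connectedP Q.
have bottom d : exists e : bottom_side Q, exists i, val e = iter i (next Q) d.
  have [||i hi] := @turns_to_e1 _ _ (vec Q) (next Q) false _ _ d.
  - by move=> x; rewrite expr0 scale1r vec_next.
  - exact: axial_side.
  - by exists (@exist _ (fun d => vec Q d == e1) _ (introT eqP hi)), i.
have [e0 _] := bottom d0.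
have [[d q] Cdq] := sim_total sC (good_act e0 ip gp).
have [f0 [i ef]] := bottom d; pose p := q - scorner Q d i.
have C0 : C (val e0, A *m p0) (val f0, p).
  apply: (sim_reb sC) Cdq (reb_refl _) _.
  by exists i; rewrite iter_rebase ef.
have [a Pa ha] := th p; have [b Pb hb] := tv p.
have step u (k : {perm bottom_side Q}) (f e e' : bottom_side Q) : Kvec K u ->
    tr K u 1 ((val e, p0) : pt Q) (val e', p0) ->
    (forall e y, good K ((val e, p) : pt Q) ->
       tr K (A *m u) 1 ((val e, p) : pt Q) y -> reb y (val (k e), p)) ->
    C (val e, A *m p0) (val f, p) -> C (val e', A *m p0) (val (k f), p).
  move=> ku htr hk Cef; have [_ gf] := sim_good sC Cef.
  have [y try Cy] := sim_tr sC (Kvec_act ku) Cef (act_tr hA htr).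
  exact: (sim_reb sC) Cy (reb_refl _) (hk f y gf try).
have hstep (e f : bottom_side Q) (c : C (val e, A *m p0) (val f, p)) :=
  step e1 a f e (h e) (Kvec_e1 hK) (tr_right hQ e hK ip) ha c.
have vstep (e f : bottom_side Q) (c : C (val e, A *m p0) (val f, p)) :=
  step e2 b f e (v e) (Kvec_e2 hK) (tr_above hQ e hK ip) hb c.
have total : forall e : bottom_side Q, exists f : bottom_side Q, C (val e, A *m p0) (val f, p).
  apply: (@squares_transitive _ _ hQ
    (fun e => exists f : bottom_side Q, C (val e, A *m p0) (val f, p))); first by exists e0, f0.
  move=> e [f Cef]; split; [exists (a f)|exists (b f)].
    exact: hstep.
  exact: vstep.
have [psi hpsi] := choice total.
have fun_ (e f f' : bottom_side Q) : C (val e, A *m p0) (val f, p) -> C (val e, A *m p0) (val f', p) -> f = f'.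
  move=> c c'; have [k] := sim_fun sC c c'; rewrite iter_rebase => -[ek _].
  by apply/esym; apply: (bottom_iter hQ ek).
exists a, b, psi; split=> // e; apply: fun_ (hpsi _) _.
  exact: hstep.
exact: vstep.
Qed.

End LinearImage.

(** * The two shears *)

Section Veech.
Variables (R : realType) (Q : translation_surface R) (hQ : made_of_unit_squares Q).
Local Notation e1 := (e1 R).
Local Notation e2 := (e2 R).
Local Notation h := (hperm hQ).
Local Notation v := (vperm hQ).

Lemma symmetry_of_act (A : 'M[R]_2) (hA : \det A = 1)
  (Ph Pv : {perm bottom_side Q} -> Prop) :
  cut_paste_equiv (act hA Q) Q ->
  (forall K, dense_subring K -> translates_by K (A *m e1) Ph) ->
  (forall K, dense_subring K -> translates_by K (A *m e2) Pv) ->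
  exists a b (psi : bottom_side Q -> bottom_side Q), [/\ Ph a, Pv b,
    forall e, psi (h e) = a (psi e) & forall e, psi (v e) = b (psi e)].
Proof.
move=> /cut_paste_simulates [F hF] th tv.
(* The ring must also contain the entries of [A], so that the sheared surface and the sheared
   directions are defined over it. *)
pose G := F ++ [seq A ij.1 ij.2 | ij <- enum {: 'I_2 * 'I_2}].
have hK := generated_dense G.
have KA i j : generated G (A i j).
  apply: generated_mem; rewrite mem_cat; apply/orP; right.
  by apply: (map_f (fun ij : 'I_2 * 'I_2 => A ij.1 ij.2) (x := (i, j))); rewrite mem_enum.
have oQ := over_squares hQ hK.
have [p ip gp] := generic_point G.
have [|sim _] := hF _ hK _ (over_act hK KA oQ) oQ.
  by move=> x hx; apply: generated_mem; rewrite mem_cat hx.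
exact: (symmetry_of_squares hK KA hQ sim ip gp (th _ hK) (tv _ hK)).
Qed.

Lemma translates_e1 K : dense_subring K -> translates_by (Q := Q) K e1 (eq h).
Proof. by move=> hK p; exists h => // e y; apply: tr_square_e1. Qed.

Lemma translates_e2 K : dense_subring K -> translates_by (Q := Q) K e2 (eq v).
Proof. by move=> hK p; exists v => // e y; apply: tr_square_e2. Qed.

Lemma translates_diagonal K : dense_subring K ->
  translates_by (Q := Q) K (e1 + e2) (fun f => f = v * h \/ f = h * v)%g.
Proof.
move=> hK p; exists (if p 0 0 < p 1 0 then (v * h)%g else (h * v)%g).
  by case: ifP; [left|right].
move=> e y ge /(tr_square_diagonal hQ hK ge).
by case: ifP => _; rewrite permM.
Qed.

Definition upper_shear : 'M[R]_2 := \matrix_(i, j) (if (i == 1) && (j == 0) then 0 else 1).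
Definition lower_shear : 'M[R]_2 := \matrix_(i, j) (if (i == 0) && (j == 1) then 0 else 1).

Lemma upper_shearE : [/\ \det upper_shear = 1, upper_shear *m e1 = e1 &
  upper_shear *m e2 = e1 + e2].
Proof.
split; first by rewrite det_mx22 !mxE /=; ring.
  by apply: cV2_eq; rewrite !mulmx2E !mxE /=; ring.
by apply: cV2_eq; rewrite !mulmx2E !mxE /=; ring.
Qed.

Lemma lower_shearE : [/\ \det lower_shear = 1, lower_shear *m e1 = e1 + e2 &
  lower_shear *m e2 = e2].
Proof.
split; first by rewrite det_mx22 !mxE /=; ring.
  by apply: cV2_eq; rewrite !mulmx2E !mxE /=; ring.
by apply: cV2_eq; rewrite !mulmx2E !mxE /=; ring.
Qed.

Lemma Veech_square (X : translation_surface R) A : cut_paste_equiv X Q ->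
  Veech_group X A -> exists hA : \det A = 1, cut_paste_equiv (act hA Q) Q.
Proof.
move=> XQ [hA AX]; exists hA.
apply: rst_trans (rst_sym _ _ _ _ (act_equiv hA XQ)) _.
exact: rst_trans AX XQ.
Qed.

(** Whether the diagonal move is [v * h] or [h * v] depends on the position of the point. The two
    products are conjugate by [h], so a correction that commutes with [h] gives [h * v], the order
    for which the commutator is fixed. *)
Lemma upper_symmetry (hA : \det upper_shear = 1) : cut_paste_equiv (act hA Q) Q ->
  exists psi : {perm bottom_side Q}, (h ^ psi = h /\ v ^ psi = h * v)%g.
Proof.
have [_ ae1 ae2] := upper_shearE => eqv.
have [||a [b [f [<- hb fh fv]]]] := symmetry_of_act (Ph := eq h)
    (Pv := fun f => f = v * h \/ f = h * v)%g eqv.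
- by move=> K hK; rewrite ae1; apply: translates_e1.
- by move=> K hK; rewrite ae2; apply: translates_diagonal.
have [|psi [ph pv]] := intertwiner_perm (squares_transitive (hQ := hQ)) _ fh fv.
  move=> P cl; have clh x : P x -> P (h x) by case/cl.
  have clV := perm_closedV clh.
  move=> x px; split; first exact: clh.
  case: hb cl => -> cl.
    have := clV _ (cl x px).2; rewrite permM; rewrite permK //.
  by have := (cl _ (clV _ px)).2; rewrite permM permKV.
case: hb pv => -> pv; last by exists psi.
exists (psi * h^-1)%g; rewrite !conjgM ph pv; split.
  by rewrite conjgE invgK mulgV mulg1.
by rewrite conjgE invgK mulgK.
Qed.

(** Here the two possible products are conjugate by [v], and the correction selects [v * h]. *)
Lemma lower_symmetry (hA : \det lower_shear = 1) : cut_paste_equiv (act hA Q) Q ->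
  exists chi : {perm bottom_side Q}, (h ^ chi = v * h /\ v ^ chi = v)%g.
Proof.
have [_ ae1 ae2] := lower_shearE => eqv.
have [||a [b [f [ha <- fh fv]]]] := symmetry_of_act (Pv := eq v)
    (Ph := fun f => f = v * h \/ f = h * v)%g eqv.
- by move=> K hK; rewrite ae1; apply: translates_diagonal.
- by move=> K hK; rewrite ae2; apply: translates_e2.
have [|chi [ch cv]] := intertwiner_perm (squares_transitive (hQ := hQ)) _ fh fv.
  move=> P cl; have clv x : P x -> P (v x) by case/cl.
  have clV := perm_closedV clv.
  move=> x px; split; last exact: clv.
  case: ha cl => -> cl.
    by have := (cl _ (clV _ px)).1; rewrite permM permKV.
  by have := clV _ (cl x px).1; rewrite permM permK.
case: ha ch => -> ch; first by exists chi.
exists (chi * v^-1)%g; rewrite !conjgM ch cv; split.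
  by rewrite conjgE invgK mulgK.
by rewrite conjgE invgK mulgV mulg1.
Qed.

End Veech.

Theorem theorem4p7 (R : realType) :
  ~ exists X : translation_surface R,
      [/\ square_tiled X, reduced X, has_genus X 2 &
          Veech_group X = SL2Z R].
Proof.
move=> [X [[Q hQ XQ] _ gX VX]].
have [d1 _ _] := upper_shearE R; have [d2 _ _] := lower_shearE R.
have int (P : 'I_2 -> 'I_2 -> bool) i j :
    (\matrix_(i, j) (if P i j then 0 else 1) : 'M[R]_2) i j \is a Num.int.
  by rewrite mxE; case: ifP; rewrite ?rpred0 ?rpred1.
have [hU eU] : exists hA : \det (upper_shear R) = 1, cut_paste_equiv (act hA Q) Q.
  by apply: (Veech_square XQ); rewrite VX; split=> // i j; apply: int.
have [hL eL] : exists hA : \det (lower_shear R) = 1, cut_paste_equiv (act hA Q) Q.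
  by apply: (Veech_square XQ); rewrite VX; split=> // i j; apply: int.
have [psi [hpsi vpsi]] := upper_symmetry hQ eU.
have [chi [hchi vchi]] := lower_symmetry hQ eL.
have gQ : has_genus Q 2 by rewrite /has_genus (cut_paste_euler XQ).
exact: (no_symmetric_genus2_monodromy (squares_transitive (hQ := hQ)) hpsi vpsi hchi vchi
  (genus2_squares hQ gQ)).
Qed.
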